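(* Let $k$ be any positive integer. Then \[\widetilde H_{k-1}(\mathsf M_3(3k+1))\cong_{S_{3k+1}}\bigoplus_{\lambda\in\Lambda(k)}\mathcal S^\lambda,\] where $\Lambda(k)$ is the set of all partitions of $3k+1$ into exactly $k+1$ parts, all of them odd.
   Context: $\mathsf M_3(n)$ is the simplicial complex with one vertex for each $3$-element subset of $[n]=\{1,\dots,n\}$, a collection of vertices being a face iff the subsets are pairwise disjoint; $S_n$ acts on it via its action on $[n]$. $\widetilde H_i$ is reduced simplicial homology with complex coefficients, viewed as a $\mathbb C[S_n]$-module; $\cong_{S_n}$ denotes isomorphism of $\mathbb C[S_n]$-modules. $\mathcal S^\lambda$ is the Specht module (irreducible complex representation) of the symmetric group indexed by $\lambda$, with $\mathcal S^{(n)}$ the trivial representation. *)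

(* Defs.v *)
From HB Require Import structures.
From mathcomp Require Import all_boot all_order all_algebra all_fingroup.
From mathcomp Require Import mxrepresentation character.

Set Implicit Arguments.
Unset Strict Implicit.
Unset Printing Implicit Defensive.

Import GroupScope GRing.Theory.
Local Open Scope ring_scope.

(* MathComp representations act on row vectors from the right, and permutations
   compose from left to right: (s * t) x = t (s x).  Hence v |-> v *m rG s is
   the usual left action of the permutation s, where s acts before t in s * t. *)

Section FreeModule.
Variables (F : fieldType) (T : finType).

Definition basis_vec (x : T) : 'rV[F]_#|T| := delta_mx 0 (enum_rank x).

(* The matrix of the linear map sending the basis vector of x to f x. *)
Definition lin_ext m (f : T -> 'rV[F]_m) : 'M[F]_(#|T|, m) :=
  \matrix_(i < #|T|) f (enum_val i).

Lemma basis_lin_ext m (f : T -> 'rV[F]_m) x : basis_vec x *m lin_ext f = f x.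
Proof. by rewrite /basis_vec -rowE rowK enum_rankK. Qed.

Lemma basis_vec_ext m (A B : 'M[F]_(#|T|, m)) :
  (forall x, basis_vec x *m A = basis_vec x *m B) -> A = B.
Proof.
move=> eqAB; apply/row_matrixP => i.
by have := eqAB (enum_val i); rewrite /basis_vec enum_valK -!rowE.
Qed.

Variables (gT : finGroupType) (G : {group gT}) (to : {action gT &-> T}).

Definition perm_repr_mx (g : gT) : 'M[F]_#|T| :=
  lin_ext (fun x => basis_vec (to x g)).

Lemma perm_repr_mxP : mx_repr G perm_repr_mx.
Proof.
split=> [|g h _ _]; apply: basis_vec_ext => x.
  by rewrite basis_lin_ext act1 mulmx1.
by rewrite mulmxA !basis_lin_ext actM.
Qed.

Definition perm_repr : mx_representation F G #|T| :=
  MxRepresentation perm_repr_mxP.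

Lemma perm_reprE x g : basis_vec x *m perm_repr g = basis_vec (to x g).
Proof. exact: basis_lin_ext. Qed.

Lemma sum_mxmodule (I : finType) (P : pred I) (v : I -> 'rV[F]_#|T|) :
  (forall g i, g \in G -> P i ->
     (v i *m perm_repr g <= (\sum_(j | P j) <<v j>>))%MS) ->
  mxmodule perm_repr (\sum_(i | P i) <<v i>>)%MS.
Proof.
move=> sP; apply/mxmoduleP => g Gg.
rewrite sumsmxMr; apply/sumsmx_subP => i Pi.
by rewrite (eqmxMr _ (genmxE _)) sP.
Qed.

End FreeModule.

Section TupleAction.
Variables (T : finType) (gT : finGroupType) (to : {action gT &-> T}) (p : nat).

Definition tuple_act (s : p.-tuple T) (g : gT) : p.-tuple T :=
  map_tuple (to^~ g) s.

Lemma tuple_act_is_action : is_action [set: gT] tuple_act.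
Proof.
apply: is_total_action => [s|s g h]; apply: eq_from_tnth => i;
  by rewrite !tnth_map ?act1 ?actM.
Qed.

Canonical tuple_action := Action tuple_act_is_action.

End TupleAction.

Record simplicial_complex (V : finType) := SimplicialComplex {
  faces :> {set {set V}};
  faces_set0 : set0 \in faces;
  faces_subset : forall s t : {set V}, s \subset t -> t \in faces -> s \in faces
}.

(* The p-th chain space of K (chains of dimension p - 1, so that p = 0 is the
   augmentation degree) is the textbook space of oriented simplices: it is
   spanned by the orderings of the p-element faces of K, modulo
   [v_(s 0), ..., v_(s (p-1))] = sgn(s) [v_0, ..., v_(p-1)].  Everything is
   expressed inside the free module on all p-tuples of vertices: the chain space
   is ordered_chains p / orientation_rels p, and cycles and boundaries are the
   inverse images in ordered_chains of the cycles and boundaries in the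
   quotients. *)
Section Homology.
Variables (F : fieldType) (V : finType) (K : simplicial_complex V).

Definition ordered_simplices p : {set p.-tuple V} :=
  [set s : p.-tuple V | uniq s & [set:: s] \in faces K].

Definition tuple_perm p (s : p.-tuple V) (u : 'S_p) : p.-tuple V :=
  [tuple tnth s (u i) | i < p].

Definition tuple_del p (s : p.+1.-tuple V) (j : 'I_p.+1) : p.-tuple V :=
  [tuple tnth s (lift j i) | i < p].

Definition ordered_chains p : 'M[F]_#|{: p.-tuple V}| :=
  (\sum_(s in ordered_simplices p) <<basis_vec F s>>)%MS.

Definition orientation_rel p (s : p.-tuple V) (u : 'S_p) :=
  basis_vec F (tuple_perm s u) - (-1) ^+ u *: basis_vec F s.

Definition orientation_rels p : 'M[F]_#|{: p.-tuple V}| :=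
  (\sum_(su : p.-tuple V * 'S_p | su.1 \in ordered_simplices p)
     <<orientation_rel su.1 su.2>>)%MS.

Definition boundary_map p : 'M[F]_(#|{: p.+1.-tuple V}|, #|{: p.-tuple V}|) :=
  lin_ext (fun s => \sum_(j < p.+1) (-1) ^+ j *: basis_vec F (tuple_del s j)).

(* A row vector v satisfies v *m cokermx A = 0 iff v is in the row space of A. *)
Definition cycles i : 'M[F]_#|{: i.+1.-tuple V}| :=
  (ordered_chains i.+1 :&:
   kermx (boundary_map i *m cokermx (orientation_rels i)))%MS.

Definition boundaries i : 'M[F]_#|{: i.+1.-tuple V}| :=
  (ordered_chains i.+2 *m boundary_map i.+1 + orientation_rels i.+1)%MS.

Variables (gT : finGroupType) (G : {group gT}) (to : {action gT &-> V}).
Hypothesis GK : [acts G, on K | to^*].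

Definition tuple_repr p : mx_representation F G #|{: p.-tuple V}| :=
  perm_repr F G (tuple_action to p).

Lemma ordered_simplices_act p (s : p.-tuple V) g :
  g \in G -> s \in ordered_simplices p ->
  tuple_act to s g \in ordered_simplices p.
Proof.
move=> Gg; rewrite !inE => /andP[Us Ks]; apply/andP; split.
  by rewrite map_inj_uniq //; apply: act_inj.
rewrite -(acts_act GK Gg) in Ks; rewrite (_ : [set:: _] = to^*%act [set:: s] g) //.
apply/setP=> x; rewrite inE; apply/mapP/imsetP=> -[y sy ->];
  by exists y; rewrite // ?inE in sy *.
Qed.

Lemma ordered_chains_module p : mxmodule (tuple_repr p) (ordered_chains p).
Proof.
apply: sum_mxmodule => g s Gg Ks; rewrite (perm_reprE _ G).
by rewrite (sumsmx_sup (tuple_act to s g)) ?genmxE ?ordered_simplices_act.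
Qed.

Lemma orientation_rels_module p :
  mxmodule (tuple_repr p) (orientation_rels p).
Proof.
apply: sum_mxmodule => g [s u] Gg /= Ks.
rewrite (sumsmx_sup (tuple_act to s g, u)) ?ordered_simplices_act // genmxE.
rewrite /orientation_rel mulmxBl -scalemxAl  !(perm_reprE _ G).
suff -> : tuple_perm (tuple_act to s g) u = tuple_act to (tuple_perm s u) g.
  exact: submx_refl.
by apply: eq_from_tnth => i; rewrite !(tnth_map, tnth_ord_tuple).
Qed.

Lemma boundary_map_equiv p g :
  tuple_repr p.+1 g *m boundary_map p = boundary_map p *m tuple_repr p g.
Proof.
apply: basis_vec_ext => s; rewrite !mulmxA (perm_reprE _ G) !basis_lin_ext mulmx_suml.
apply: eq_bigr => j _; rewrite -scalemxAl (perm_reprE _ G); congr (_ *: basis_vec F _).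
by apply: eq_from_tnth => i; rewrite !(tnth_map, tnth_ord_tuple).
Qed.

Lemma cycles_module i : mxmodule (tuple_repr i.+1) (cycles i).
Proof.
apply: capmx_module; first exact: ordered_chains_module.
apply/mxmoduleP => g Gg; apply/sub_kermxP.
set C := cokermx _; set Z := kermx _.
have sZ : (Z *m boundary_map i <= orientation_rels i)%MS.
  by rewrite submxE -mulmxA mulmx_ker.
rewrite mulmxA -(mulmxA Z) boundary_map_equiv (mulmxA Z).
apply/eqP; rewrite -submxE (submx_trans (submxMr _ sZ)) //.
exact: (mxmoduleP (orientation_rels_module i)).
Qed.

Lemma boundaries_module i : mxmodule (tuple_repr i.+1) (boundaries i).
Proof.
apply: addsmx_module; last exact: orientation_rels_module.
apply/mxmoduleP => g Gg; rewrite -mulmxA -boundary_map_equiv mulmxA.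
by rewrite submxMr // (mxmoduleP (ordered_chains_module _)).
Qed.

(* The reduced homology of K in degree i >= 0, namely cycles i / boundaries i. *)
Definition reduced_homology i :=
  section_repr (boundaries_module i) (cycles_module i).

End Homology.

(* The vertices v of the complex are those with [set v] a face: the r-element
   subsets of 'I_n. *)
Section MatchingComplex.
Variables (r n : nat).

Definition matching_faces : {set {set {set 'I_n}}} :=
  [set s : {set {set 'I_n}} | [forall A in s, #|A| == r] & trivIset s].

Lemma matching_faces_set0 : set0 \in matching_faces.
Proof.
rewrite inE; apply/andP; split; first by apply/forall_inP=> A; rewrite inE.
by apply/trivIsetP=> A B; rewrite inE.
Qed.

Lemma matching_faces_subset (s t : {set {set 'I_n}}) :
  s \subset t -> t \in matching_faces -> s \in matching_faces.
Proof.
move=> st; rewrite !inE => /andP[/forall_inP rt tt]; apply/andP; split.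
  by apply/forall_inP=> A sA; rewrite rt ?(subsetP st).
exact: trivIsetS tt.
Qed.

Definition matching_complex :=
  SimplicialComplex matching_faces_set0 matching_faces_subset.

Lemma matching_complex_acts :
  [acts [set: 'S_n], on matching_complex | ('P^*)^*].
Proof.
apply/actsP=> g _ s.
have imp h (t : {set {set 'I_n}}) : t \in matching_faces ->
    (('P^*)^*)%act t h \in matching_faces.
  rewrite !inE => /andP[/forall_inP rt /trivIsetP tt]; apply/andP; split.
    by apply/forall_inP=> _ /imsetP[A tA ->]; rewrite card_setact rt.
  apply/trivIsetP=> _ _ /imsetP[A tA ->] /imsetP[B tB ->] neAB.
  rewrite -setI_eq0 /= /setact -imsetI; last by move=> x y _ _; apply: act_inj.
  rewrite imset_eq0 setI_eq0 tt //.
  by apply: contraNneq neAB => ->.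
apply/idP/idP=> [Ks|]; last exact: imp.
by rewrite -(actK (('P^*)^*)%act g s); apply: imp.
Qed.

End MatchingComplex.

Section FunAction.
Variables (n : nat) (X : finType).

Definition fun_act (f : {ffun 'I_n -> X}) (g : 'S_n) : {ffun 'I_n -> X} :=
  [ffun x => f (g^-1%g x)].

Lemma fun_act_is_action : is_action [set: 'S_n] fun_act.
Proof.
apply: is_total_action => [f|f g h]; apply/ffunP=> x;
  by rewrite !ffunE ?invg1 ?perm1 // invMg permM.
Qed.

Canonical fun_action := Action fun_act_is_action.

End FunAction.

(* Partitions of n, padded with zeros to length n; parts lists the actual
   (nonzero) parts. *)
Definition intpart n :=
  {l : {ffun 'I_n -> 'I_n.+1} |
    [forall i : 'I_n, forall j : 'I_n, (i <= j)%N ==> (l j <= l i)%N]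
    && (\sum_i l i == n)%N}.

Definition parts n (l : intpart n) : seq nat :=
  [seq m <- [seq nat_of_ord (val l i) | i <- enum 'I_n] | (0 < m)%N].

(* A tableau of shape l is given by the bijection sending each entry x of 'I_n
   to the cell (row, column) that contains it (injectivity suffices, the diagram
   having n cells). A tabloid, i.e. a tableau up to permutation of the entries
   within rows, is given by the map sending each entry to its row.  With these
   encodings the tableau obtained from t by applying g to its entries is
   fun_act t g, and likewise for tabloids. *)
Section Specht.
Variables (F : fieldType) (n : nat).
Implicit Type t : {ffun 'I_n -> 'I_n * 'I_n}.

Definition tableaux (l : intpart n) : {set {ffun 'I_n -> 'I_n * 'I_n}} :=
  [set t : {ffun 'I_n -> 'I_n * 'I_n} |
    injectiveb t & [forall x, ((t x).2 < val l (t x).1)%N]].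

Definition tabloid t : {ffun 'I_n -> 'I_n} := [ffun x => (t x).1].

Definition col_stab t : {set 'S_n} :=
  [set u : 'S_n | [forall x, (t (u x)).2 == (t x).2]].

Definition polytabloid t : 'rV[F]_#|{: {ffun 'I_n -> 'I_n}}| :=
  \sum_(u in col_stab t) (-1) ^+ u *: basis_vec F (tabloid (fun_act t u)).

Definition tabloid_repr : mx_representation F [set: 'S_n] _ :=
  perm_repr F [set: 'S_n] (fun_action n 'I_n).

Variable l : intpart n.

Definition specht_mx : 'M[F]_#|{: {ffun 'I_n -> 'I_n}}| :=
  (\sum_(t in tableaux l) <<polytabloid t>>)%MS.

Lemma tableaux_act t g : t \in tableaux l -> fun_act t g \in tableaux l.
Proof.
rewrite !inE => /andP[/injectiveP It /forallP lt]; apply/andP; split.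
  by apply/injectiveP=> x y; rewrite !ffunE => /It /perm_inj.
by apply/forallP=> x; rewrite ffunE.
Qed.

Lemma polytabloid_act t g :
  polytabloid t *m tabloid_repr g = polytabloid (fun_act t g).
Proof.
rewrite mulmx_suml [RHS](reindex_inj (conjg_inj g)) /=.
apply: eq_big => [u|u _].
  rewrite !inE; apply/forallP/forallP=> H x.
    by rewrite !ffunE !permM permK.
  by have := H (g x); rewrite !ffunE !permM !permK.
rewrite -scalemxAl (perm_reprE _ [set: 'S_n]%G) [odd_perm (_ ^ _)]odd_permJ.
congr (_ *: basis_vec F _).
apply/ffunP=> x; rewrite !ffunE; congr (t _).1.
by rewrite -conjVg conjgE !permM permK.
Qed.

Lemma specht_module : mxmodule tabloid_repr specht_mx.
Proof.
apply: sum_mxmodule => g t _ lt; rewrite polytabloid_act.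
by rewrite (sumsmx_sup (fun_act t g)) ?genmxE ?tableaux_act.
Qed.

Definition specht_repr : representation F [set: 'S_n] :=
  Representation (submod_repr specht_module).

End Specht.

(* Main.v *)
(* As a maximum matching leaves just one of the n = 3k+1 points uncovered, the
   homology is the space H of cycles among the alternating top chains.

   The Laplacian sends a maximum matching f with uncovered point v to k f plus
   the sum of the (p v) f, p <> v.  So modulo its image the Jucys-Murphy element
   at v acts on f by -k, and an S_n-module containing such an eigenvector has a
   nonzero vector antisymmetric under k+1 points.  Since by the pigeonhole
   principle every antisymmetrization over k+1 points is a cycle, and the
   Laplacian is symmetric and kills cycles, H consists of these
   antisymmetrizations.  It is generated by a single one, w.

   The projections of w to the summands of a decomposition of H inherit its
   symmetries.  A cycle with these symmetries is determined by its coefficients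
   at the matchings with one base point in each triple; on the other 2k points
   such a matching amounts, by orienting a 2-regular multigraph, to a permutation
   of k triples up to conjugacy.  So H has at most as many summands as S_k has
   classes, i.e. as there are partitions mu of k, or partitions l_i = 2 mu_i + 1
   of 3k+1 into k+1 odd parts.  Conversely S^l embeds in H for each such l, by
   cutting the rows of a tableau into triples, the image of a polytabloid being
   nonzero as no cancellation occurs.  Hence H is the sum of these S^l. *)

Require Import Defs.
From mathcomp Require Import all_boot all_order all_algebra all_fingroup.
From mathcomp Require Import mxrepresentation character reals complex.
From mathcomp Require Import pgroup zify.

Set Implicit Arguments.
Unset Strict Implicit.
Unset Printing Implicit Defensive.

Import GroupScope Order.TTheory GRing.Theory Num.Theory.
Local Open Scope ring_scope.

(** * Jucys-Murphy eigenvectors *)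

(** The eigenvalues of a Jucys-Murphy element are the contents of corner cells, so -k can only come
    from a diagram with at least k+1 rows; this is where antisymmetry over k+1 points originates.
    The proof gets there without the branching rule, by a highest-weight argument: among the
    eigenvectors fixed by a row stabilizer, one whose row sizes have the largest sum of squares is
    chosen, and an invariant Hermitian form supplies the missing inequality. Positivity enters a
    second time to separate the image of the Laplacian from its kernel; both uses need a field with
    conjugation. No summand of H is identified from inside: a bound on their number is enough, since
    the embedded Specht modules are pairwise nonisomorphic and already reach it. Chains are stored
    as words in k+1 letters, the last letter marking uncovered points: S_n permutes positions,
    reordering a simplex permutes letters, and taking a face merges two letters. *)

Section Covariance.
Variables (F : fieldType) (n d : nat).
Variable rG : mx_representation F [set: 'S_n] d.
Implicit Types (e : bool) (K : {set 'S_n}) (z : 'rV[F]_d).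

(** The boolean chooses between the trivial character ([false]) and the sign ([true]), so that
    symmetrizing and antisymmetrizing share one coset argument. *)
Definition chi e (g : 'S_n) : F := (-1) ^+ (e && g).

Lemma chiM e : {morph chi e : g h / (g * h)%g >-> g * h}.
Proof. by move=> g h; rewrite /chi; case: e; rewrite /= ?mulr1 // odd_permM signr_addb. Qed.

Lemma chi_sqr e g : chi e g * chi e g = 1.
Proof. by rewrite /chi -signr_addb addbb. Qed.

Lemma reprM z g h : z *m rG (g * h)%g = z *m rG g *m rG h.
Proof. by rewrite repr_mxM ?inE // mulmxA. Qed.

Lemma repr1 z : z *m rG 1%g = z.
Proof. by rewrite repr_mx1 mulmx1. Qed.

Definition covariant e K z := forall g, g \in K -> z *m rG g = chi e g *: z.

(* The transpositions (p b), b in A, are coset representatives of K in K'. *)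
Lemma covariant_extend e K K' (p : 'I_n) (A : {set 'I_n}) z :
    {in K' & A, forall (g : 'S_n) b, g b \in A} ->
    {in K' & A, forall (g : 'S_n) b, (tperm p b * g * tperm p (g b))%g \in K} ->
  covariant e K z ->
  covariant e K' (\sum_(b in A) chi e (tperm p b) *: (z *m rG (tperm p b))).
Proof.
move=> stabA decK covz g K'g; rewrite mulmx_suml scaler_sumr.
rewrite [RHS](reindex_inj (@perm_inj _ g)) /=.
apply: eq_big => [b|b Ab].
  apply/idP/idP => [Ab|Agb]; first exact: stabA.
  have im: g @: A = A.
    apply/eqP; rewrite eqEcard card_imset ?leqnn ?andbT; last exact: perm_inj.
    by apply/subsetP=> _ /imsetP[x Ax ->]; apply: stabA.
  by move: Agb; rewrite -[in X in X -> _]im mem_imset //; apply: perm_inj.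
set h := (tperm p b * g * tperm p (g b))%g.
have hE: (tperm p b * g = h * tperm p (g b))%g by rewrite /h -!mulgA tperm2 mulg1.
rewrite -scalemxAl -reprM hE reprM (covz h) ?decK // -scalemxAl !scalerA.
congr (_ *: _).
have chE: chi e h * chi e (tperm p (g b)) = chi e (tperm p b) * chi e g.
  by rewrite -!chiM hE.
rewrite -[LHS]mulr1 -(chi_sqr e (tperm p (g b))) -mulrA [chi e h * _]mulrA chE.
by rewrite !mulrA chi_sqr mul1r.
Qed.

(** The product sends [p] to [b], to [g b] and back to [p]; it thus fixes [p] and moves only points
    of [A]. *)
Lemma Sym_conj_tperm (p : 'I_n) (A : {set 'I_n}) :
  {in Sym (p |: A) & p |: A, forall (g : 'S_n) b, (tperm p b * g * tperm p (g b))%g \in Sym A}.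
Proof.
move=> g b; rewrite inE => onA Ab; rewrite inE.
have Agb: g b \in p |: A by rewrite (perm_closed _ onA).
have tp c: c \in p |: A -> perm_on (p |: A) (tperm p c).
  move=> Ac; apply: subset_trans (tperm_on p c) _.
  by apply/subsetP=> x; rewrite !inE => /orP[] /eqP->; rewrite ?eqxx // -in_setU1.
have onh: perm_on (p |: A) (tperm p b * g * tperm p (g b))%g.
  by rewrite !perm_onM ?tp.
apply/subsetP=> x; rewrite inE => hx.
have: x \in p |: A by apply: contraR hx => /(out_perm onh) ->.
rewrite inE in_set1 => /orP[/eqP xp|//].
by move: hx; rewrite xp !permM tpermL tpermR eqxx.
Qed.

Lemma Sym_closed (A : {set 'I_n}) : {in Sym A & A, forall (g : 'S_n) b, g b \in A}.
Proof. by move=> g b; rewrite inE => onA Ab; rewrite (perm_closed _ onA). Qed.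

Section Transversal.
Variables (T : eqType) (rho : 'I_n -> T).

(** For [z] fixed under the permutations of row [i] and [b] outside that row, this Garnir relation
    says that symmetrizing [z] over the row enlarged by [b] gives 0. *)
Definition garnir (i : T) (b : 'I_n) z :=
  \sum_(p | rho p == i) z *m rG (tperm p b) == - z.

(** The transposition [(p c)] fixes the points of row [i], which lie outside [D], and moves [b]
    within [D]; conjugating by it carries the relation at one point of [D] to the relation at
    another. *)
Lemma garnir_tperm (D : pred T) i z p c :
    ~~ D i -> D (rho p) -> D (rho c) ->
    (forall b, D (rho b) -> garnir i b z) ->
  forall b, D (rho b) -> garnir i b (z *m rG (tperm p c)).
Proof.
move=> nDi Dp Dc gz b Db.
have Dpc x : D (rho x) -> D (rho (tperm p c x)) by case: tpermP => // ->.
rewrite /garnir -mulNmx -(eqP (gz _ (Dpc _ Db))) mulmx_suml; apply/eqP.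
apply: eq_bigr => q /eqP rq; rewrite -!reprM; congr (_ *m rG _).
have qfix: tperm p c q = q.
  by apply: tpermD; apply: contraNneq nDi => pq; rewrite -rq -pq.
have := tpermJ q b (tperm p c); rewrite qfix => <-.
by rewrite conjgE tpermV !mulgA -!mulgA tperm2 mulg1.
Qed.

Lemma garnir_add i b z1 z2 : garnir i b z1 -> garnir i b z2 -> garnir i b (z1 + z2).
Proof.
rewrite /garnir => /eqP g1 /eqP g2; under eq_bigr do rewrite mulmxDl.
by rewrite big_split /= g1 g2 opprD.
Qed.

Lemma garnir_opp i b z : garnir i b z -> garnir i b (- z).
Proof.
by rewrite /garnir => /eqP gz; under eq_bigr do rewrite mulNmx; rewrite sumrN gz.
Qed.

Lemma garnir_sum i b (A : {set 'I_n}) (w : 'I_n -> 'rV_d) :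
  (forall a, a \in A -> garnir i b (w a)) -> garnir i b (\sum_(a in A) w a).
Proof.
move=> gw; apply: (big_ind (garnir i b)) => [||a /gw//]; last exact: garnir_add.
by rewrite /garnir big1 ?oppr0 // => p _; rewrite mul0mx.
Qed.

Hypothesis char0 : [pchar F] =i pred0.

(* Going through s from its end, a vector z antisymmetric in A is replaced by
   z - \sum_(b in A) z (p b), which is antisymmetric in p |: A; summing over the
   points p of the new row shows, by the relations, that one of these is nonzero. *)
Lemma transversal_antisym (s : seq T) z :
    z != 0 -> uniq s -> {in s, forall i, exists p, rho p = i} ->
    pairwise (fun i j => [forall b, (rho b == j) ==> garnir i b z]) s ->
  exists (A : {set 'I_n}) (z' : 'rV_d),
    [/\ z' != 0, #|A| = size s, covariant true (Sym A) z',
        {in A, forall b, rho b \in s} &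
        forall (i : T) (D : pred T), ~~ D i -> {subset s <= D} ->
          (forall b, D (rho b) -> garnir i b z) ->
          forall b, D (rho b) -> garnir i b z'].
Proof.
elim: s => [|i s IHs] /= nz.
  move=> *; exists set0, z; split=> // [|g|b]; rewrite ?cards0 ?inE //.
  move=> on0; suff -> : g = 1%g by rewrite repr1 /chi odd_perm1 scale1r.
  by apply/permP=> x; rewrite perm1 (out_perm on0) ?inE.
case/andP=> nsi us rowne /andP[gi ps].
case: (IHs nz us _ ps) => [j sj|A [y [nzy cardA covy As gy]]].
  by apply: rowne; rewrite inE sj orbT.
have giy b : b \in A -> garnir i b y.
  move=> Ab; apply: (gy i (mem s) _ _ _ b (As b Ab)) => // c sc.
  by have /forallP/(_ c)/implyP := allP gi _ sc; apply.
pose w p := \sum_(b in p |: A) chi true (tperm p b) *: (y *m rG (tperm p b)).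
have nAi p : rho p = i -> p \notin A.
  by move=> rp; apply: contra nsi => /As; rewrite rp.
have wE p : rho p = i -> w p = y - \sum_(b in A) y *m rG (tperm p b).
  move=> rp; rewrite /w big_setU1 ?nAi //= tperm1 /chi odd_perm1 scale1r repr1.
  congr (_ + _); rewrite -sumrN; apply: eq_bigr => b Ab.
  rewrite odd_tperm (_ : p != b) ?scaleN1r //.
  by apply: contraTneq Ab => <-; rewrite nAi.
have /existsP[p /andP[/eqP rp nzw]]: [exists p, (rho p == i) && (w p != 0)].
  apply: contraR nzy; rewrite negb_exists => /forallP w0.
  have: \sum_(p | rho p == i) w p = 0.
    apply: big1 => p rp; apply/eqP.
    by have := w0 p; rewrite rp negbK.
  rewrite (eq_bigr _ (fun p rp => wE p (eqP rp))) big_split /= sumrN exchange_big.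
  rewrite /= [X in _ - X](eq_bigr (fun=> - y)) => [|b Ab]; last by apply/eqP; apply: giy.
  rewrite (eq_bigl (fun p => p \in [set q | rho q == i])) => [|p]; last by rewrite inE.
  rewrite !sumr_const mulNrn opprK -mulrnDr => /eqP.
  rewrite -scaler_nat scaler_eq0 => /orP[|//].
  have [p0 rp0] := rowne i (mem_head _ _).
  rewrite ((pcharf0P F).1 char0) addn_eq0 => /andP[/eqP/card0_eq/(_ p0)].
  by rewrite !inE rp0 eqxx.
exists (p |: A), (w p); split=> //.
- by rewrite cardsU1 nAi // cardA.
- apply: covariant_extend covy; [exact: Sym_closed | exact: Sym_conj_tperm].
- move=> b; rewrite !inE => /orP[/eqP ->|/As ->]; by rewrite ?rp ?eqxx ?orbT.
move=> j D nDj sD gz b Db; rewrite wE //.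
have sD' : {subset s <= D} by move=> k sk; apply: sD; rewrite inE sk orbT.
have gyj := gy j D nDj sD' gz.
apply: garnir_add; first exact: gyj.
apply/garnir_opp/garnir_sum => a Aa; apply: (garnir_tperm nDj) => //.
  by rewrite rp; apply: sD; rewrite mem_head.
exact/sD'/As.
Qed.

End Transversal.
End Covariance.

Arguments chi {F n}.

Section InvariantForm.
Variables (F : numClosedFieldType) (gT : finGroupType) (G : {group gT}) (d : nat).
Variable rG : mx_representation F G d.
Implicit Types u w : 'rV[F]_d.

(** Averaging the standard Hermitian form over the group gives every representation an invariant
    positive definite form, the source of the inequality in [murphy_rows]. *)
Definition inv_form u w :=
  \sum_(g in G) \sum_j (u *m rG g) 0 j * ((w *m rG g) 0 j)^*.

Lemma inv_form_suml (I : finType) (P : pred I) (u : I -> 'rV_d) w :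
  inv_form (\sum_(i | P i) u i) w = \sum_(i | P i) inv_form (u i) w.
Proof.
rewrite [RHS]exchange_big; apply: eq_bigr => g _; rewrite exchange_big.
by apply: eq_bigr => j _; rewrite mulmx_suml summxE mulr_suml.
Qed.

Lemma inv_form_sumr (I : finType) (P : pred I) u (w : I -> 'rV_d) :
  inv_form u (\sum_(i | P i) w i) = \sum_(i | P i) inv_form u (w i).
Proof.
rewrite [RHS]exchange_big; apply: eq_bigr => g _; rewrite exchange_big.
apply: eq_bigr => j _; rewrite mulmx_suml summxE rmorph_sum mulr_sumr.
exact: eq_bigr.
Qed.

Lemma inv_formZl a u w : inv_form (a *: u) w = a * inv_form u w.
Proof.
rewrite mulr_sumr; apply: eq_bigr => g _; rewrite mulr_sumr; apply: eq_bigr => j _.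
by rewrite -scalemxAl mxE mulrA.
Qed.

Lemma inv_form_ge0 u : 0 <= inv_form u u.
Proof. by apply: sumr_ge0 => g _; apply: sumr_ge0 => j _; apply: mul_conjC_ge0. Qed.

Lemma inv_form_eq0 u : inv_form u u = 0 -> u = 0.
Proof.
move/eqP; rewrite psumr_eq0 => [|g _]; last by apply: sumr_ge0 => j _; apply: mul_conjC_ge0.
move/allP/(_ 1%g); rewrite mem_index_enum group1 repr_mx1 mulmx1 => /(_ isT).
rewrite /= psumr_eq0 => [/allP u0|j _]; last exact: mul_conjC_ge0.
apply/rowP => j; rewrite mxE; apply/eqP.
by have := u0 j; rewrite mem_index_enum mul_conjC_eq0; apply.
Qed.

Lemma inv_formJ g u w : g \in G -> inv_form (u *m rG g) (w *m rG g) = inv_form u w.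
Proof.
move=> Gg; rewrite /inv_form [RHS](reindex_inj (mulgI g)) /=.
by apply: eq_big => [h|h Gh]; rewrite ?groupMl // !repr_mxM // !mulmxA.
Qed.

End InvariantForm.

Section JucysMurphy.
Variables (F : numClosedFieldType) (n d : nat).
Variable rG : mx_representation F [set: 'S_n] d.
Variables (v : 'I_n) (k : nat).
Implicit Types (g : 'S_n) (rho : {ffun 'I_n -> 'I_n}) (z : 'rV[F]_d).

Let char0 : [pchar F] =i pred0. Proof. exact: pchar_num. Qed.

Definition murphy_mx : 'M[F]_d := \sum_(p | p != v) rG (tperm p v).

Let Y := kermx (murphy_mx + k%:R%:M).

Lemma murphy_comm g : g v = v -> murphy_mx *m rG g = rG g *m murphy_mx.
Proof.
move=> gv; rewrite mulmx_suml mulmx_sumr.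
rewrite [RHS](reindex_inj (@perm_inj _ g)) /=.
apply: eq_big => p; first by rewrite -(inj_eq (@perm_inj _ g)) gv.
move=> _; rewrite -!repr_mxM ?inE // -{2}gv -tpermJ conjgE; congr (rG _).
by rewrite !mulgA mulgV mul1g.
Qed.

Lemma murphy_eigen_stable g z : g v = v -> (z <= Y)%MS -> (z *m rG g <= Y)%MS.
Proof.
move=> gv /sub_kermxP zY; apply/sub_kermxP.
rewrite -mulmxA mulmxDr -murphy_comm // scalar_mxC -mulmxDl mulmxA.
by rewrite zY mul0mx.
Qed.

Definition young rho : {set 'S_n} := [set g : 'S_n | [forall x, rho (g x) == rho x]].

Definition row_size rho i := #|[set x | rho x == i]|.

(* rho is read as a set partition of the points into rows.  An eigenvector fixed
   by the row stabilizer of a rho of maximal potential satisfies the relations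
   garnir, as otherwise a point could be moved to a longer row. *)
Definition potential rho := (\sum_i row_size rho i ^ 2)%N.

(** The point [v] has to be a row by itself, so that it can be adjoined to each of the other rows in
    turn; see [raise]. *)
Definition admissible rho :=
  [forall x, (rho x == rho v) ==> (x == v)] &&
  ((Y :&: rfix_mx rG (young rho))%MS != 0).

Definition move_to rho (q p : 'I_n) : {ffun 'I_n -> 'I_n} :=
  [ffun x => if x == q then rho p else rho x].

(** Moving a point from a row of size [a+1] to one of size [b > a] changes [(a+1)^2 + b^2] into
    [a^2 + (b+1)^2], a gain of [2(b-a)]. *)
Lemma potential_move rho q p : rho p != rho q ->
  (row_size rho (rho q) <= row_size rho (rho p))%N ->
  (potential rho < potential (move_to rho q p))%N.
Proof.
move=> npq le_qp; rewrite /potential.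
rewrite (bigD1 (rho q)) // (bigD1 (rho p)) //=.
rewrite [X in (_ < X)%N](bigD1 (rho q)) // [X in (_ < _ + X)%N](bigD1 (rho p)) //=.
rewrite !addnA [X in (_ < _ + X)%N](eq_bigr (fun i => row_size rho i ^ 2)%N); last first.
  move=> i /andP[iq ip]; congr (_ ^ 2)%N; apply: eq_card => x; rewrite !inE ffunE.
  by case: (eqVneq x q) => [->|//]; rewrite ![_ == i]eq_sym (negPf iq) (negPf ip).
rewrite ltn_add2r.
have ->: row_size (move_to rho q p) (rho p) = (row_size rho (rho p)).+1.
  rewrite /row_size (cardsD1 q) inE ffunE !eqxx add1n; congr _.+1.
  apply: eq_card => x; rewrite !inE ffunE; case: (eqVneq x q) => [->|//].
  by rewrite eq_sym (negPf npq).
have ->: row_size rho (rho q) = (row_size (move_to rho q p) (rho q)).+1.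
  rewrite /row_size (cardsD1 q) inE eqxx add1n; congr _.+1.
  by apply: eq_card => x; rewrite !inE ffunE; case: (eqVneq x q) => // _; rewrite (negPf npq).
have: (row_size (move_to rho q p) (rho q) < row_size rho (rho p))%N.
  apply: leq_trans le_qp.
  rewrite {2}/row_size (cardsD1 q) inE eqxx add1n ltnS.
  by apply/eq_leq/eq_card => x; rewrite !inE ffunE; case: (eqVneq x q) => // _; rewrite (negPf npq).
set a := row_size _ _; set b := row_size _ _ => ab.
rewrite -!mulnn !mulSn !mulnS; nia.
Qed.

Lemma young_closed rho g x : g \in young rho -> rho (g x) = rho x.
Proof. by rewrite inE => /forallP/(_ x)/eqP. Qed.

(** Elements of the new row stabilizer that fix [q] lie in the old one, and the [(q b)], for [b] in
    the enlarged row, are coset representatives. They all fix [v], so the sum stays in the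
    eigenspace. *)
Lemma symmetrize_move rho (y : 'rV_d) q p :
    (y <= Y :&: rfix_mx rG (young rho))%MS -> q != v ->
    rho p != rho q -> rho p != rho v ->
  ((\sum_(b in q |: [set x | rho x == rho p]) y *m rG (tperm q b))%R
     <= Y :&: rfix_mx rG (young (move_to rho q p)))%MS.
Proof.
rewrite !sub_capmx => /andP[Yy /rfix_mxP fixy] nqv npq npv.
set A := q |: _; set rho' := move_to rho q p.
have AE x : (x \in A) = (rho' x == rho p).
  by rewrite !inE ffunE; case: (eqVneq x q) => //=; rewrite eqxx.
apply/andP; split.
  apply: summx_sub => b; rewrite !inE => Ab; apply: murphy_eigen_stable => //.
  apply: tpermD => //; case/orP: Ab => [/eqP-> //|/eqP rb].
  by apply: contraNneq npv => <-; rewrite rb.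
apply/rfix_mxP => g Kg.
have cov: covariant rG false (young rho') (\sum_(b in A) chi false (tperm q b) *: (y *m rG (tperm q b))).
  apply: (@covariant_extend _ _ _ _ _ (young rho)).
  - by move=> h b Kh; rewrite !AE (young_closed _ Kh).
  - move=> h b Kh Ab; rewrite inE; apply/forallP => x.
    set h' := (_ * _ * _)%g.
    have tA c (s : 'I_n): c \in A -> rho' (tperm q c s) = rho' s.
      rewrite AE => /eqP rc; have rq: rho' q = rho p by rewrite ffunE eqxx.
      by case: tpermP => // ->; rewrite rc rq.
    have: rho' (h' x) = rho' x.
      by rewrite !permM tA ?(young_closed _ Kh) ?tA // AE (young_closed _ Kh) -AE.
    have hq: h' q = q by rewrite !permM tpermL tpermR.
    rewrite !ffunE -{1}hq (inj_eq perm_inj).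
    by case: (eqVneq x q) => [-> _|_ ->//]; rewrite hq.
  - by move=> h Kh; rewrite /chi /= scale1r fixy.
have:= cov g Kg; rewrite /chi /= scale1r.
by under eq_bigr do rewrite scale1r.
Qed.

Lemma murphy_garnir rho (y : 'rV_d) q p :
    admissible rho -> (forall rho', admissible rho' -> potential rho' <= potential rho)%N ->
    (y <= Y :&: rfix_mx rG (young rho))%MS -> 
    rho p != rho q -> rho p != rho v -> rho q != rho v ->
    (row_size rho (rho q) <= row_size rho (rho p))%N ->
  garnir rG rho (rho p) q y.
Proof.
move=> /andP[/forallP adm _] maxr Yy npq npv nqv le_qp.
have nv : q != v by apply: contraNneq nqv => ->.
have := symmetrize_move Yy nv npq npv; set z := bigop _ _ _ => Yz.
have z0 : z = 0.
  apply/eqP; apply/idPn => nz.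
  have := maxr (move_to rho q p); rewrite leqNgt potential_move // => /(_ _)/negP; apply=> //.
  rewrite /admissible; apply/andP; split; last first.
    by apply: contraNneq nz => Y0; rewrite -submx0 -Y0.
  apply/forallP => x; rewrite !ffunE [v == q]eq_sym (negPf nv).
  by case: (eqVneq x q) => _; rewrite ?(negPf npv).
move: z0; rewrite /z big_setU1 ?inE 1?eq_sym //= tperm1 repr1 => /eqP.
rewrite addrC addr_eq0 /garnir => /eqP <-; apply/eqP.
by apply: eq_big => b; rewrite ?inE // => _; rewrite tpermC.
Qed.

Section HighestWeight.
Variables (rho : {ffun 'I_n -> 'I_n}) (y : 'rV[F]_d).
Hypothesis rho_v : forall x, rho x = rho v -> x = v.
Hypothesis nzy : y != 0.
Hypothesis Yy : y *m murphy_mx = - k%:R *: y.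
Hypothesis fixy : forall g, g \in young rho -> y *m rG g = y.

Let I := [set rho x | x in [set~ v]].
Let row i := [set x | rho x == i].
Let raise i := \sum_(b in v |: row i) y *m rG (tperm v b).

Let v_row i : i \in I -> v \notin row i.
Proof.
case/imsetP=> x; rewrite !inE => xv ->; apply: contra xv => /eqP vx.
by apply/eqP/rho_v.
Qed.

Let raiseE i : i \in I -> raise i = y + \sum_(b in row i) y *m rG (tperm b v).
Proof.
move=> Ii; rewrite /raise big_setU1 ?v_row //= tperm1 repr1; congr (_ + _).
by apply: eq_bigr => b _; rewrite tpermC.
Qed.

(** Each row contributes [y] once, and the transpositions through [v] add up to the Jucys-Murphy
    element, which acts by [-k]. *)
Let raise_sum : \sum_(i in I) raise i = (#|I|%:R - k%:R) *: y.
Proof.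
rewrite (eq_bigr _ raiseE) big_split /= sumr_const scalerBl scaler_nat.
congr (_ + _); rewrite -scaleNr -Yy /murphy_mx mulmx_sumr.
rewrite [RHS](partition_big rho (mem I)) /=; last first.
  by move=> x xv; apply: imset_f; rewrite !inE.
apply: eq_bigr => i Ii; apply: eq_bigl => b; rewrite inE.
case: eqVneq => [ri|_]; rewrite ?andbF // andbT; apply/esym.
by apply: contraTneq Ii => bv; apply/negP => /v_row; rewrite inE -ri bv eqxx.
Qed.

Let raise_fix i b : i \in I -> b \in v |: row i -> raise i *m rG (tperm v b) = raise i.
Proof.
move=> Ii Ab.
have cov : covariant rG false (Sym (v |: row i)) 
    (\sum_(b in v |: row i) chi false (tperm v b) *: (y *m rG (tperm v b))).
  apply: (@covariant_extend _ _ _ _ _ (Sym (row i))).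
  - exact: Sym_closed.
  - exact: Sym_conj_tperm.
  - move=> g; rewrite inE => on_g; rewrite /chi scale1r fixy // inE.
    apply/forallP=> x; have [xi|nxi] := boolP (x \in row i); last by rewrite (out_perm on_g).
    by move: (xi); rewrite -(perm_closed _ on_g) !inE => /eqP ->; move: xi; rewrite inE => /eqP ->.
have:= cov (tperm v b); rewrite /chi /= scale1r.
under eq_bigr do rewrite scale1r.
apply; rewrite inE; apply: subset_trans (tperm_on v b) _.
by apply/subsetP=> x; rewrite !inE => /orP[] /eqP->; rewrite ?eqxx // -?in_setU1; move: Ab; rewrite !inE.
Qed.

(** The [(v b)] fix [raise i] and preserve the form, so all terms of the second argument pair
    equally: up to a factor, [raise i] is an orthogonal projection of [y]. *)
Let raise_form i : i \in I ->
  inv_form rG (raise i) (raise i) = #|row i|.+1%:R * inv_form rG (raise i) y.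
Proof.
move=> Ii; rewrite {2}/raise inv_form_sumr (eq_bigr (fun=> inv_form rG (raise i) y)).
  by rewrite sumr_const cardsU1 v_row // mulr_natl.
move=> b Ab; rewrite -[LHS](inv_formJ rG (g := tperm v b)) ?inE //.
by rewrite raise_fix // -reprM tperm2 repr1.
Qed.

(** By [raise_form] every [inv_form (raise i) y] is nonnegative, while by [raise_sum] their total is
    [#|I| - k] times the positive number [inv_form y y], hence at most 0. So all of them vanish,
    which forces [#|I| = k] and [raise i = 0]; the latter is the relation at [v]. *)
Lemma murphy_rows : (#|I| <= k)%N ->
  #|I| = k /\ forall i, i \in I -> garnir rG rho i v y.
Proof.
move=> le_Ik.
have ge0 i : i \in I -> 0 <= inv_form rG (raise i) y.
  move=> Ii; rewrite -(pmulr_rge0 _ (ltr0Sn F #|row i|)) -raise_form //.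
  exact: inv_form_ge0.
have sumE : \sum_(i in I) inv_form rG (raise i) y = (#|I|%:R - k%:R) * inv_form rG y y.
  by rewrite -inv_form_suml raise_sum inv_formZl.
have yy : 0 < inv_form rG y y.
  by rewrite lt_def inv_form_ge0 andbT; apply: contra nzy => /eqP/inv_form_eq0 ->.
have sum0 : \sum_(i in I) inv_form rG (raise i) y = 0.
  apply/eqP; rewrite eq_le sumr_ge0 // andbT sumE pmulr_lle0 //.
  by rewrite subr_le0 ler_nat.
split.
  move/eqP: sum0; rewrite sumE mulf_eq0 (gt_eqF yy) orbF subr_eq0 eqr_nat.
  by move/eqP.
move=> i Ii; move/eqP: sum0; rewrite psumr_eq0 // => /allP/(_ i).
rewrite mem_index_enum Ii => /(_ isT)/eqP ri0.
have: raise i = 0 by apply: (@inv_form_eq0 _ _ _ _ rG); rewrite raise_form // ri0 mulr0.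
rewrite raiseE // => /eqP; rewrite addrC addr_eq0 /garnir => /eqP <-.
by apply/eqP; apply: eq_bigl => b; rewrite inE.
Qed.

End HighestWeight.

(** The rows of an admissible [rho] of maximal potential provide the relations that
    [transversal_antisym] needs to build an antisymmetric vector over one point from each of k+1
    rows. *)
Lemma murphy_antisym (u : 'rV[F]_d) :
    u != 0 -> u *m murphy_mx = - k%:R *: u ->
  exists (A : {set 'I_n}) (z : 'rV_d),
    [/\ z != 0, #|A| = k.+1 & covariant rG true (Sym A) z].
Proof.
move=> nzu uY.
have subY (w : 'rV_d) : (w <= Y)%MS = (w *m murphy_mx == - k%:R *: w).
  rewrite (sameP sub_kermxP eqP) mulmxDr mul_mx_scalar addr_eq0 scaleNr.
  by [].
(* The row stabilizer of the partition into singletons is trivial, so [u] itself shows that some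
   [rho] is admissible. *)
have adm0 : admissible [ffun x => x].
  apply/andP; split; first by apply/forallP=> x; rewrite !ffunE implybb.
  apply: contraNneq nzu => Y0; rewrite -submx0 -Y0 sub_capmx subY uY eqxx.
  apply/rfix_mxP => g; rewrite inE => /forallP g1.
  have ->: g = 1%g by apply/permP=> x; have := g1 x; rewrite !ffunE perm1 => /eqP.
  by rewrite repr1.
case: (arg_maxnP potential adm0) => rho adm maxr.
have /andP[/forallP rho_v nzY] := adm.
set W := (_ :&: _)%MS in nzY.
pose y := nz_row W.
have nzy : y != 0 by rewrite nz_row_eq0.
have yW : (y <= W)%MS by exact: nz_row_sub.
have:= yW; rewrite sub_capmx subY => /andP[/eqP Yy /rfix_mxP fixy].
have rho_v' x : rho x = rho v -> x = v.
  by move=> rx; apply/eqP; have := rho_v x; rewrite rx eqxx.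
pose I := [set rho x | x in [set~ v]].
(* [murphy_garnir] moves a point to a row that is at least as long, hence the order by decreasing
   size. *)
pose s := sort (fun i j => (row_size rho j <= row_size rho i)%N) (enum I).
have sI i : (i \in s) = (i \in I) by rewrite mem_sort mem_enum.
have us : uniq s by rewrite sort_uniq enum_uniq.
have ss : pairwise (fun i j => (row_size rho j <= row_size rho i)%N) s.
  rewrite -sorted_pairwise; first by apply: sort_sorted => i j; apply: leq_total.
  by move=> j i l ji lj; apply: leq_trans lj ji.
have gs : pairwise (fun i j => [forall b, (rho b == j) ==> garnir rG rho i b y]) s.
  have: pairwise (fun i j : 'I_n => i != j) s by rewrite -uniq_pairwise.
  have : all (mem I) s by apply/allP=> i; rewrite sI.
  elim: (s) ss => //= i t IHt /andP[ai pt] /andP[Ii It] /andP[ni ut].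
  rewrite IHt // andbT; apply/allP => j tj; apply/forallP => b; apply/implyP=> /eqP rb.
  case/imsetP: Ii => p; rewrite !inE => pv def_i.
  have /imsetP[q] := allP It _ tj; rewrite !inE => qv def_j.
  rewrite def_i; apply: murphy_garnir => //; rewrite ?rb -?def_i //.
  - exact: (allP ni).
  - by rewrite def_i; apply: contra pv => /eqP/rho_v' ->.
  - by rewrite def_j; apply: contra qv => /eqP/rho_v' ->.
  - exact: (allP ai).
have size_s : size s = #|I| by rewrite size_sort cardE.
have ne t : {subset t <= rcons s (rho v)} -> {in t, forall i, exists p, rho p = i}.
  move=> st i /st; rewrite mem_rcons inE => /orP[/eqP->|]; first by exists v.
  by rewrite sI => /imsetP[p _ ->]; exists p.
(* With at most k rows besides that of [v] there are exactly k, and the row of [v], placed last, is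
   the missing one. Otherwise the k+1 longest rows suffice. *)
have [leIk|ltkI] := leqP #|I| k.
  have [cI gv] := murphy_rows rho_v' nzy Yy fixy leIk.
  have nvs : rho v \notin s.
    rewrite sI; apply/negP => /imsetP[x]; rewrite !inE => xv.
    by move/esym/rho_v'/eqP; rewrite (negPf xv).
  have [|||A [z [nzz cA covz _ _]]] := transversal_antisym char0 nzy (s := rcons s (rho v)) (rG := rG) (rho := rho).
  - by rewrite rcons_uniq nvs.
  - exact: ne.
  - rewrite pairwise_rcons gs andbT; apply/allP=> i; rewrite sI => Ii.
    by apply/forallP => b; apply/implyP=> /eqP/rho_v' ->; apply: gv.
  by exists A, z; rewrite cA size_rcons size_s cI.
have [|||A [z [nzz cA covz _ _]]] := transversal_antisym char0 nzy (s := take k.+1 s) (rG := rG) (rho := rho).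
- exact: take_uniq.
- by apply: ne => i /mem_take; rewrite mem_rcons inE orbC => ->.
- by move: gs; rewrite -{1}(cat_take_drop k.+1 s) pairwise_cat => /and3P[].
by exists A, z; rewrite cA size_takel ?size_s.
Qed.

End JucysMurphy.

(** * Top cycles *)

Section FreeModuleCoordinates.
Variables (F : fieldType) (T : finType).
Implicit Types (x y : 'rV[F]_#|T|) (t : T).

Definition coord x t := x 0 (enum_rank t).

Lemma coordP x y : coord x =1 coord y -> x = y.
Proof. by move=> xy; apply/rowP=> i; have := xy (enum_val i); rewrite /coord enum_valK. Qed.

Lemma coord_basis t s : coord (basis_vec F t) s = (s == t)%:R.
Proof. by rewrite /coord mxE eqxx /= (inj_eq enum_rank_inj). Qed.

Lemma coordZ a x t : coord (a *: x) t = a * coord x t.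
Proof. by rewrite /coord mxE. Qed.

Lemma coordD x y t : coord (x + y) t = coord x t + coord y t.
Proof. by rewrite /coord mxE. Qed.

Lemma coord0 t : coord 0 t = 0.
Proof. by rewrite /coord mxE. Qed.

Lemma coord_sum (I : finType) (P : pred I) (x : I -> 'rV_#|T|) t :
  coord (\sum_(i | P i) x i) t = \sum_(i | P i) coord (x i) t.
Proof. by rewrite /coord summxE. Qed.

Lemma basis_sum x : x = \sum_t coord x t *: basis_vec F t.
Proof.
apply: coordP => s; rewrite coord_sum (bigD1 s) //= coordZ coord_basis eqxx mulr1.
rewrite big1 ?addr0 // => t ts.
by rewrite coordZ coord_basis eq_sym (negPf ts) mulr0.
Qed.

Lemma lin_ext_sum m (h : T -> 'rV[F]_m) x :
  x *m lin_ext h = \sum_t coord x t *: h t.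
Proof.
rewrite [in LHS](basis_sum x) mulmx_suml; apply: eq_bigr => t _.
by rewrite -scalemxAl basis_lin_ext.
Qed.

Lemma basis_vec_sub m (A : 'M_(m, #|T|)) (P : pred T) x :
  (forall t, P t -> (basis_vec F t <= A)%MS) ->
  (forall t, ~~ P t -> coord x t = 0) -> (x <= A)%MS.
Proof.
move=> sA x0; rewrite [x]basis_sum; apply: summx_sub => t _.
by have [Pt|/x0 ->] := boolP (P t); rewrite ?scale0r ?sub0mx ?scalemx_sub ?sA.
Qed.

End FreeModuleCoordinates.

Section Words.
Variables (F : fieldType) (n : nat).
Implicit Types (g : 'S_n) (A : {set 'I_n}).

Definition antisym_mx d (rG : mx_representation F [set: 'S_n] d) A : 'M_d :=
  \sum_(g in Sym A) (-1) ^+ g *: rG g.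

Lemma covariant_antisym d (rG : mx_representation F [set: 'S_n] d) A z :
  covariant rG true (Sym A) z -> z *m antisym_mx rG A = #|Sym A|%:R *: z.
Proof.
move=> covz; rewrite mulmx_sumr scaler_nat -sumr_const; apply: eq_bigr => g Ag.
by rewrite -scalemxAr covz // scalerA -signr_addb addbb scale1r.
Qed.

Lemma antisymJ d (rG : mx_representation F [set: 'S_n] d) A g :
  antisym_mx rG A *m rG g = rG g *m antisym_mx rG (g @: A).
Proof.
rewrite mulmx_suml mulmx_sumr [RHS](reindex_inj (conjg_inj g)) /=.
apply: eq_big => [h|h _].
  rewrite !inE; apply/subsetP/subsetP => on_h x.
    rewrite inE => hx; have := on_h (g^-1%g x); rewrite inE.
    rewrite (contraNneq _ hx) => [/(_ isT) Ax|hgx].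
      by rewrite -(permKV g x) mem_imset //; apply: perm_inj.
    by rewrite conjgE !permM hgx permKV.
  rewrite inE => hx; rewrite -(mem_imset _ _ (@perm_inj _ g)); apply: on_h.
  by rewrite inE conjgE !permM permK (inj_eq perm_inj).
rewrite odd_permJ -scalemxAl -scalemxAr -!repr_mxM ?inE // conjgE.
by rewrite !mulgA mulgV mul1g.
Qed.

Lemma antisym_cov d (rG : mx_representation F [set: 'S_n] d) A z :
  covariant rG true (Sym A) (z *m antisym_mx rG A).
Proof.
move=> g Ag; rewrite -mulmxA mulmx_suml !mulmx_sumr scaler_sumr.
have gA h : (h * g^-1)%g \in Sym A = (h \in Sym A).
  rewrite -groupV /= in Ag.
  have gS : g^-1%g \in Sym_group A by [].
  by apply: (groupMr h gS).
rewrite [LHS](reindex_inj (mulIg g^-1%g)) /=.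
apply: eq_big => h; first exact: gA.
move=> _; rewrite -scalemxAl -repr_mxM ?inE // mulgKV odd_permM odd_permV signr_addb.
by rewrite -!scalemxAr scalerA /chi mulrC.
Qed.

Variable X : finType.
Local Notation word := {ffun 'I_n -> X}.
Implicit Types f : word.

Definition word_repr := perm_repr F [set: 'S_n] (fun_action n X).

Lemma word_reprE f g : basis_vec F f *m word_repr g = basis_vec F (fun_act f g).
Proof. exact: (perm_reprE F [set: 'S_n]%G). Qed.

Lemma coord_word x g f : coord (x *m word_repr g) f = coord x [ffun p => f (g p)].
Proof.
rewrite [in LHS](basis_sum x) mulmx_suml coord_sum.
rewrite (bigD1 [ffun p => f (g p)]) //= -scalemxAl word_reprE coordZ coord_basis.
have -> : f == fun_act [ffun p => f (g p)] g.
  by apply/eqP/ffunP=> p; rewrite !ffunE permKV.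
rewrite mulr1 big1 ?addr0 // => h hf.
rewrite -scalemxAl word_reprE coordZ coord_basis (_ : _ == _ = false) ?mulr0 //.
apply: contraNF hf => /eqP ->; apply/eqP/ffunP=> p.
by rewrite !ffunE permK.
Qed.

Hypothesis char0 : [pchar F] =i pred0.

(** The transposition [(p q)] fixes the word but changes the sign of the antisymmetrizer, so the
    product is its own opposite. *)
Lemma antisym_kill f A p q :
  p \in A -> q \in A -> p != q -> f p = f q ->
  basis_vec F f *m antisym_mx word_repr A = 0.
Proof.
move=> Ap Aq npq fpq; set z := _ *m _.
have Apq : tperm p q \in Sym A.
  rewrite inE; apply: subset_trans (tperm_on p q) _.
  by apply/subsetP=> x; rewrite !inE => /orP[] /eqP->.
have zN : z = - z.
  rewrite -[in RHS]scaleN1r /z mulmx_sumr scaler_sumr.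
  have gS : tperm p q \in Sym_group A by [].
  rewrite [LHS](reindex_inj (mulgI (tperm p q))) /=.
  apply: eq_big => h; first by apply: (groupMl h gS).
  move=> _; rewrite odd_permM odd_tperm npq /= signrN -!scalemxAr scaleN1r scaleNr.
  congr (- (_ *: _)).
  rewrite (reprM word_repr) word_reprE; congr (basis_vec _ _ *m _).
  by apply/ffunP=> x; rewrite !ffunE tpermV; case: tpermP => // ->; rewrite fpq.
apply/eqP; move/eqP: zN; rewrite -addr_eq0 -mulr2n -scaler_nat scaler_eq0.
by rewrite ((pcharf0P F).1 char0).
Qed.

Lemma antisym_kill_card f A : (#|[set f p | p in A]| < #|A|)%N ->
  basis_vec F f *m antisym_mx word_repr A = 0.
Proof.
move=> ltA; have /dinjectivePn[p Ap [q]]: ~~ dinjectiveb f (mem A).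
  by apply: contraL ltA => /dinjectiveP inj_f; rewrite -leqNgt card_in_imset.
by rewrite !inE => /andP[qp Aq] fpq; apply: (antisym_kill Ap Aq) => //; rewrite eq_sym.
Qed.

End Words.

Section EquivariantExtension.
Variables (F : fieldType) (n : nat) (X : finType) (d : nat).
Variable rG : mx_representation F [set: 'S_n] d.
Local Notation word := {ffun 'I_n -> X}.

Lemma lin_ext_equiv (h : word -> 'rV[F]_d) g :
  (forall f, h (fun_act f g) = h f *m rG g) ->
  word_repr F n X g *m lin_ext h = lin_ext h *m rG g.
Proof.
move=> hg; apply: basis_vec_ext => f.
by rewrite !mulmxA word_reprE !basis_lin_ext hg.
Qed.

Lemma coord_lin_ext (Y : finType) (phi : word -> Y) (x : 'rV[F]_#|{: word}|) y :
  coord (x *m lin_ext (fun f => basis_vec F (phi f))) y = \sum_(f | phi f == y) coord x f.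
Proof.
rewrite lin_ext_sum coord_sum [RHS]big_mkcond; apply: eq_bigr => f _.
by rewrite coordZ coord_basis eq_sym; case: eqP => _; rewrite ?mulr1 ?mulr0.
Qed.

End EquivariantExtension.

(** * Alternating top chains as combinations of words *)

Section Chains.
Variables (F : numClosedFieldType) (n k : nat).
Local Notation word := {ffun 'I_n -> 'I_k.+1}.
Local Notation tr := (word_repr F n 'I_k.+1).
Implicit Types (f : word) (x : 'rV[F]_#|{: word}|) (g : 'S_n) (s : 'S_k.+1).

Let char0 : [pchar F] =i pred0. Proof. exact: pchar_num. Qed.

(* A word f encodes the ordered matching whose i-th triple is the fiber of
   lift ord_max i, the points in the fiber of ord_max being left uncovered. *)
Definition top f :=
  [forall i, #|[set p | f p == i]| == if i == ord_max then 1%N else 3%N].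

Definition relabel s f : word := [ffun p => s (f p)].

(** Giving uncovered points the letter [i] makes them indistinguishable from the points of triple
    [i], which is the effect of deleting that triple: this is a face map that stays within the same
    set of words. *)
Definition merge i f : word := [ffun p => if f p == ord_max then i else f p].

Definition top_mx : 'M[F]_#|{: word}| := lin_ext (fun f => (top f)%:R *: basis_vec F f).

Definition alt_mx : 'M[F]_#|{: word}| :=
  lin_ext (fun f => \sum_(s : 'S_k.+1 | s ord_max == ord_max) (-1) ^+ s *: basis_vec F (relabel s f)).

Definition merge_mx i : 'M[F]_#|{: word}| := lin_ext (fun f => basis_vec F (merge i f)).

Definition nb_relabel := #|[set s : 'S_k.+1 | s ord_max == ord_max]|.

Definition top_supported x := forall f, ~~ top f -> coord x f = 0.

Definition alternating x :=
  forall s f, s ord_max = ord_max -> coord x (relabel s f) = (-1) ^+ s * coord x f.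

(** For alternating chains the single face [ord0] controls all the others ([merge0_all]), and with
    them the boundary. *)
Definition top_cycles : 'M[F]_#|{: word}| :=
  (kermx (1%:M - top_mx) :&: kermx (alt_mx - nb_relabel%:R%:M) :&:
   kermx (merge_mx ord0))%MS.

Lemma nb_relabel_neq0 : nb_relabel%:R != 0 :> F.
Proof.
rewrite ((pcharf0P F).1 char0) -lt0n; apply/card_gt0P; exists 1%g.
by rewrite inE perm1.
Qed.

Lemma relabelM s t f : relabel s (relabel t f) = relabel (t * s)%g f.
Proof. by apply/ffunP=> p; rewrite !ffunE permM. Qed.

Lemma relabel1 f : relabel 1 f = f.
Proof. by apply/ffunP=> p; rewrite ffunE perm1. Qed.

Lemma top_relabel s f : s ord_max = ord_max -> top (relabel s f) = top f.
Proof.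
move=> smax; apply/forallP/forallP=> tf i.
  have := tf (s i); have -> : (s i == ord_max) = (i == ord_max).
    by rewrite -(inj_eq (@perm_inj _ s) i) smax.
  move/eqP <-.
  by apply/eqP/eq_card => p; rewrite !inE ffunE (inj_eq perm_inj).
have := tf (s^-1%g i); have -> : (s^-1%g i == ord_max) = (i == ord_max).
  by rewrite -(inj_eq (@perm_inj _ s)) permKV smax.
move/eqP <-; apply/eqP/eq_card => p; rewrite !inE ffunE.
by rewrite -[in RHS](inj_eq (@perm_inj _ s)) permKV.
Qed.

Lemma top_act f g : top (fun_act f g) = top f.
Proof.
apply: eq_forallb => i; congr (_ == _).
rewrite -(card_imset _ (@perm_inj _ g^-1%g)); apply: eq_card => p.
rewrite inE; apply/imsetP/idP => [[q]|fp]; first by rewrite inE ffunE => fq ->.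
by exists (g p); rewrite ?inE ?ffunE permK.
Qed.

Lemma coord_top x f : coord (x *m top_mx) f = (top f)%:R * coord x f.
Proof.
rewrite lin_ext_sum coord_sum (bigD1 f) //= !coordZ coord_basis eqxx mulr1 mulrC.
by rewrite big1 ?addr0 // => h hf; rewrite !coordZ coord_basis eq_sym (negPf hf) !mulr0.
Qed.

Lemma coord_alt x f :
  coord (x *m alt_mx) f = \sum_(s : 'S_k.+1 | s ord_max == ord_max) (-1) ^+ s * coord x (relabel s f).
Proof.
rewrite lin_ext_sum coord_sum.
under eq_bigr => h _ do rewrite coordZ coord_sum mulr_sumr.
rewrite exchange_big (reindex_inj invg_inj) /=.
apply: eq_big => [s|s smax]; first by rewrite -(inj_eq (@perm_inj _ s)) permKV eq_sym.
rewrite (bigD1 (relabel s f)) //= !coordZ coord_basis relabelM mulgV relabel1 eqxx.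
rewrite mulr1 odd_permV mulrC big1 ?addr0 // => h hf.
rewrite !coordZ coord_basis (_ : _ == _ = false) ?mulr0 //.
by apply: contraNF hf => /eqP ->; rewrite relabelM mulVg relabel1.
Qed.

Lemma top_mx_equiv g : tr g *m top_mx = top_mx *m tr g.
Proof. by apply: lin_ext_equiv => f; rewrite top_act -scalemxAl word_reprE. Qed.

Lemma relabel_act s f g : relabel s (fun_act f g) = fun_act (relabel s f) g.
Proof. by apply/ffunP=> p; rewrite !ffunE. Qed.

Lemma alt_mx_equiv g : tr g *m alt_mx = alt_mx *m tr g.
Proof.
apply: lin_ext_equiv => f; rewrite mulmx_suml; apply: eq_bigr => s _.
by rewrite -scalemxAl word_reprE relabel_act.
Qed.

Lemma merge_mx_equiv i g : tr g *m merge_mx i = merge_mx i *m tr g.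
Proof.
apply: lin_ext_equiv => f; rewrite word_reprE; congr basis_vec.
by apply/ffunP=> p; rewrite !ffunE.
Qed.

Lemma alternating_alt x : alternating (x *m alt_mx).
Proof.
move=> t f tmax; rewrite !coord_alt mulr_sumr.
rewrite (reindex_inj (mulgI t^-1%g)) /=; apply: eq_big => [s|s smax].
  by rewrite permM -{1}tmax permK.
by rewrite relabelM mulKVg odd_permM odd_permV signr_addb mulrA.
Qed.

Lemma alternatingP x : reflect (alternating x) (x *m alt_mx == nb_relabel%:R *: x).
Proof.
apply: (iffP eqP) => [xE|altx].
  have -> : x = nb_relabel%:R^-1 *: (x *m alt_mx).
    by rewrite xE scalerA mulVf ?nb_relabel_neq0 ?scale1r.
  by move=> s f smax; rewrite !coordZ alternating_alt // mulrCA.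
apply: coordP => f; rewrite coord_alt coordZ mulr_natl -sumr_const.
apply: eq_big => [s|s /eqP smax]; first by rewrite inE.
by rewrite altx // mulrA -signr_addb addbb mul1r.
Qed.

Lemma top_supportedP x : reflect (top_supported x) (x *m top_mx == x).
Proof.
apply: (iffP eqP) => [xE f nf|topx]; first by rewrite -xE coord_top (negPf nf) mul0r.
apply: coordP => f; rewrite coord_top; have [_|/topx ->] := boolP (top f).
  by rewrite mul1r.
by rewrite mulr0.
Qed.

Lemma top_cyclesP x :
  reflect [/\ top_supported x, alternating x & x *m merge_mx ord0 = 0] (x <= top_cycles)%MS.
Proof.
rewrite !sub_capmx !(sameP sub_kermxP eqP) !mulmxBr mulmx1 mul_mx_scalar !subr_eq0 -andbA.
apply: (iffP and3P) => [[t /alternatingP a /eqP m]|[t a m]]; split=> //.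
- by apply/top_supportedP; rewrite eq_sym.
- by rewrite eq_sym; apply/top_supportedP.
- exact/alternatingP.
- exact/eqP.
Qed.

Lemma top_cycles_module : mxmodule tr top_cycles.
Proof.
have cent1 (B : 'M_#|{: word}|) : (forall g, tr g *m B = B *m tr g) -> mxmodule tr (kermx B).
  by move=> cB; apply: kermx_centg_module; apply/centgmxP=> g _.
rewrite !capmx_module ?cent1 // => g; rewrite ?merge_mx_equiv //.
  by rewrite mulmxBr mulmxBl mulmx1 mul1mx top_mx_equiv.
by rewrite mulmxBr mulmxBl alt_mx_equiv scalar_mxC.
Qed.

(** Relabelling by the transposition of the letters 0 and [i] turns [merge ord0] into [merge i] and
    changes an alternating chain at most by a sign. *)
Lemma merge0_all x i : i != ord_max -> alternating x ->
  x *m merge_mx ord0 = 0 -> x *m merge_mx i = 0.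
Proof.
move=> nimax altx x0; apply: coordP => h; rewrite coord0.
have [k0|kpos] := posnP k.
  by case/eqP: nimax; apply/val_inj; case: i => i /=; rewrite k0; lia.
pose s : 'S_k.+1 := tperm ord0 i.
have smax : s ord_max = ord_max.
  by rewrite tpermD //; apply/eqP => /(congr1 val)/=; lia.
have := congr1 (fun y => coord y (relabel s h)) x0; rewrite coord0 !coord_lin_ext => e0.
apply: (mulfI (negbT (signr_eq0 F s))); rewrite mulr0 -[RHS]e0 mulr_sumr.
have relK : cancel (relabel s) (relabel s^-1%g).
  by move=> f; rewrite relabelM mulgV relabel1.
rewrite [RHS](reindex_inj (can_inj relK)) /=.
apply: eq_big => [f|f _]; last by rewrite altx.
rewrite -(inj_eq (can_inj relK)); congr (_ == _); apply/ffunP=> p; rewrite !ffunE.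
by rewrite -{2}smax (inj_eq perm_inj); case: eqP => // _; rewrite tpermR.
Qed.

End Chains.

(** The image of a real symmetric matrix is orthogonal to its kernel: a vector [z = y A] in the
    kernel pairs to 0 with its own conjugate, after moving [A] to the other side. *)
Lemma sym_real_cap (F : numClosedFieldType) m (A : 'M[F]_m) (y : 'rV_m) :
  A^T = A -> map_mx Num.conj A = A -> y *m A *m A = 0 -> y *m A = 0.
Proof.
move=> symA realA; set z := y *m A => zA0.
have: z *m (map_mx Num.conj z)^T = 0.
  rewrite {1}/z -mulmxA -{1}symA -trmx_mul -{1}realA -map_mxM zA0.
  by rewrite map_mx0 trmx0 mulmx0.
move: (z) => w /matrixP/(_ 0 0); rewrite !mxE => /eqP.
under eq_bigr do rewrite !mxE.
rewrite psumr_eq0 => [/allP z0|j _]; last exact: mul_conjC_ge0.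
apply/rowP=> j; rewrite [RHS]mxE; apply/eqP; rewrite -mul_conjC_eq0.
by have /= := z0 j (mem_index_enum j).
Qed.

(** * The Laplacian and the antisymmetrizations *)

Section TopCycles.
Variables (F : numClosedFieldType) (n k : nat).
Local Notation word := {ffun 'I_n -> 'I_k.+1}.
Local Notation tr := (word_repr F n 'I_k.+1).
Implicit Types (f h : word) (x : 'rV[F]_#|{: word}|) (g : 'S_n) (A : {set 'I_n}).

Let char0 : [pchar F] =i pred0. Proof. exact: pchar_num. Qed.

(* On top-dimensional chains this is the Laplacian; it sends f to k f plus the
   sum of the transpositions moving the uncovered point of f. *)
Definition laplace_mx : 'M[F]_#|{: word}| :=
  lin_ext (fun f => k%:R *: basis_vec F f +
    \sum_(q | f q == ord_max) \sum_(p | f p != ord_max)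
       basis_vec F (fun_act f (tperm p q))).

Lemma swap_word f p q r : fun_act f (tperm p q) r = f (tperm p q r).
Proof. by rewrite ffunE tpermV. Qed.

Lemma swap_wordK f p q : fun_act (fun_act f (tperm p q)) (tperm p q) = f.
Proof. by apply/ffunP=> r; rewrite !swap_word tpermK. Qed.

(** Swapping an uncovered with a covered point is undone by the same swap, so coefficients obey the
    formula that defines the images of basis vectors. This is the symmetry of the Laplacian. *)
Lemma coord_laplace x h : coord (x *m laplace_mx) h = k%:R * coord x h +
  \sum_(q | h q == ord_max) \sum_(p | h p != ord_max) coord x (fun_act h (tperm p q)).
Proof.
rewrite lin_ext_sum coord_sum.
under eq_bigr => f _ do rewrite coordZ coordD mulrDr coordZ coord_basis.
rewrite big_split /=; congr (_ + _).
  rewrite (bigD1 h) //= eqxx mulr1 mulrC big1 ?addr0 // => f fh.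
  by rewrite eq_sym (negPf fh) !mulr0.
pose c f p q := ((f q == ord_max) && (f p != ord_max))%:R : F.
transitivity (\sum_f \sum_q \sum_p coord x f * (c f p q * (h == fun_act f (tperm p q))%:R)).
  apply: eq_bigr => f _; rewrite coord_sum mulr_sumr big_mkcond /=.
  apply: eq_bigr => q _; case: ifP => fq; last first.
    by rewrite big1 // => p _; rewrite /c fq mul0r mulr0.
  rewrite coord_sum mulr_sumr big_mkcond /=; apply: eq_bigr => p _.
  by rewrite /c fq coord_basis; case: ifP => _; rewrite ?mul1r // mul0r mulr0.
transitivity (\sum_q \sum_p coord x (fun_act h (tperm p q)) *
                 ((h p == ord_max) && (h q != ord_max))%:R).
  rewrite exchange_big /=; apply: eq_bigr => q _; rewrite exchange_big /=.
  apply: eq_bigr => p _; rewrite (bigD1 (fun_act h (tperm p q))) //= swap_wordK eqxx.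
  rewrite mulr1 /c !swap_word tpermL tpermR big1 ?addr0 // => f fh.
  rewrite (_ : h == _ = false) ?mulr0 //.
  by apply: contraNF fh => /eqP ->; rewrite swap_wordK.
rewrite exchange_big [RHS]big_mkcond; apply: eq_bigr => q _ /=.
case: ifP => hq; last by rewrite big1 // => p _; rewrite mulr0.
rewrite [RHS]big_mkcond; apply: eq_bigr => p _ /=.
by rewrite tpermC; case: ifP; rewrite ?mulr1 ?mulr0.
Qed.

Lemma laplace_sym : laplace_mx^T = laplace_mx.
Proof.
apply: basis_vec_ext => f; apply: coordP => h.
transitivity (coord (basis_vec F h *m laplace_mx) f).
  by rewrite /coord /basis_vec -!rowE !mxE.
rewrite coord_laplace basis_lin_ext coordD coordZ !coord_basis eq_sym; congr (_ + _).
rewrite coord_sum; apply: eq_bigr => q _; rewrite coord_sum; apply: eq_bigr => p _.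
by rewrite !coord_basis eq_sym.
Qed.

Lemma laplace_real : map_mx Num.conj laplace_mx = laplace_mx.
Proof.
apply/matrixP=> i j; rewrite !mxE summxE rmorphD rmorphM !rmorph_nat rmorph_sum.
congr (_ + _); apply: eq_bigr => q _; rewrite summxE rmorph_sum; apply: eq_bigr => p _.
by rewrite mxE /= rmorph_nat.
Qed.

Lemma laplace_equiv g : tr g *m laplace_mx = laplace_mx *m tr g.
Proof.
apply: lin_ext_equiv => f; rewrite mulmxDl -scalemxAl word_reprE; congr (_ + _).
rewrite mulmx_suml [LHS](reindex_inj (@perm_inj _ g)) /=.
apply: eq_big => [q|q _]; first by rewrite ffunE permK.
rewrite mulmx_suml [LHS](reindex_inj (@perm_inj _ g)) /=.
apply: eq_big => [p|p _]; first by rewrite ffunE permK.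
rewrite word_reprE; congr basis_vec.
apply/ffunP=> r; rewrite !swap_word !ffunE; congr (f _).
by rewrite tpermV -tpermJ conjgE !permM permK.
Qed.

(** The merged word no longer separates [v] from triple [i]; a top word above it amounts to choosing
    which of these four points stays uncovered. *)
Lemma merge_fiber h v i : top h -> h v = ord_max -> i != ord_max ->
  [set f | (merge i f == merge i h) && top f] =
  [set fun_act h (tperm p v) | p in v |: [set p | h p == i]].
Proof.
move=> toph hv nimax.
have uniq_max f p q : top f -> f p = ord_max -> f q = ord_max -> p = q.
  move=> /forallP/(_ ord_max); rewrite eqxx => /cards1P[r fr] fp fq.
  have: p \in [set r] by rewrite -fr inE fp.
  have: q \in [set r] by rewrite -fr inE fq.
  by rewrite !inE => /eqP-> /eqP->.
apply/setP=> f; rewrite inE; apply/andP/imsetP => [[/eqP mf topf]|[p]].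
  have [p fp]: exists p, f p = ord_max.
    have /forallP/(_ ord_max) := topf; rewrite eqxx => /cards1P[r fr].
    by exists r; apply/eqP; have := set11 r; rewrite -fr inE.
  have mE r : merge i f r = merge i h r by rewrite mf.
  exists p.
    rewrite !inE; have := mE p; rewrite !ffunE fp eqxx.
    case: (eqVneq (h p) ord_max) => [hp _|_ ->]; last by rewrite eqxx orbT.
    apply/orP; left; apply/eqP; apply: (uniq_max h) => //.
  apply/ffunP=> r; rewrite swap_word; case: tpermP => [->|->|/eqP rp /eqP rv].
  - by rewrite hv.
  - have := mE v; have := mE p; rewrite !ffunE fp hv !eqxx.
    case: (eqVneq (h p) ord_max) => [hp _|nhp <-].
      by rewrite hp -(uniq_max h p v) // fp.
    case: (eqVneq (f v) ord_max) => [fv|//].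
    by rewrite -(uniq_max f v p) // hv eqxx in nhp.
  have := mE r; rewrite !ffunE.
  case: (eqVneq (f r) ord_max) => [fr|_]; first by rewrite (uniq_max f r p) ?eqxx in rp.
  by case: (eqVneq (h r) ord_max) => [hr|//]; rewrite (uniq_max h r v) ?eqxx in rv.
rewrite !inE => vp ->; split; last by rewrite top_act.
apply/eqP/ffunP=> r; rewrite [LHS]ffunE [RHS]ffunE swap_word.
case/orP: vp => [/eqP->|/eqP hp]; first by rewrite tperm1 perm1.
by case: tpermP => // ->; rewrite ?hv ?eqxx hp (negPf nimax).
Qed.

(** By [merge_fiber], the vanishing of face [i] at [h] says that the swaps of [v] with the points of
    triple [i] contribute minus the coefficient of [h]. The k triples together cancel the term [k]
    of the Laplacian. *)
Lemma merge_laplace0 x : top_supported x ->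
  (forall i, i != ord_max -> x *m merge_mx F n i = 0) -> x *m laplace_mx = 0.
Proof.
move=> topx mx0; apply: coordP => h; rewrite coord0 coord_laplace.
have [toph|ntop] := boolP (top h); last first.
  rewrite topx // mulr0 add0r big1 // => q _; rewrite big1 // => p _.
  by rewrite topx // top_act.
have /forallP/(_ ord_max) := toph; rewrite eqxx => /cards1P[v hmax].
have hv q : (h q == ord_max) = (q == v).
  by have := in_set1 q v; rewrite -hmax inE.
rewrite (eq_bigl _ _ hv) big_pred1_eq.
rewrite (partition_big h (fun i => i != ord_max)) //=.
rewrite (eq_bigr (fun=> - coord x h)) => [|i nimax].
  have cardI : #|[pred i : 'I_k.+1 | i != ord_max]| = k.
    by have := cardC1 (@ord_max k); rewrite card_ord.
  by rewrite sumr_const cardI mulNrn mulr_natl subrr.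
have := congr1 (fun y => coord y (merge i h)) (mx0 i nimax).
rewrite coord0 coord_lin_ext (bigID (@top n k)) /= [X in _ + X]big1 ?addr0; last first.
  by move=> f /andP[_ /topx].
rewrite (eq_bigl (fun f => f \in [set f | (merge i f == merge i h) && top f])); last first.
  by move=> f; rewrite inE.
have hvE : h v = ord_max by apply/eqP; rewrite hv.
rewrite (merge_fiber toph hvE nimax) big_imset /=; last first.
  move=> p q _ _ /ffunP/(_ p); rewrite !swap_word tpermL hvE => /esym/eqP.
  by rewrite hv => /eqP tp; apply/(@perm_inj _ (tperm q v)); rewrite tp tpermL.
rewrite big_setU1 ?inE /=; last by rewrite hvE eq_sym.
rewrite tperm1; have -> : fun_act h 1 = h by apply/ffunP=> r; rewrite ffunE invg1 perm1.
move/eqP; rewrite addrC addr_eq0 => /eqP <-; apply: eq_bigl => p; rewrite inE.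
by case: (eqVneq (h p) i) => [->|]; rewrite ?andbF // nimax.
Qed.

(** A merged word avoids [ord_max], so only k letters are left for the k+1 points of [A]. *)
Lemma antisym_merge0 A i : #|A| = k.+1 -> i != ord_max ->
  antisym_mx tr A *m merge_mx F n i = 0.
Proof.
move=> cardA nimax; apply: basis_vec_ext => f; rewrite mulmx0.
have comm : antisym_mx tr A *m merge_mx F n i = merge_mx F n i *m antisym_mx tr A.
  rewrite mulmx_suml mulmx_sumr; apply: eq_bigr => g _.
  by rewrite -scalemxAl -scalemxAr merge_mx_equiv.
rewrite comm mulmxA basis_lin_ext antisym_kill_card // cardA.
have: [set merge i f p | p in A] \subset [set~ ord_max].
  apply/subsetP=> _ /imsetP[p _ ->]; rewrite !inE ffunE.
  by case: (eqVneq (f p) ord_max).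
by move/subset_leq_card; rewrite cardsC1 card_ord.
Qed.

Let W0 := (\sum_(A : {set 'I_n} | #|A| == k.+1) <<antisym_mx tr A>>)%MS.
Let D := (laplace_mx + W0)%MS.

Let D_module : mxmodule tr D.
Proof.
apply: addsmx_module.
  by apply/mxmoduleP=> g _; rewrite -laplace_equiv submxMl.
apply/mxmoduleP=> g _; rewrite sumsmxMr; apply/sumsmx_subP => A cardA.
rewrite (eqmxMr _ (genmxE _)) antisymJ (sumsmx_sup (g @: A)) //.
  by rewrite card_imset //; apply: perm_inj.
by rewrite genmxE submxMl.
Qed.

(** Modulo [D] a top word is an eigenvector for [-k], so if it were nonzero the quotient would
    contain a nonzero [z] antisymmetric over k+1 points. But [z] is then, up to the factor
    [#|Sym A|], an antisymmetrization, and [D] contains all of these; this is why [W0] is divided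
    out along with the image of the Laplacian. *)
Let top_sub f : top f -> (basis_vec F f <= D)%MS.
Proof.
move=> topf; rewrite -in_factmod_eq0; apply/negPn/negP => nz.
have /forallP/(_ ord_max) := topf; rewrite eqxx => /cards1P[v fmax].
have fv q : (f q == ord_max) = (q == v).
  by have := in_set1 q v; rewrite -fmax inE.
have := murphy_antisym (rG := factmod_repr D_module) (v := v) (k := k) nz.
case=> [|A [z [/negP nzz cardA covz]]].
  rewrite mulmx_sumr (eq_bigr (fun p => in_factmod D (basis_vec F (fun_act f (tperm p v))))).
    rewrite -linear_sum -linearZ /=; apply/eqP; rewrite -subr_eq0 -linearB /=.
    rewrite in_factmod_eq0 (submx_trans _ (addsmxSl _ _)) //.
    have <- : basis_vec F f *m laplace_mx = \sum_(p | p != v) basis_vec F (fun_act f (tperm p v)) - (- k%:R) *: basis_vec F f.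
      rewrite basis_lin_ext scaleNr opprK addrC; congr (_ + _).
      rewrite (eq_bigl _ _ fv) big_pred1_eq; apply: eq_bigl => p; by rewrite fv.
    exact: submxMl.
  by move=> p _; rewrite -in_factmodJ ?inE // word_reprE.
apply: nzz.
have := covariant_antisym covz.
have -> : z *m antisym_mx (factmod_repr D_module) A = in_factmod D (val_factmod z *m antisym_mx tr A).
  rewrite in_factmodE -mulmxA mulmx_suml !mulmx_sumr; apply: eq_bigr => g _.
  have zg : z *m factmod_repr D_module g = in_factmod D (val_factmod z *m tr g).
    by rewrite (in_factmodJ D_module) ?inE // val_factmodK.
  by rewrite -scalemxAl -!scalemxAr zg; congr (_ *: _); rewrite mulmxA -in_factmodE.
have -> : in_factmod D (val_factmod z *m antisym_mx tr A) = 0.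
  apply/eqP; rewrite in_factmod_eq0 (submx_trans _ (addsmxSr _ _)) //.
  by rewrite (sumsmx_sup A) ?cardA ?genmxE ?submxMl.
move/esym/eqP; rewrite scaler_eq0 ((pcharf0P F).1 char0) => /orP[|//].
by rewrite -leqn0 leqNgt (cardD1 1%g) inE perm_on1.
Qed.

Lemma laplace_top : laplace_mx *m top_mx F n k = top_mx F n k *m laplace_mx.
Proof.
apply: basis_vec_ext => f; apply: coordP => h.
rewrite !mulmxA coord_top !coord_laplace coord_top mulrDr mulrCA; congr (_ + _).
rewrite mulr_sumr; apply: eq_bigr => q _; rewrite mulr_sumr; apply: eq_bigr => p _.
by rewrite coord_top top_act.
Qed.

Lemma antisym_comm A (B : 'M_#|{: word}|) : (forall g, tr g *m B = B *m tr g) ->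
  antisym_mx tr A *m B = B *m antisym_mx tr A.
Proof.
move=> cB; rewrite mulmx_suml mulmx_sumr; apply: eq_bigr => g _.
by rewrite -scalemxAl -scalemxAr cB.
Qed.

(** A cycle is [y L + w'], with [L] the Laplacian and [w'] a combination of antisymmetrizations
    restricted to top words. Both the cycle and [w'] have zero faces, so [L] kills them; hence
    [y L L = 0], then [y L = 0] by [sym_real_cap], and only [w'] remains. Alternating [w']
    finishes. *)
Lemma top_cycles_antisym :
  (top_cycles F n k <= \sum_(A : {set 'I_n} | #|A| == k.+1)
      <<top_mx F n k *m alt_mx F n k *m antisym_mx tr A>>)%MS.
Proof.
apply/row_subP=> r; set x := row r _.
have /top_cyclesP[topx altx x0] : (x <= top_cycles F n k)%MS := row_sub _ _.
have xD : (x <= D)%MS := basis_vec_sub top_sub topx.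
have /sub_addsmxP[[y w] /= xE] := xD.
pose w' := w *m W0 *m top_mx F n k.
have xE' : x = y *m top_mx F n k *m laplace_mx + w'.
  have /eqP <- : x *m top_mx F n k == x by apply/top_supportedP.
  by rewrite {1}xE mulmxDl -(mulmxA y) laplace_top mulmxA.
have topw' : top_supported w'.
  by move=> f nf; rewrite coord_top (negPf nf) mul0r.
have w'0 i : i != ord_max -> w' *m merge_mx F n i = 0.
  move=> nimax; apply/eqP; rewrite -submx0 /w' -!mulmxA (submx_trans (submxMl _ _)) //.
  rewrite sumsmxMr; apply/sumsmx_subP => A /eqP cardA.
  rewrite (eqmxMr _ (genmxE _)) mulmxA (antisym_comm A (@top_mx_equiv F n k)).
  by rewrite -mulmxA antisym_merge0 // mulmx0 sub0mx.
have xL : x *m laplace_mx = 0.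
  by apply: merge_laplace0 => // i nimax; apply: merge0_all.
have yL : y *m top_mx F n k *m laplace_mx = 0.
  apply: sym_real_cap laplace_sym laplace_real _.
  by move: xL; rewrite {1}xE' mulmxDl (merge_laplace0 topw' w'0) addr0.
rewrite yL add0r in xE'.
have -> : x = (nb_relabel k)%:R^-1 *: (x *m alt_mx F n k).
  have /eqP -> : x *m alt_mx F n k == (nb_relabel k)%:R *: x by apply/alternatingP.
  by rewrite scalerA mulVf ?nb_relabel_neq0 ?scale1r.
rewrite scalemx_sub // xE' /w' -!mulmxA (submx_trans (submxMl _ _)) //.
rewrite sumsmxMr; apply/sumsmx_subP => A cardA; rewrite (sumsmx_sup A) //.
rewrite (eqmxMr _ (genmxE _)) genmxE antisym_comm ?submx_refl // => g.
by rewrite mulmxA top_mx_equiv -!mulmxA alt_mx_equiv.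
Qed.

End TopCycles.

(** * Counting the summands of the top cycles *)

Lemma fiber_perm n (Y : finType) (F G : 'I_n -> Y) :
    (forall y, #|[set x | F x == y]| = #|[set x | G x == y]|) ->
  exists g : 'S_n, forall x, G (g x) = F x.
Proof.
move=> cardFG; pose s := [tuple F i | i < n]; pose t := [tuple G i | i < n].
have cnt (H : 'I_n -> Y) y : count_mem y [tuple H i | i < n] = #|[set x | H x == y]|.
  rewrite -sum1_count big_map big_enum_cond /= -sum1_card.
  by apply: eq_bigl => x; rewrite inE.
have /tuple_permP[p sp] : perm_eq s t.
  by apply/allP=> y _ /=; rewrite !cnt cardFG.
exists p => x; have/(congr1 (fun u => nth (F x) u x)) := sp.
by rewrite -!tnth_nth !tnth_mktuple.
Qed.

(* A 2-regular multigraph (vertices i, edges F (i, c)) can be oriented: choosing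
   an outgoing half-edge at each vertex so that each edge is chosen once. *)
Section Orientation.
Variables (k : nat) (F : 'I_k * bool -> 'I_k).
Hypothesis cardF : forall j, #|[set x | F x == j]| = 2%N.

Local Notation T := ('I_k * bool)%type.

(** On half-edges, [rho] passes to the other half-edge at the same vertex and [tau] to the other end
    of the same edge. *)
Let rho (x : T) : T := (x.1, ~~ x.2).

Let tau (x : T) : T := odflt x [pick y | (y != x) && (F y == F x)].

Let tauP x : [/\ tau x != x, F (tau x) = F x &
  forall y, F y = F x -> y = x \/ y = tau x].
Proof.
have /eqP/cards2P[a [b [nab fib]]] := cardF (F x).
have [y]: exists y, (y != x) && (F y == F x).
  have: x \in [set a; b] by rewrite -fib inE.
  have /eqP Fa : F a == F x by have := set21 a b; rewrite -fib inE.
  have /eqP Fb : F b == F x by have := set22 a b; rewrite -fib inE.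
  rewrite !inE => /orP[]/eqP xE; [exists b|exists a]; rewrite xE ?(eq_sym b) nab /=.
    by rewrite Fb -xE.
  by rewrite Fa -xE.
rewrite /tau; case: pickP => [z /andP[zx /eqP Fz] _|/(_ y)-> //] /=; split=> // u Fu.
have mem v : F v = F x -> v \in [set a; b] by rewrite -fib inE => ->.
have := mem u Fu; have := mem z Fz; have := mem x erefl; rewrite !inE.
by case/orP=> /eqP xE; case/orP=> /eqP zE; case/orP=> /eqP uE;
  rewrite ?xE ?zE ?uE ?eqxx // in zx *; auto.
Qed.

Let tauK : involutive tau.
Proof.
move=> x; have [n1 f1 u1] := tauP x; have [n2 f2 u2] := tauP (tau x).
by case: (u1 (tau (tau x))); rewrite ?f2 // => e; move: n2; rewrite e eqxx.
Qed.

Let rhoK : involutive rho.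
Proof. by case=> i b; rewrite /rho /= negbK. Qed.

Let rho_neq x : rho x != x.
Proof. by case: x => i []; rewrite /rho xpair_eqE eqxx. Qed.

Let c := (perm (inv_inj rhoK) * perm (inv_inj tauK))%g.

Let cE x : c x = tau (rho x).
Proof. by rewrite permM !permE. Qed.

Let rhoc x : c (rho (c x)) = rho x.
Proof. by rewrite !cE rhoK tauK. Qed.

(** Descent by two: as [rho] is recovered by applying [c], [rho] and [c] in turn, an equality
    [c^(j+2) x = rho x] would give [c^j (c x) = rho (c x)], down to a fixed point of [rho] or
    [tau]. *)
Let iter_c_rho j x : (c ^+ j)%g x != rho x.
Proof.
elim/ltn_ind: j x => -[|[|j]] IHj x; first by rewrite perm1 eq_sym rho_neq.
  by rewrite expg1 cE; have [] := tauP (rho x).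
apply/eqP => e; have /negP[] := IHj j (leqnSn _) (c x).
rewrite -permM -expgS; apply/eqP; apply: (@perm_inj _ c).
by rewrite rhoc -permM -expgSr.
Qed.

Let porbit_rho x : porbit c (rho x) != porbit c x.
Proof.
apply/negP => /eqP e; have: rho x \in porbit c x by rewrite -e porbit_id.
by case/porbitP => j /eqP; rewrite eq_sym (negPf (iter_c_rho _ _)).
Qed.

(** The cycles of [c] through [x] and [rho x] are distinct: they are the two directions of travel
    around one component. Comparing their ranks selects one direction for the whole component. *)
Let out x := (enum_rank (porbit c x) < enum_rank (porbit c (rho x)))%N.

Let out_rho x : out (rho x) = ~~ out x.
Proof.
rewrite /out rhoK -leqNgt ltn_neqAle andb_idl // => _.
by apply: contra (porbit_rho x) => /eqP/val_inj/enum_rank_inj ->.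
Qed.

Let out_tau x : out (tau x) = ~~ out x.
Proof.
have pc y : porbit c (c y) = porbit c y.
  by apply/esym/eqP; rewrite eq_porbit_mem porbit_sym; have := mem_porbit c 1 y; rewrite expg1.
rewrite -out_rho -[x in LHS]rhoK -cE /out pc.
by rewrite -(pc (rho (c (rho x)))) rhoc.
Qed.

Lemma orientation : exists o : 'I_k -> bool, injective (fun i => F (i, o i)).
Proof.
pose o i := out (i, true).
have outE i b : out (i, b) = (b == o i).
  by case: b; rewrite /o ?eqb_id //; rewrite -[(i, false)]/(rho (i, true)) out_rho; case: out.
exists o => i j /=; have [_ _ uniq] := tauP (i, o i) => Fij.
case: (uniq (j, o j)) => [//|[]|e] //.
by have := outE j (o j); rewrite eqxx e out_tau outE eqxx.
Qed.

End Orientation.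

(* The components of a cyclic generator w along a direct decomposition are
   nonzero and inherit the covariance of w. *)
Lemma card_summands (F : fieldType) (gT : finGroupType) (G : {group gT}) d
    (rG : mx_representation F G d) (H : 'M_d) (w : 'rV_d) (C : gT -> F -> Prop)
    r (E : 'M_(d, r)) (I : finType) (M : I -> 'M_d) :
    (forall i, mxmodule rG (M i)) -> (forall i, M i != 0) ->
    (\sum_i M i :=: H)%MS -> mxdirect (\sum_i M i) ->
    (w <= H)%MS -> (H <= cyclic_mx rG w)%MS ->
    (forall g c, C g c -> g \in G /\ w *m rG g = c *: w) ->
    (forall x : 'rV_d, (x <= H)%MS -> (forall g c, C g c -> x *m rG g = c *: x) ->
       x *m E = 0 -> x = 0) ->
  (#|I| <= r)%N.
Proof.
move=> modM nzM defH dxM wH Hw covw inj.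
pose N i := (\sum_(j | j != i) M j)%MS; pose p i := proj_mx (M i) (N i).
have modN i : mxmodule rG (N i) by apply: sumsmx_module.
have MN0 i : (M i :&: N i = 0)%MS by have /mxdirect_sumsP/(_ i isT) := dxM.
have addMN i : (M i + N i :=: H)%MS.
  by apply: eqmx_trans defH; rewrite [X in (_ :=: X)%MS](bigD1 i).
pose v i := w *m p i.
have vM i : (v i <= M i)%MS by apply: proj_mx_sub.
have vH i : (v i <= H)%MS by apply: submx_trans (vM i) _; rewrite -defH (sumsmx_sup i).
have covv i g c : C g c -> v i *m rG g = c *: v i.
  case/covw=> Gg wg; have hom := proj_mx_hom (MN0 i) (modM i) (modN i).
  have hw : (w <= dom_hom_mx rG (p i))%MS by apply: submx_trans hom; rewrite addMN.
  by rewrite -(hom_mxP hw) // wg -scalemxAl.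
have nzv i : v i != 0.
  apply: contraNneq (nzM i) => vi0.
  have wN : (w <= N i)%MS.
    by rewrite -(add_proj_mx (MN0 i) (_ : (w <= M i + N i)%MS)) ?addMN // -/(p i) -/(v i) vi0 add0r proj_mx_sub.
  have HN : (H <= N i)%MS by apply: submx_trans Hw _; apply: cyclic_mx_sub.
  rewrite -submx0 -(MN0 i) sub_capmx submx_refl (submx_trans _ HN) //.
  by rewrite -defH (sumsmx_sup i).
pose V := \matrix_(i < #|I|) v (enum_val i).
(* A linear relation among the images under [E] lifts to one among the components [v i], since [E]
   is injective on covariant vectors; projecting to each summand kills its coefficients. *)
suff freeVE : row_free (V *m E) by rewrite -(eqP freeVE) rank_leq_col.
rewrite -kermx_eq0; apply/rowV0P => u /sub_kermxP; rewrite mulmxA => uVE.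
have uVs : u *m V = \sum_j u 0 j *: v (enum_val j).
  by rewrite mulmx_sum_row; apply: eq_bigr => j _; rewrite rowK.
have uV0 : u *m V = 0.
  apply: inj uVE => [|g c Cgc]; rewrite uVs.
    by apply: summx_sub => j _; apply: scalemx_sub.
  rewrite mulmx_suml scaler_sumr; apply: eq_bigr => j _.
  by rewrite -scalemxAl (covv _ _ c) // !scalerA mulrC.
apply/rowP => j; rewrite mxE; apply/eqP; have := congr1 (mulmx^~ (p (enum_val j))) uV0.
rewrite uVs mul0mx mulmx_suml (bigD1 j) //= big1 ?addr0 => [|l lj].
  rewrite -scalemxAl proj_mx_id // => /eqP; rewrite scaler_eq0 (negPf (nzv _)) orbF.
  by [].
rewrite -scalemxAl proj_mx_0 ?scaler0 // (submx_trans (vM _)) // (sumsmx_sup (enum_val l)) //.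
by rewrite (inj_eq enum_val_inj).
Qed.

(** * The generator of the top cycles and its symmetries *)

Section Generator.
Variables (F : numClosedFieldType) (k : nat).
Local Notation n := (3 * k + 1)%N.
Local Notation word := {ffun 'I_n -> 'I_k.+1}.
Local Notation tr := (word_repr F n 'I_k.+1).
Local Notation H := (top_cycles F n k).
Local Notation T := ('I_k.+1 + 'I_k * bool)%type.
Implicit Types (f : word) (x : 'rV[F]_#|{: word}|) (g : 'S_n).

Let char0 : [pchar F] =i pred0. Proof. exact: pchar_num. Qed.

Lemma card_points : #|{: T}| = n.
Proof. by rewrite card_sum card_prod card_bool !card_ord; lia. Qed.

(** The [inl i] are the k+1 base points, the last of which is uncovered in a standard word; the
    other 2k points come in the k pairs [inr (i, _)]. *)
Definition pt (t : T) : 'I_n := cast_ord card_points (enum_rank t).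
Definition unpt (p : 'I_n) : T := enum_val (cast_ord (esym card_points) p).

Lemma ptK : cancel pt unpt.
Proof. by move=> t; rewrite /unpt /pt cast_ordK enum_rankK. Qed.

Lemma unptK : cancel unpt pt.
Proof. by move=> p; rewrite /unpt /pt enum_valK cast_ordKV. Qed.

Definition pt_perm_fun (s : {perm T}) (p : 'I_n) := pt (s (unpt p)).

Lemma pt_perm_subproof s : injective (pt_perm_fun s).
Proof.
move=> p q /(can_inj ptK)/perm_inj e.
exact: (can_inj unptK).
Qed.

Definition pt_perm s : 'S_n := perm (@pt_perm_subproof s).

Lemma pt_permE s t : pt_perm s (pt t) = pt (s t).
Proof. by rewrite permE /pt_perm_fun ptK. Qed.

Definition embed_perm (h : 'S_k) : 'S_k.+1 := lift_perm ord_max ord_max h.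

Lemma embed_max h : embed_perm h ord_max = ord_max.
Proof. exact: lift_perm_id. Qed.

Lemma embed_lift h i : embed_perm h (lift ord_max i) = lift ord_max (h i).
Proof. exact: lift_perm_lift. Qed.

Lemma odd_embed h : odd_perm (embed_perm h) = odd_perm h.
Proof. by rewrite odd_lift_perm addbb. Qed.

(* The points are identified with T through pt.  The i-th triple of std_word pi
   is {inl i, inr (i, false), inr (j, true)} where pi j = i. *)
Definition std_word (pi : 'S_k) : word :=
  [ffun p => match unpt p with
             | inl i => i
             | inr (i, b) => lift ord_max (if b then pi i else i)
             end].

Definition base_pts : {set 'I_n} := [set pt (inl i) | i in 'I_k.+1].

(** The base points take all k+1 letters once; if two of them shared a letter, the
    antisymmetrization would vanish. *)
Definition generator : 'rV[F]_#|{: word}| :=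
  basis_vec F (std_word 1) *m alt_mx F n k *m antisym_mx tr base_pts.

Lemma card_pt (P : pred T) : #|[set p | P (unpt p)]| = #|[set t | P t]|.
Proof.
rewrite -(card_imset _ (can_inj ptK)); apply: eq_card => p.
rewrite !inE; apply/idP/imsetP => [Pp|[t]]; first by exists (unpt p); rewrite ?inE ?unptK.
by rewrite inE => Pt ->; rewrite ptK.
Qed.

Lemma base_pts_inl t : (pt t \in base_pts) = if t is inl _ then true else false.
Proof.
apply/imsetP/idP => [[i _ /(can_inj ptK) ->]//|]; case: t => // i _.
by exists i.
Qed.

Lemma card_base_pts : #|base_pts| = k.+1.
Proof. by rewrite card_imset ?card_ord // => i j /(can_inj ptK)[]. Qed.

Lemma fiber_std_word (i : 'I_k.+1) (b : bool) :
  #|[set p | (std_word 1 p, p \in base_pts) == (i, b)]| =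
  if b then 1%N else if i == ord_max then 0%N else 2%N.
Proof.
pose P (t : T) := (match t with inl i => (i, true) | inr (j, _) => (lift ord_max j, false) end : 'I_k.+1 * bool) == (i, b).
rewrite (_ : [set p | _] = [set p | P (unpt p)]); last first.
  apply/setP=> p; rewrite !inE /P ffunE -{2}[p]unptK base_pts_inl.
  by case: (unpt p) => // -[j c]; rewrite perm1 if_same.
rewrite card_pt /P; case: b {P} => /=.
  rewrite (_ : [set t | _] = [set inl i]) ?cards1 //; apply/setP=> -[j|[j c]]; rewrite !inE xpair_eqE //.
    by rewrite eqxx andbT.
  by rewrite andbF.
case: (unliftP ord_max i) => [j ->|->].
  rewrite [_ == ord_max]eq_sym (negPf (neq_lift _ _)).
  have ne : inr (j, true) != inr (j, false) :> T by apply/eqP => -[].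
  rewrite (_ : [set t | _] = [set inr (j, true); inr (j, false)]); first by rewrite cards2 ne.
  apply/setP=> -[l|[l c]]; rewrite !inE xpair_eqE ?andbF // eqxx andbT.
  rewrite (inj_eq lift_inj) -[RHS]/(((l, c) == (j, true)) || ((l, c) == (j, false))) !xpair_eqE.
  by case: c; rewrite ?andbT ?andbF ?orbF.
rewrite eqxx; apply: eq_card0 => -[l|[l c]]; rewrite !inE xpair_eqE ?andbF //.
by rewrite eqxx andbT eq_sym (negPf (neq_lift _ _)).
Qed.

Lemma top_std_word : top (std_word 1).
Proof.
apply/forallP => i; rewrite -(cardsID base_pts).
have -> : [set p | std_word 1 p == i] :&: base_pts = [set p | (std_word 1 p, p \in base_pts) == (i, true)].
  by apply/setP=> p; rewrite !inE xpair_eqE eqb_id.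
have -> : [set p | std_word 1 p == i] :\: base_pts = [set p | (std_word 1 p, p \in base_pts) == (i, false)].
  by apply/setP=> p; rewrite !inE xpair_eqE andbC; case: (_ \in base_pts); rewrite ?andbT ?andbF.
by rewrite !fiber_std_word; case: ifP.
Qed.

(** These are the counts of [fiber_std_word], so [fiber_perm] yields a permutation carrying [f] and
    [A] simultaneously to the standard word and the base points. *)
Lemma fiber_top f (A : {set 'I_n}) (i : 'I_k.+1) (b : bool) :
    top f -> {in A &, injective f} -> #|A| = k.+1 ->
  #|[set p | (f p, p \in A) == (i, b)]| =
  if b then 1%N else if i == ord_max then 0%N else 2%N.
Proof.
move=> topf injf cardA.
have imf : f @: A = [set: 'I_k.+1].
  by apply/eqP; rewrite eqEcard subsetT card_in_imset // cardA cardsT card_ord leqnn.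
have fib1 : #|[set p | (f p, p \in A) == (i, true)]| = 1%N.
  have /imsetP[p Ap ip] : i \in f @: A by rewrite imf inE.
  rewrite (_ : [set _ | _] = [set p]) ?cards1 //; apply/setP=> q.
  rewrite !inE xpair_eqE eqb_id; apply/andP/eqP => [[/eqP fq Aq]|->]; last by rewrite ip.
  by apply: injf => //; rewrite fq.
case: b => //; have /forallP/(_ i) := topf.
rewrite -(cardsID A).
have -> : [set p | f p == i] :&: A = [set p | (f p, p \in A) == (i, true)].
  by apply/setP=> p; rewrite !inE xpair_eqE eqb_id.
have -> : [set p | f p == i] :\: A = [set p | (f p, p \in A) == (i, false)].
  by apply/setP=> p; rewrite !inE xpair_eqE andbC; case: (_ \in A); rewrite ?andbT ?andbF.
by rewrite fib1 add1n; case: ifP => _ /eqP[].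
Qed.

Lemma basis_relabel_alt (s : 'S_k.+1) f : s ord_max = ord_max ->
  basis_vec F (relabel s f) *m alt_mx F n k = (-1) ^+ s *: (basis_vec F f *m alt_mx F n k).
Proof.
move=> smax; rewrite !basis_lin_ext scaler_sumr (reindex_inj (mulgI s^-1%g)) /=.
apply: eq_big => [t|t _]; first by rewrite permM -{1}smax permK.
by rewrite relabelM mulKVg odd_permM odd_permV signr_addb scalerA.
Qed.

Lemma generator_sub : (0 < k)%N -> (generator <= H)%MS.
Proof.
move=> kgt0; have altE (x : 'rV[F]_#|{: word}|) : x *m alt_mx F n k *m antisym_mx tr base_pts = x *m antisym_mx tr base_pts *m alt_mx F n k.
  by rewrite -!mulmxA -antisym_comm // => g; rewrite alt_mx_equiv.
apply/top_cyclesP; split.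
- have f0 : basis_vec F (std_word 1) = basis_vec F (std_word 1) *m top_mx F n k.
    by rewrite basis_lin_ext top_std_word scale1r.
  apply/top_supportedP; rewrite /generator -!mulmxA (antisym_comm base_pts (@top_mx_equiv F n k)).
  rewrite {2}f0 -!mulmxA; apply/eqP; congr (_ *m _); rewrite !mulmxA; congr (_ *m _).
  apply: basis_vec_ext => f; apply: coordP => h.
  rewrite !mulmxA coord_top !coord_alt mulr_sumr; apply: eq_bigr => s /eqP smax.
  by rewrite coord_top top_relabel // mulrCA.
- by rewrite /generator altE; apply: alternating_alt.
rewrite /generator -(mulmxA _ (antisym_mx _ _)) antisym_merge0 ?mulmx0 ?card_base_pts //.
by apply/eqP => /(congr1 val)/=; lia.
Qed.

(** The antisymmetrization of [f] over [A] vanishes unless [f] is injective on [A]; in that case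
    some permutation carries the pair to [std_word 1] and [base_pts], so the antisymmetrization is a
    translate of [generator]. *)
Lemma top_cycles_cyclic : (H <= cyclic_mx tr generator)%MS.
Proof.
apply: submx_trans (top_cycles_antisym F n k) _; apply/sumsmx_subP => A /eqP cardA.
rewrite genmxE; apply/row_subP => r; rewrite -[r]enum_valK.
move: (enum_val r) => f {r}; rewrite rowE -/(basis_vec F f) !mulmxA basis_lin_ext.
have [topf|_] := boolP (top f); last by rewrite scale0r !mul0mx sub0mx.
rewrite scale1r.
have [/dinjectiveP injf|/dinjectivePn[p Ap [q]]] := boolP (dinjectiveb f (mem A)); last first.
  rewrite !inE => /andP[qp Aq] fpq; rewrite basis_lin_ext mulmx_suml summx_sub // => s _.
  rewrite -scalemxAl (antisym_kill _ (p := p) (q := q)) ?scaler0 ?sub0mx // 1?eq_sym //.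
  by rewrite !ffunE fpq.
have [|g fg] := @fiber_perm n _ (fun p => (f p, p \in A)) (fun p => (std_word 1 p, p \in base_pts)).
  by case=> i b; rewrite fiber_top // fiber_std_word.
have fE : fun_act f g = std_word 1.
  by apply/ffunP => p; rewrite ffunE; have [<- _] := fg (g^-1%g p); rewrite permKV.
have AE : g @: A = base_pts.
  apply/setP => p; rewrite -[p in LHS](permKV g) mem_imset ?perm_inj //; last exact: perm_inj.
  by have [_ <-] := fg (g^-1%g p); rewrite permKV.
suff -> : basis_vec F f *m alt_mx F n k *m antisym_mx tr A = generator *m tr g^-1%g.
  by apply: mxmodule_trans (cyclic_mx_id _ _); rewrite ?cyclic_mx_module ?inE.
have -> : generator = basis_vec F f *m alt_mx F n k *m antisym_mx tr A *m tr g.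
  rewrite /generator -fE -word_reprE -AE -(mulmxA _ (tr g)) alt_mx_equiv.
  by rewrite mulmxA -(mulmxA _ (tr g)) -antisymJ !mulmxA.
by rewrite -(reprM tr) mulgV (repr1 tr).
Qed.

Definition half_swap_fun (o : 'I_k -> bool) (t : T) : T :=
  match t with inl i => inl i | inr (i, b) => inr (i, b (+) o i) end.

Lemma half_swap_inj o : injective (half_swap_fun o).
Proof.
apply: (can_inj (g := half_swap_fun o)) => -[i|[i b]] //=.
by rewrite -addbA addbb addbF.
Qed.

Definition half_swap o : 'S_n := pt_perm (perm (@half_swap_inj o)).

Definition diag_perm_fun (h : 'S_k) (t : T) : T :=
  match t with inl i => inl (embed_perm h i) | inr (i, b) => inr (h i, b) end.

Lemma diag_perm_inj h : injective (diag_perm_fun h).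
Proof.
by move=> [i|[i b]] [j|[j c]] //= [/perm_inj ->] // ->.
Qed.

Definition diag_perm h : 'S_n := pt_perm (perm (@diag_perm_inj h)).

Lemma half_swapE o t : half_swap o (pt t) = pt (half_swap_fun o t).
Proof. by rewrite pt_permE permE. Qed.

Lemma diag_permE h t : diag_perm h (pt t) = pt (diag_perm_fun h t).
Proof. by rewrite pt_permE permE. Qed.

(** The three kinds serve to bring a word to standard form: they reorder the base points, orient the
    multigraph of pairs and triples, and conjugate the resulting permutation. *)
Variant generator_symmetry : 'S_n -> F -> Prop :=
 | BaseSym g of g \in Sym base_pts : generator_symmetry g ((-1) ^+ g)
 | HalfSwap o : generator_symmetry (half_swap o) 1
 | DiagPerm h : generator_symmetry (diag_perm h) ((-1) ^+ h).

Lemma im_base_pts g : {in base_pts, forall p, g p \in base_pts} -> g @: base_pts = base_pts.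
Proof.
move=> st; apply/eqP; rewrite eqEcard card_imset ?leqnn ?andbT; last exact: perm_inj.
by apply/subsetP=> _ /imsetP[p Bp ->]; apply: st.
Qed.

Lemma generator_act g : g @: base_pts = base_pts ->
  generator *m tr g = basis_vec F (fun_act (std_word 1) g) *m alt_mx F n k *m antisym_mx tr base_pts.
Proof.
move=> gB; rewrite /generator -(mulmxA _ _ (tr g)) antisymJ gB !mulmxA; congr (_ *m _).
by rewrite -mulmxA -alt_mx_equiv mulmxA word_reprE.
Qed.

Lemma generator_symmetryP g c : generator_symmetry g c ->
  g \in [set: 'S_n] /\ generator *m tr g = c *: generator.
Proof.
move=> sym; split; first by rewrite inE.
case: sym => {g c} [g Bg|o|h].
- by have := @antisym_cov _ _ _ tr base_pts (basis_vec F (std_word 1) *m alt_mx F n k) g Bg.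
- rewrite generator_act ?scale1r; last first.
    apply: im_base_pts => p; rewrite -[p]unptK base_pts_inl half_swapE base_pts_inl.
    by case: (unpt p) => [|[]].
  congr (basis_vec F _ *m _ *m _); apply/ffunP=> p; rewrite ffunE.
  rewrite -[p](permKV (half_swap o)); set q := (half_swap o)^-1%g p; rewrite permK.
  rewrite -[q]unptK half_swapE !ffunE !ptK; case: (unpt q) => //= -[i b].
  by rewrite perm1 !if_same.
rewrite generator_act; last first.
  apply: im_base_pts => p; rewrite -[p]unptK base_pts_inl diag_permE base_pts_inl.
  by case: (unpt p) => [|[]].
have -> : fun_act (std_word 1) (diag_perm h) = relabel (embed_perm h)^-1%g (std_word 1).
  apply/ffunP=> p; rewrite ffunE.
  rewrite -[p](permKV (diag_perm h)); set q := (diag_perm h)^-1%g p; rewrite permK.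
  rewrite -[q]unptK diag_permE !ffunE !ptK; case: (unpt q) => [i|[i b]] /=.
    by rewrite permK.
  by rewrite !perm1 !if_same -embed_lift permK.
rewrite basis_relabel_alt ?odd_permV ?odd_embed -?scalemxAl //.
by apply: (@perm_inj _ (embed_perm h)); rewrite permKV embed_max.
Qed.

(** This plays the role of [E] in [card_summands]; its number of columns is the bound on the number
    of summands. *)
Definition class_eval : 'M[F]_(#|{: word}|, #|classes [set: 'S_k]|) :=
  \matrix_(i, j) (enum_val i == std_word (repr (enum_val j)))%:R.

Lemma class_evalE x j : (x *m class_eval) 0 j = coord x (std_word (repr (enum_val j))).
Proof.
rewrite mxE (bigD1 (enum_rank (std_word (repr (enum_val j))))) //= mxE enum_rankK eqxx mulr1.
rewrite big1 ?addr0 // => i ne; rewrite mxE (_ : _ == _ = false) ?mulr0 //.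
by apply: contraNF ne => /eqP <-; rewrite enum_valK.
Qed.

Section Symmetric.
Variable x : 'rV[F]_#|{: word}|.
Hypothesis xH : (x <= H)%MS.
Hypothesis symx : forall g c, generator_symmetry g c -> x *m tr g = c *: x.

Let coord_sym g c f : generator_symmetry g c -> c != 0 ->
  coord x [ffun p => f (g p)] = 0 -> coord x f = 0.
Proof.
move=> /symx xg nzc; rewrite -coord_word xg coordZ => /eqP.
by rewrite mulf_eq0 (negPf nzc) => /eqP.
Qed.

Let coord_rel (s : 'S_k.+1) f : s ord_max = ord_max ->
  coord x (relabel s f) = 0 -> coord x f = 0.
Proof.
move=> smax; have /top_cyclesP[_ altx _] := xH.
by rewrite altx // => /eqP; rewrite mulf_eq0 signr_eq0 => /eqP.
Qed.

Let embedV_max h : (embed_perm h)^-1%g ord_max = ord_max :> 'I_k.+1.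
Proof. by apply: (@perm_inj _ (embed_perm h)); rewrite permKV embed_max. Qed.

(** Permuting base points and pairs together by a power of [h], and renaming the triples
    accordingly, conjugates [pi] and changes the coefficient only by signs. *)
Lemma coord_conj pi h : coord x (std_word (pi ^ h)) = 0 -> coord x (std_word pi) = 0.
Proof.
move=> x0; apply: (coord_sym (DiagPerm h^-1%g)); rewrite ?signr_eq0 //.
apply: (coord_rel (embedV_max h^-1%g)); rewrite -[RHS]x0; congr coord.
apply/ffunP=> p; rewrite !ffunE -[p]unptK diag_permE !ptK.
case: (unpt p) => [i|[i b]] /=; first by rewrite permK.
apply: (canLR (permK _)); rewrite embed_lift; congr lift.
by case: b => //; rewrite conjgE !permM permK.
Qed.

Lemma coord_std_word pi : x *m class_eval = 0 -> coord x (std_word pi) = 0.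
Proof.
move=> xE; have Cpi : pi ^: [set: 'S_k] \in classes [set: 'S_k] by apply: mem_classes; rewrite inE.
have := class_evalE x (enum_rank_in Cpi (pi ^: [set: 'S_k])).
rewrite xE mxE enum_rankK_in // => /esym.
have /imsetP[h _ ->] := mem_repr _ (class_refl [set: 'S_k]%G pi).
exact: coord_conj.
Qed.

Lemma coord_top_inj f : top f -> {in base_pts &, injective f} ->
  x *m class_eval = 0 -> coord x f = 0.
Proof.
move=> topf injf xE.
have fib := fiber_top _ _ topf injf card_base_pts.
have npt (y : 'I_k * bool) : f (pt (inr y)) != ord_max.
  apply/eqP => fy; have /eqP := fib ord_max false; rewrite eqxx cards_eq0 => /eqP/setP/(_ (pt (inr y))).
  by rewrite !inE base_pts_inl fy eqxx.
(* [L] gives the triple of each point outside the base. Pairs become the vertices and triples the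
   edges of a multigraph, 2-regular because a triple has exactly two such points. *)
pose L y := odflt y.1 (unlift ord_max (f (pt (inr y)))).
have LE y : lift ord_max (L y) = f (pt (inr y)).
  by rewrite /L; case: unliftP => [j ->//|/eqP]; rewrite (negPf (npt y)).
have cardL j : #|[set y | L y == j]| = 2%N.
  have := fib (lift ord_max j) false; rewrite eq_sym (negPf (neq_lift _ _)) => <-.
  have inj_pt : injective (fun y : 'I_k * bool => pt (inr y)).
    by move=> y z /(can_inj ptK)[].
  rewrite -(card_imset _ inj_pt); apply: eq_card => p; rewrite !inE xpair_eqE.
  apply/imsetP/andP => [[y]|].
    by rewrite inE => /eqP Ly ->; rewrite -LE Ly eqxx base_pts_inl.
  rewrite -[p]unptK base_pts_inl; case: (unpt p) => [i [_ //]|y [/eqP fp _]].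
  by exists y => //; rewrite inE -(inj_eq (@lift_inj _ ord_max)) LE fp.
have [o inj_o] := orientation cardL.
(* The half of each pair chosen by [o] meets every triple once, and so does the other half. Swapping
   the chosen half to the front and renaming the triples by the inverse of [c0] puts the front
   halves in standard position. *)
pose c0 := perm inj_o.
have inj_o' : injective (fun i => L (i, ~~ o i)).
  move=> i j Lij; apply/eqP/negPn/negP => nij.
  pose l := c0^-1%g (L (i, ~~ o i)).
  have Ll : L (l, o l) = L (i, ~~ o i) by rewrite -[L (l, _)](permE inj_o) permKV.
  have := cardL (L (i, ~~ o i)).
  rewrite (cardsD1 (i, ~~ o i)) (cardsD1 (j, ~~ o j)) (cardsD1 (l, o l)) !inE /=.
  rewrite -Lij Ll !eqxx !xpair_eqE [j == i]eq_sym (negPf nij) /=.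
  have ne m : (l == m) && (o l == ~~ o m) = false.
    by apply/negP => /andP[/eqP -> /eqP]; case: (o m).
  by rewrite !ne.
pose c1 := perm inj_o'.
apply: (coord_sym (HalfSwap o)); rewrite ?oner_eq0 //.
apply: (coord_rel (embedV_max c0)).
set f1 := relabel _ _.
have f1E i b : f1 (pt (inr (i, b))) = lift ord_max (if b then (c1 * c0^-1)%g i else i).
  rewrite /f1 !ffunE half_swapE /= -LE; apply: (canLR (permK _)); rewrite embed_lift; congr lift.
  by case: b => /=; rewrite ?permM ?permKV permE.
have inj_a : injective (fun i => f1 (pt (inl i))).
  move=> i j; rewrite /f1 !ffunE !half_swapE /= => /perm_inj/injf.
  by rewrite !base_pts_inl => /(_ isT isT)/(can_inj ptK)[].
(* What remains is to permute the base points among themselves, which leaves the standard word of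
   [c1] followed by the inverse of [c0]. *)
pose a := perm inj_a.
pose gf (t : T) : T := if t is inl i then inl (a^-1%g i) else t.
have inj_g : injective gf by move=> [i|y] [j|z] //= [] // /perm_inj ->.
pose g := pt_perm (perm inj_g).
have gE t : g (pt t) = pt (gf t) by rewrite pt_permE permE.
have Bg : g \in Sym base_pts.
  rewrite inE; apply/subsetP=> p; rewrite inE -[p]unptK base_pts_inl gE.
  by case: (unpt p) => // y; rewrite eqxx.
apply: (coord_sym (BaseSym Bg)); rewrite ?signr_eq0 //.
rewrite -[RHS](coord_std_word (c1 * c0^-1)%g xE); congr coord.
apply/ffunP=> p; rewrite ffunE [RHS]ffunE -[in LHS](unptK p) gE.
case: (unpt p) => [i|[i b]] /=; last by rewrite f1E.
by rewrite -[LHS](permE inj_a) permKV.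
Qed.

Lemma class_eval_inj : x *m class_eval = 0 -> x = 0.
Proof.
move=> xE; apply: coordP => f; rewrite coord0.
have /top_cyclesP[topx _ _] := xH.
have [topf|/topx//] := boolP (top f).
have [/dinjectiveP injf|/dinjectivePn[p Bp [q]]] := boolP (dinjectiveb f (mem base_pts)).
  exact: coord_top_inj.
rewrite !inE => /andP[qp Bq] fpq.
(* Two base points with the same letter: exchanging them fixes the word but negates its
   coefficient. *)
have Bpq : tperm p q \in Sym base_pts.
  rewrite inE; apply: subset_trans (tperm_on p q) _.
  by apply/subsetP=> z; rewrite !inE => /orP[] /eqP->.
have := coord_word x (tperm p q) f; rewrite (symx (BaseSym Bpq)) odd_tperm eq_sym qp.
rewrite expr1 scaleN1r /coord mxE -/(coord x f).
have -> : [ffun r => f (tperm p q r)] = f.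
  by apply/ffunP=> r; rewrite ffunE; case: tpermP => // ->.
move/eqP; rewrite eq_sym -addr_eq0 -mulr2n -mulr_natl mulf_eq0.
by rewrite ((pcharf0P F).1 char0) => /eqP.
Qed.

End Symmetric.

Lemma card_top_cycles_summands (I : finType) (M : I -> 'M_#|{: word}|) : (0 < k)%N ->
  (forall i, mxmodule tr (M i)) -> (forall i, M i != 0) ->
  (\sum_i M i :=: H)%MS -> mxdirect (\sum_i M i) ->
  (#|I| <= #|classes [set: 'S_k]|)%N.
Proof.
move=> kgt0 modM nzM defM dxM.
apply: (card_summands modM nzM defM dxM (generator_sub kgt0) top_cycles_cyclic generator_symmetryP).
exact: class_eval_inj.
Qed.

End Generator.

(** * Conjugacy classes and partitions into odd parts *)

Section CycleType.
Local Open Scope nat_scope.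
Variable k : nat.
Implicit Types s t : 'S_k.

Definition sorted_porbits s : seq {set 'I_k} :=
  sort (relpre (fun Q : {set 'I_k} => #|Q|) geq) (enum (porbits s)).

Definition cycle_type s : seq nat := [seq #|Q| | Q : {set 'I_k} <- sorted_porbits s].

Lemma perm_expg_eq s x a b :
  ((s ^+ a)%g x == (s ^+ b)%g x) = (a == b %[mod #|porbit s x|]).
Proof.
have modE c : (s ^+ c)%g x = nth x (traject s x #|porbit s x|) (c %% #|porbit s x|).
  have lt_c : (c %% #|porbit s x| < #|porbit s x|)%N.
    by rewrite ltn_mod lt0n card_porbit_neq0.
  have per : (s ^+ #|porbit s x|)%g x = x by rewrite permX iter_porbit.
  rewrite nth_traject // {1}(divn_eq c #|porbit s x|) expgD permM -permX.
  elim: (c %/ _) => [|q IHq]; first by rewrite perm1.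
  by rewrite mulSn expgD permM per.
have lt_m c : (c %% #|porbit s x| < size (traject s x #|porbit s x|))%N.
  by rewrite size_traject ltn_mod lt0n card_porbit_neq0.
by rewrite !modE nth_uniq // uniq_traject_porbit.
Qed.

(** The cycles of both permutations are listed by decreasing length; the conjugator sends the j-th
    iterate of the representative of a cycle of [s] to the j-th iterate of the representative of the
    cycle of [t] with the same index. Equal lengths make this injective and compatible with wrapping
    around. *)
Lemma cycle_type_conj s t : cycle_type s = cycle_type t -> exists h, t = (s ^ h)%g.
Proof.
move=> eq_st; have [k0|x0] : k = 0%N \/ inhabited 'I_k.
  by case: (posnP k) => [|k_gt0]; [left | right; exists; apply: Ordinal k_gt0].
  by exists 1%g; apply/permP => -[i lt_i]; exfalso; rewrite k0 in lt_i.
case: x0 => x0.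
pose Q u x := index (porbit u x) (sorted_porbits u).
pose r u i := odflt x0 [pick y in nth set0 (sorted_porbits u) i].
have Qlt u x : (Q u x < size (sorted_porbits u))%N.
  by rewrite index_mem mem_sort mem_enum imset_f.
have nthQ u x : nth set0 (sorted_porbits u) (Q u x) = porbit u x.
  by rewrite nth_index // -index_mem Qlt.
have us u : uniq (sorted_porbits u) by rewrite sort_uniq enum_uniq.
have rP u i : (i < size (sorted_porbits u))%N -> porbit u (r u i) = nth set0 (sorted_porbits u) i.
  move=> lt_i; have: nth set0 (sorted_porbits u) i \in porbits u.
    by rewrite -mem_enum -(mem_sort (relpre (fun Q : {set 'I_k} => #|Q|) geq)) mem_nth.
  case/imsetP=> y _ e; rewrite /r e; case: pickP => [z zy|/(_ y)]; last by rewrite porbit_id.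
  by apply/eqP; rewrite eq_porbit_mem.
have size_st : size (sorted_porbits s) = size (sorted_porbits t).
  by have := congr1 size eq_st; rewrite !size_map.
have card_st i : (i < size (sorted_porbits s))%N ->
    #|porbit s (r s i)| = #|porbit t (r t i)|.
  move=> lt_i; rewrite !rP -?size_st //.
  have := congr1 (fun m => nth 0%N m i) eq_st.
  by rewrite !(nth_map set0) -?size_st.
have jP x : exists j, x = (s ^+ j)%g (r s (Q s x)).
  have /porbitP[j xj] : x \in porbit s (r s (Q s x)) by rewrite rP // nthQ porbit_id.
  by exists j.
have [j jE] := fin_all_exists jP.
pose h x := (t ^+ j x)%g (r t (Q s x)).
have Qh x : Q t (h x) = Q s x.
  rewrite /Q /h porbit_perm rP -?size_st ?Qlt // index_uniq // -?size_st ?Qlt //.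
have h_inj : injective h.
  move=> x y hxy; have Qxy : Q s x = Q s y by rewrite -!Qh hxy.
  have: (t ^+ j x)%g (r t (Q s x)) == (t ^+ j y)%g (r t (Q s x)).
    by move/eqP: hxy; rewrite /h Qxy.
  rewrite perm_expg_eq -(card_st _ (Qlt s x)) -perm_expg_eq => /eqP e.
  by apply: etrans (jE x) _; apply: etrans e _; rewrite Qxy -(jE y).
exists (perm h_inj); apply/permP => z; rewrite -[z](permKV (perm h_inj)).
set x := (perm h_inj)^-1%g z; rewrite conjgE !permM permK !permE.
have Qs : Q s (s x) = Q s x by rewrite /Q -[s x]/((s ^+ 1)%g x) porbit_perm.
rewrite /h Qs -permM -expgSr; apply/eqP.
rewrite perm_expg_eq -(card_st _ (Qlt s x)) -perm_expg_eq; apply/eqP.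
by rewrite expgSr permM -(jE x) [LHS](jE (s x)) Qs.
Qed.

Lemma cycle_type_sorted s : sorted geq (cycle_type s).
Proof. by rewrite /cycle_type sorted_map sort_sorted // => A B; apply: leq_total. Qed.

Lemma cycle_type_gt0 s : all (fun m => 0 < m)%N (cycle_type s).
Proof.
apply/allP => m /mapP[A]; rewrite mem_sort mem_enum => /imsetP[x _ ->] ->.
by rewrite lt0n card_porbit_neq0.
Qed.

Lemma sumn_cycle_type s : sumn (cycle_type s) = k.
Proof.
rewrite sumnE big_map (perm_big _ (permEl (perm_sort _ _))) big_enum /=.
rewrite -[RHS](card_ord k) -sum1_card (partition_big (porbit s) (mem (porbits s))) /=; last first.
  by move=> x _; rewrite imset_f.
apply: eq_bigr => A /imsetP[y _ ->]; rewrite -sum1_card; apply: eq_bigl => x.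
by rewrite eq_porbit_mem.
Qed.

Lemma size_cycle_type s : (size (cycle_type s) <= k)%N.
Proof.
apply: (@leq_trans (sumn (cycle_type s))); last by rewrite sumn_cycle_type.
elim: (cycle_type s) (cycle_type_gt0 s) => //= m l IHl /andP[m0 /IHl].
by move=> le_l; rewrite -add1n leq_add.
Qed.

End CycleType.

Section OddPartitions.
Local Open Scope nat_scope.
Variable k : nat.
Local Notation n := (3 * k + 1)%N.

Definition odd_intpart (l : intpart n) := (size (parts l) == k.+1) && all odd (parts l).

(** The cycle type is padded with zeros to k+1 entries, and each zero yields a part 1. This makes
    the number of parts exactly k+1 and their sum 2k + (k+1). *)
Definition odd_part_fun (m : seq nat) : {ffun 'I_n -> 'I_n.+1} :=
  [ffun i : 'I_n => inord (if (i <= k)%N then (nth 0 m i).*2.+1 else 0)].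

Section OfCycleType.
Variable m : seq nat.
Hypotheses (sorted_m : sorted geq m) (sum_m : sumn m = k) (size_m : (size m <= k)%N).

Lemma nth_sumn i : (nth 0 m i <= k)%N.
Proof.
rewrite -[X in _ <= X]sum_m; elim: (m) i => [|a l IHl] [|i] //=; rewrite ?leq_addr //.
exact: leq_trans (IHl i) (leq_addl _ _).
Qed.

Lemma odd_part_funE (i : 'I_n) :
  odd_part_fun m i = (if (i <= k)%N then (nth 0 m i).*2.+1 else 0) :> nat.
Proof. rewrite ffunE inordK //; case: ifP => // _; move: (nth_sumn i).
by move: (nth 0 m i) => a; clear; lia. Qed.

Lemma sum_nth : (\sum_(i < k.+1) nth 0 m i = k)%N.
Proof.
rewrite -[RHS]sum_m -(big_mkord xpredT) (@big_cat_nat _ _ _ (size m)) //=; last exact: leqW.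
rewrite [X in (_ + X)%N]big_nat_cond [X in (_ + X)%N]big1 ?addn0; last first.
  by move=> i /andP[/andP[le_i _] _]; rewrite nth_default.
by rewrite sumnE [RHS](big_nth 0%N).
Qed.

Lemma odd_part_subproof :
  [forall i : 'I_n, forall j : 'I_n, (i <= j)%N ==> (odd_part_fun m j <= odd_part_fun m i)%N]
    && (\sum_i odd_part_fun m i == n)%N.
Proof.
apply/andP; split.
  apply/forallP=> i; apply/forallP => j; apply/implyP=> le_ij; rewrite !odd_part_funE.
  case: ifP => // le_jk; rewrite (leq_trans le_ij le_jk) ltnS leq_double.
  have [lt_j|] := ltnP j (size m); last by move=> ?; rewrite (nth_default _ (_ : size m <= j)%N).
  have tr : transitive geq by move=> a b c ba cb; apply: leq_trans cb ba.
  by apply: (sorted_leq_nth tr leqnn) => //; rewrite inE // (leq_ltn_trans le_ij).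
rewrite (eq_bigr (fun i : 'I_n => if (i <= k)%N then (nth 0 m i).*2.+1 else 0)) => [|i _]; last exact: odd_part_funE.
rewrite -big_mkcond /=.
have <- := @big_ord_widen _ 0 addn k.+1 n (fun i => (nth 0 m i).*2.+1) ltac:(lia).
rewrite (eq_bigr (fun i : 'I_k.+1 => (2 * nth 0 m i) + 1)%N); last by move=> i _; lia.
by rewrite big_split /= -big_distrr /= sum_nth sum_nat_const card_ord; apply/eqP; lia.
Qed.

Definition odd_part : intpart n := exist _ (odd_part_fun m) odd_part_subproof.

Lemma odd_partP : odd_intpart odd_part.
Proof.
rewrite /odd_intpart /parts; apply/andP; split.
  rewrite size_filter count_map -sum1_count big_enum_cond /=.
  rewrite (eq_bigl (fun i : 'I_n => (i <= k)%N)); last first.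
    by move=> i; rewrite /= odd_part_funE; case: ifP.
  have <- := @big_ord_widen _ 0 addn k.+1 n (fun=> 1) ltac:(lia).
  by rewrite sum1_card card_ord.
apply/allP => a; rewrite mem_filter => /andP[a0 /mapP[i _ aE]].
by move: a0; rewrite aE odd_part_funE; case: ifP => //= _ _; rewrite odd_double.
Qed.

End OfCycleType.

Lemma odd_part_inj (m m' : seq nat) : (size m <= k)%N -> (size m' <= k)%N ->
  sumn m = k -> sumn m' = k ->
  all (fun a => 0 < a)%N m -> all (fun a => 0 < a)%N m' -> odd_part_fun m = odd_part_fun m' -> m = m'.
Proof.
move=> sm sm' Sm Sm' pm pm' e.
have en i : nth 0%N m i = nth 0%N m' i.
  have [lt_ik|lt_ki] := leqP i k; last by rewrite !nth_default //; lia.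
  have lt_in : (i < n)%N by lia.
  have := congr1 (fun l : {ffun _ -> _} => val (l (Ordinal lt_in))) e.
  by rewrite /= (odd_part_funE Sm) (odd_part_funE Sm') /= lt_ik => -[]; apply: double_inj.
apply: (@eq_from_nth _ 0%N) => // .
apply/eqP; rewrite eqn_leq; apply/andP; split; rewrite leqNgt; apply/negP => lt.
  by have := all_nthP 0%N pm _ lt; rewrite en nth_default.
by have := all_nthP 0%N pm' _ lt; rewrite -en nth_default.
Qed.

Lemma card_classes_Sym : (#|classes [set: 'S_k]| <= #|[set l | odd_intpart l]|)%N.
Proof.
pose l (C : {set 'S_k}) := let s := repr C in
  odd_part (cycle_type_sorted s) (sumn_cycle_type s) (size_cycle_type s).
rewrite -(card_in_imset (f := l)).
  by apply/subset_leq_card/subsetP => _ /imsetP[C _ ->]; rewrite inE odd_partP.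
move=> A B clA clB /(congr1 val)/= e.
have : cycle_type (repr A) = cycle_type (repr B).
  by apply: odd_part_inj e;
    first [exact: size_cycle_type | exact: sumn_cycle_type | exact: cycle_type_gt0].
case/cycle_type_conj => h eB.
have rep C : C \in classes [set: 'S_k] -> C = repr C ^: [set: 'S_k].
  case/imsetP=> x _ ->; apply/esym/class_eqP.
  exact: mem_repr (class_refl [set: 'S_k]%G x).
rewrite (rep A clA) (rep B clB) eB; apply/class_eqP.
by rewrite class_sym memJ_class ?inE.
Qed.

End OddPartitions.

(** * Specht modules *)

Section SpechtModules.
Variables (F : fieldType) (n : nat).
Hypothesis char0 : [pchar F] =i pred0.
Implicit Types (l : intpart n) (t : {ffun 'I_n -> 'I_n * 'I_n}) (s : {ffun 'I_n -> 'I_n}) (u g : 'S_n).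

Local Notation rT := (tabloid_repr F n).

Definition col_antisym t : 'M[F]_#|{: {ffun 'I_n -> 'I_n}}| :=
  \sum_(u in col_stab t) (-1) ^+ u *: rT u.

Definition has_content l s := [forall i, #|[set x | s x == i]| == val l i].

Definition col_transversal t s := forall x y, (t x).2 = (t y).2 -> s x = s y -> x = y.

Lemma part_antitone l (i j : 'I_n) : (i <= j)%N -> (val l j <= val l i)%N.
Proof. by case: l => l /= /andP[/forallP/(_ i)/forallP/(_ j)/implyP h _]; apply: h. Qed.

Lemma part_sum l : (\sum_i val l i = n)%N.
Proof. by case: l => l /= /andP[_ /eqP]. Qed.

Definition diagram l : {set 'I_n * 'I_n} :=
  [set c : 'I_n * 'I_n | (c.2 < val l c.1)%N].

Lemma card_ord_lt (m : nat) (lt_m : (m <= n)%N) : #|[set j : 'I_n | (j < m)%N]| = m.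
Proof.
rewrite -sum1_card (eq_bigl (fun j : 'I_n => (j < m)%N)) => [|j]; last by rewrite inE.
by have <- := @big_ord_widen _ 0%N addn m n (fun=> 1%N) lt_m; rewrite sum1_card card_ord.
Qed.

Lemma card_diagram l : #|diagram l| = n.
Proof.
rewrite -[RHS](part_sum l) -sum1_card.
rewrite (partition_big (fun c : 'I_n * 'I_n => c.1) xpredT) //=.
apply: eq_bigr => i _.
rewrite -[RHS](@card_ord_lt (val l i)); last by rewrite -ltnS.
have inj_i : injective (fun j : 'I_n => (i, j)) by move=> j j' [].
rewrite -(card_imset _ inj_i) -sum1_card; apply: eq_bigl => -[i' j]; rewrite inE /=.
apply/andP/imsetP => [[lt_j /eqP /= <-]|[j']]; first by exists j; rewrite ?inE.
by rewrite inE => lt_j [-> ->].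
Qed.

Lemma tableauP l t : t \in tableaux l ->
  injective t /\ t @: [set: 'I_n] = diagram l.
Proof.
rewrite inE => /andP[/injectiveP inj_t /forallP Dt]; split=> //.
apply/eqP; rewrite eqEcard card_imset // cardsT card_ord card_diagram leqnn andbT.
by apply/subsetP => _ /imsetP[x _ ->]; rewrite inE.
Qed.

Lemma tableau_diagram l t x : t \in tableaux l -> t x \in diagram l.
Proof. by case/tableauP=> _ <-; apply: imset_f; rewrite inE. Qed.

Lemma tableau_ex l : exists t, t \in tableaux l.
Proof.
pose e := cast_ord (esym (card_diagram l)).
exists [ffun x => enum_val (e x)]; rewrite inE; apply/andP; split.
  by apply/injectiveP => x y; rewrite !ffunE => /enum_val_inj/cast_ord_inj.
by apply/forallP => x; rewrite ffunE; have := enum_valP (e x); rewrite inE.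
Qed.

Lemma tableau_trans l t t' : t \in tableaux l -> t' \in tableaux l ->
  exists g, t' = fun_act t g.
Proof.
move=> lt lt'; have [inj_t im_t] := tableauP lt; have [inj_t' im_t'] := tableauP lt'.
have [|g gE] := @fiber_perm n _ t' t.
  move=> c; have cnt t0 : injective t0 -> t0 @: [set: 'I_n] = diagram l ->
      #|[set x | t0 x == c]| = (c \in diagram l).
    move=> inj0 im0; have [|nc] := boolP (c \in diagram l).
      rewrite -im0 => /imsetP[x _ ->]; rewrite (_ : [set _ | _] = [set x]) ?cards1 //.
      by apply/setP => y; rewrite !inE (inj_eq inj0).
    apply: eq_card0 => x; rewrite inE; apply/negP => /eqP xc.
    by case/negP: nc; rewrite -xc -im0 imset_f ?inE.
  by rewrite !cnt.
exists g^-1%g; apply/ffunP => x; rewrite ffunE invgK gE.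
by [].
Qed.

Lemma tabloid_content l t : t \in tableaux l -> has_content l (tabloid t).
Proof.
move=> lt; have [inj_t im_t] := tableauP lt; apply/forallP => i.
rewrite -(@card_ord_lt (val l i)); last by rewrite -ltnS.
rewrite -(card_imset _ inj_t).
have inj_i : injective (fun j : 'I_n => (i, j)) by move=> j j' [].
rewrite -[X in _ == X](card_imset _ inj_i); apply/eqP/eq_card => c.
apply/imsetP/imsetP => [[x]|[j]].
  rewrite inE ffunE => /eqP xi ->; exists (t x).2; last by rewrite -xi -surjective_pairing.
  by have := tableau_diagram x lt; rewrite !inE xi.
rewrite inE => lt_j ->; have: (i, j) \in diagram l by rewrite inE.
by rewrite -im_t => /imsetP[x _ xE]; exists x => //; rewrite inE ffunE -xE.
Qed.

Lemma content_act l s g : has_content l s -> has_content l (fun_act s g).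
Proof.
move/forallP => cs; apply/forallP => i; rewrite -(eqP (cs i)); apply/eqP.
rewrite -(card_imset _ (@perm_inj _ g^-1%g)); apply: eq_card => p.
rewrite inE; apply/imsetP/idP => [[q]|sp]; first by rewrite inE ffunE => sq ->.
by exists (g p); rewrite ?inE ?ffunE permK.
Qed.

Lemma tabloid_act t g : tabloid (fun_act t g) = fun_act (tabloid t) g.
Proof. by apply/ffunP => x; rewrite !ffunE. Qed.

Lemma polytabloidE t : polytabloid F t = basis_vec F (tabloid t) *m col_antisym t.
Proof.
rewrite mulmx_sumr; apply: eq_bigr => u _.
by rewrite -scalemxAr tabloid_act; congr (_ *: _); rewrite (perm_reprE F [set: 'S_n]%G).
Qed.

Lemma col_stabV t u : u \in col_stab t -> u^-1%g \in col_stab t.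
Proof.
rewrite !inE => /forallP ut; apply/forallP => x; rewrite eq_sym.
by have := ut (u^-1%g x); rewrite permKV.
Qed.

Lemma col_stabM t u g : u \in col_stab t -> (u * g \in col_stab t)%g = (g \in col_stab t).
Proof.
rewrite !inE => /forallP ut; apply/forallP/forallP => gt x.
  by rewrite -(permKV u x) -permM (eqP (gt _)) -(eqP (ut _)).
by rewrite permM (eqP (gt _)) ut.
Qed.

Lemma col_antisym_act t u : u \in col_stab t -> rT u *m col_antisym t = (-1) ^+ u *: col_antisym t.
Proof.
move=> Cu; rewrite mulmx_sumr scaler_sumr [RHS](reindex_inj (mulgI u)).
apply: eq_big => g; first by rewrite col_stabM.
move=> _; have rM : rT (u * g)%g = rT u *m rT g by apply: repr_mxM; rewrite inE.
by rewrite rM -scalemxAr scalerA odd_permM signr_addb mulrA -signr_addb addbb mul1r.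
Qed.

Lemma col_antisym_actr t u : u \in col_stab t -> col_antisym t *m rT u = (-1) ^+ u *: col_antisym t.
Proof.
move=> Cu; rewrite mulmx_suml scaler_sumr [RHS](reindex_inj (mulIg u)).
apply: eq_big => g.
  apply/idP/idP => /= Cg; first by rewrite col_stabM.
  by rewrite -(mulgK u g) col_stabM ?col_stabV.
move=> _; have rM : rT (g * u)%g = rT g *m rT u by apply: repr_mxM; rewrite inE.
rewrite rM -scalemxAl scalerA odd_permM signr_addb.
by rewrite mulrCA -signr_addb addbb mulr1.
Qed.

Lemma col_antisym_sqr t : col_antisym t *m col_antisym t = #|col_stab t|%:R *: col_antisym t.
Proof.
rewrite {1}/col_antisym mulmx_suml scaler_nat -sumr_const; apply: eq_bigr => u Cu.
by rewrite -scalemxAl col_antisym_act // scalerA -signr_addb addbb scale1r.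
Qed.

Lemma col_stab1 t : 1%g \in col_stab t.
Proof. by rewrite inE; apply/forallP => x; rewrite perm1. Qed.

Lemma card_col_stab t : #|col_stab t|%:R != 0 :> F.
Proof.
rewrite ((pcharf0P F).1 char0) -lt0n; apply/card_gt0P.
by exists 1%g; apply: col_stab1.
Qed.

Lemma polytabloid_neq0 t : injective t -> polytabloid F t != 0.
Proof.
move=> inj_t; have: coord (polytabloid F t) (tabloid t) = 1.
  rewrite coord_sum (bigD1 1%g) ?col_stab1 //= odd_perm1 coordZ coord_basis mul1r.
  have -> : fun_act t 1 = t by apply/ffunP=> x; rewrite ffunE invg1 perm1.
  rewrite eqxx big1 ?addr0 // => u /andP[Cu nu1]; rewrite coordZ coord_basis.
  case: eqP => [e|_]; last by rewrite mulr0.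
  case/eqP: nu1; apply/permP => x; rewrite perm1; apply: inj_t.
  move/ffunP/(_ (u x)): e; rewrite !ffunE permK => e1.
  move: Cu; rewrite inE => /forallP/(_ x)/eqP e2.
  by rewrite [LHS]surjective_pairing e1 e2 -surjective_pairing.
by apply: contra_eqN => /eqP ->; rewrite coord0 eq_sym oner_eq0.
Qed.

Lemma col_antisym_neq0 t s : basis_vec F s *m col_antisym t != 0 -> col_transversal t s.
Proof.
move=> nz x y txy sxy; apply/eqP; apply: contraNT nz => nxy.
have Ct : tperm x y \in col_stab t.
  by rewrite inE; apply/forallP => z; case: tpermP => // ->; rewrite txy.
set z := _ *m _; have zN : z = - z.
  have sE : basis_vec F s = basis_vec F s *m rT (tperm x y).
    rewrite (perm_reprE F [set: 'S_n]%G); congr basis_vec; apply/ffunP => p.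
    by rewrite ffunE tpermV; case: tpermP => // ->; rewrite sxy.
  by rewrite {1}/z sE -mulmxA col_antisym_act // odd_tperm nxy expr1 scaleN1r mulmxN.
move/eqP: zN; rewrite -addr_eq0 -mulr2n -scaler_nat scaler_eq0.
by rewrite ((pcharf0P F).1 char0).
Qed.

(** * Dominance of contents, and its equality case *)

Section Dominance.
Variables (l l' : intpart n) (t : {ffun 'I_n -> 'I_n * 'I_n}) (s : {ffun 'I_n -> 'I_n}).
Hypotheses (lt : t \in tableaux l) (cs : has_content l' s) (ts : col_transversal t s).

Lemma content_count (r : nat) : #|[set x | (s x < r)%N]| = (\sum_(i < n | (i < r)%N) val l' i)%N.
Proof.
rewrite -sum1_card [LHS](partition_big s (fun i : 'I_n => (i < r)%N)) /= => [|x]; last by rewrite inE.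
apply: eq_bigr => i ir; rewrite -(eqP (forallP cs i)) -sum1_card; apply: eq_bigl => x.
by rewrite !inE; case: eqP => [->|]; rewrite ?ir ?andbF.
Qed.

(** If column [c] reaches row [r], it has cells in all rows below [r], and [s], injective on the
    column, takes at most that many values below [r]. If it does not, all its entries are counted on
    the right. *)
Lemma col_count (c r : nat) :
  (#|[set x | ((t x).2 == c :> nat) && (s x < r)%N]| <=
   #|[set x | ((t x).2 == c :> nat) && ((t x).1 < r)%N]|)%N.
Proof.
have [/existsP[x0 /andP[/eqP cx0 rx0]]|] := boolP [exists x, ((t x).2 == c :> nat) && (r <= (t x).1)%N].
  have [inj_t im_t] := tableauP lt.
  apply: (@leq_trans #|[set i : 'I_n | (i < r)%N]|).
    rewrite -(card_in_imset (f := s)); last first.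
      move=> x y; rewrite !inE => /andP[/eqP cx _] /andP[/eqP cy _]; apply: ts.
      by apply: val_inj; rewrite /= cx cy.
    by apply/subset_leq_card/subsetP => _ /imsetP[x xP ->]; move: xP; rewrite !inE => /andP[].
  rewrite -[X in (_ <= X)%N](card_imset _ inj_t).
  have inj_c : injective (fun i : 'I_n => (i, (t x0).2)) by move=> i j [].
  rewrite -(card_imset _ inj_c); apply/subset_leq_card/subsetP => _ /imsetP[i ir ->].
  move: ir; rewrite inE => lt_ir; have: (i, (t x0).2) \in diagram l.
    have := tableau_diagram x0 lt; rewrite !inE /= => /leq_trans; apply.
    by apply: part_antitone; apply: leq_trans (ltnW lt_ir) rx0.
  rewrite -im_t => /imsetP[x _ xE]; apply/imsetP; exists x => //.
  by rewrite inE -xE /= cx0 eqxx.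
rewrite negb_exists => /forallP small.
apply/subset_leq_card/subsetP => x; rewrite !inE => /andP[cx _].
by have := small x; rewrite cx /= -ltnNge.
Qed.

Lemma sum_col_count (P : pred 'I_n) :
  (\sum_(c < n) #|[set x | ((t x).2 == c :> nat) && P x]|)%N = #|[set x | P x]|.
Proof.
rewrite -[RHS]sum1_card [RHS](partition_big (fun x => (t x).2) xpredT) //=.
apply: eq_bigr => c _; rewrite -sum1_card; apply: eq_bigl => x.
by rewrite !inE andbC.
Qed.

Lemma row_count (r : nat) : #|[set x | ((t x).1 < r)%N]| = (\sum_(i < n | (i < r)%N) val l i)%N.
Proof.
have/forallP ct := tabloid_content lt.
rewrite -sum1_card (partition_big (fun x => (t x).1) (fun i : 'I_n => (i < r)%N)) /= => [|x]; last by rewrite inE.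
apply: eq_bigr => i ir; rewrite -(eqP (ct i)) -sum1_card; apply: eq_bigl => x.
by rewrite !inE ffunE; case: eqP => [->|]; rewrite ?ir ?andbF.
Qed.

Lemma dominance r : (\sum_(i < n | (i < r)%N) val l' i <= \sum_(i < n | (i < r)%N) val l i)%N.
Proof.
rewrite -content_count -row_count.
rewrite -(sum_col_count (fun x => (s x < r)%N)) -(sum_col_count (fun x => ((t x).1 < r)%N)).
by apply: leq_sum => c _; apply: col_count.
Qed.

Lemma col_count_eq (c : 'I_n) r : val l = val l' ->
  #|[set x | ((t x).2 == c :> nat) && (s x < r)%N]| =
  #|[set x | ((t x).2 == c :> nat) && ((t x).1 < r)%N]|.
Proof.
move=> ll; pose a c := #|[set x | ((t x).2 == c :> nat) && (s x < r)%N]|.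
pose b c := #|[set x | ((t x).2 == c :> nat) && ((t x).1 < r)%N]|.
have le_ab (d : 'I_n) : xpredT d -> (a d <= b d ?= iff (a d == b d))%N.
  by move=> _; split=> //; apply: col_count.
have [_ /esym] := leqif_sum le_ab.
rewrite /a /b (sum_col_count (fun x => (s x < r)%N)) (sum_col_count (fun x => ((t x).1 < r)%N)).
rewrite content_count row_count ll eqxx => /forallP/(_ c)/eqP.
by [].
Qed.

(** With equal contents all column inequalities are equalities ([col_count_eq]). A value [s x]
    beyond the foot of the column of [x] would break the equality at [r = s x]; so [s] rearranges
    the row indices within each column, which defines [u]. *)
Lemma transversal_tabloid : val l = val l' -> exists2 u, u \in col_stab t & s = tabloid (fun_act t u).
Proof.
move=> ll; have [inj_t im_t] := tableauP lt.
have inD x : (s x, (t x).2) \in diagram l.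
  rewrite inE /= ltnNge; apply/negP => le_lc.
  have := col_count_eq (t x).2 (s x) ll.
  have -> : [set y | ((t y).2 == (t x).2 :> nat) && ((t y).1 < s x)%N] = [set y | ((t y).2 == (t x).2 :> nat)].
    apply/setP=> y; rewrite !inE andb_idr // => /eqP cyx; rewrite ltnNge; apply/negP => le_sy.
    have := tableau_diagram y lt; rewrite inE cyx ltnNge (leq_trans _ le_lc) //.
    exact: part_antitone.
  move/eqP; rewrite eqn_leq => /andP[_].
  rewrite leqNgt => /negP; apply; apply: proper_card; apply/properP; split.
    by apply/subsetP=> y; rewrite !inE => /andP[].
  by exists x; rewrite !inE ?eqxx // ltnn.
have uP x : exists y, t y = (s x, (t x).2).
  by have := inD x; rewrite -im_t => /imsetP[y _ ->]; exists y.
have [u0 u0E] := fin_all_exists uP.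
have inj_u : injective u0.
  by move=> x y uxy; have := u0E y; rewrite -uxy u0E => -[sxy txy]; apply: ts.
exists (perm inj_u)^-1%g.
  by apply: col_stabV; rewrite inE; apply/forallP => x; rewrite permE u0E.
by apply/ffunP => x; rewrite !ffunE invgK permE u0E.
Qed.

End Dominance.

Definition supported_content l (x : 'rV[F]_#|{: {ffun 'I_n -> 'I_n}}|) :=
  forall s, ~~ has_content l s -> coord x s = 0.

Lemma specht_content l (x : 'rV_#|{: {ffun 'I_n -> 'I_n}}|) :
  (x <= specht_mx F l)%MS -> supported_content l x.
Proof.
pose Z : 'M[F]_#|{: {ffun 'I_n -> 'I_n}}| := lin_ext (fun s => (~~ has_content l s)%:R *: basis_vec F s).
have sZ : (specht_mx F l <= kermx Z)%MS.
  apply/sumsmx_subP => t lt; rewrite genmxE; apply/sub_kermxP.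
  rewrite mulmx_suml big1 // => u _; rewrite -scalemxAl basis_lin_ext.
  by rewrite tabloid_act content_act ?tabloid_content // scale0r scaler0.
move=> xS s ns; have /sub_kermxP xZ := submx_trans xS sZ.
have := congr1 (fun y => coord y s) xZ; rewrite coord0 lin_ext_sum coord_sum.
rewrite (bigD1 s) //= ns scale1r coordZ coord_basis eqxx mulr1 big1 ?addr0 // => s' ne.
by rewrite !coordZ coord_basis eq_sym (negPf ne) !mulr0.
Qed.

(** A word of this content is either killed by the column antisymmetrizer or column equivalent to
    the tabloid of [t], so the image is the line of the polytabloid. *)
Lemma content_col_antisym l t x : t \in tableaux l -> supported_content l x ->
  (x *m col_antisym t <= polytabloid F t)%MS.
Proof.
move=> lt cx; rewrite [x]basis_sum mulmx_suml summx_sub // => s _.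
rewrite -scalemxAl; have [cs|/cx ->] := boolP (has_content l s); last by rewrite scale0r sub0mx.
rewrite scalemx_sub //.
have [->|/col_antisym_neq0 ts] := eqVneq (basis_vec F s *m col_antisym t) 0; first exact: sub0mx.
have [u Cu ->] := transversal_tabloid lt cs ts erefl.
have -> : basis_vec F (tabloid (fun_act t u)) = basis_vec F (tabloid t) *m rT u.
  by rewrite (perm_reprE F [set: 'S_n]%G) tabloid_act.
by rewrite -mulmxA col_antisym_act // -scalemxAr -polytabloidE scalemx_sub.
Qed.

Lemma polytabloid_sub l t : t \in tableaux l -> (polytabloid F t <= specht_mx F l)%MS.
Proof. by move=> lt; rewrite (sumsmx_sup t) ?genmxE. Qed.

Lemma specht_generated l t (U : 'M_#|{: {ffun 'I_n -> 'I_n}}|) : t \in tableaux l -> mxmodule rT U ->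
  (polytabloid F t <= U)%MS -> (specht_mx F l <= U)%MS.
Proof.
move=> lt modU tU; apply/sumsmx_subP => t' lt'; rewrite genmxE.
have [g ->] := tableau_trans lt lt'.
by rewrite -polytabloid_act (mxmodule_trans modU) ?inE.
Qed.

Lemma polytabloid_col_antisym t :
  polytabloid F t *m col_antisym t = #|col_stab t|%:R *: polytabloid F t.
Proof. by rewrite polytabloidE -mulmxA col_antisym_sqr -scalemxAr. Qed.

Lemma col_antisym_module t (U : 'M_#|{: {ffun 'I_n -> 'I_n}}|) (x : 'rV_#|{: {ffun 'I_n -> 'I_n}}|) : mxmodule rT U ->
  (x <= U)%MS -> (x *m col_antisym t <= U)%MS.
Proof.
move=> modU xU; rewrite mulmx_sumr summx_sub // => u _.
by rewrite -scalemxAr scalemx_sub // (mxmodule_trans modU) ?inE.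
Qed.

(** Split the polytabloid along [U] and a complement [V] given by Maschke's theorem. The column
    antisymmetrizer sends both components into the line of the polytabloid, and not both to 0; so
    [U] or [V] contains the polytabloid, which generates everything. *)
Lemma specht_simple l : mxsimple rT (specht_mx F l).
Proof.
have [t lt] := tableau_ex l; have [inj_t _] := tableauP lt.
have tS := polytabloid_sub lt; split; first exact: specht_module.
  by apply: contraNneq (polytabloid_neq0 inj_t) => S0; rewrite -submx0 -S0.
move=> U modU sUS nzU.
have pG : [pchar F]^'.-group [set: 'S_n].
  by rewrite /pgroup pcharf'_nat ((pcharf0P F).1 char0) -lt0n cardG_gt0.
have red : mx_completely_reducible rT (specht_mx F l).
  by apply: mx_reducibleS (mx_Maschke_pchar rT pG); rewrite ?specht_module ?submx1.
have [V modV defS /mxdirect_addsP dxUV] := red U modU sUS.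
have [key|] := boolP (polytabloid F t <= U)%MS; first exact: specht_generated key.
move=> ntU; have: (polytabloid F t <= U + V)%MS by rewrite defS.
case/sub_addsmxP => -[a b] /= tE.
have aU : (a *m U <= U)%MS := submxMl _ _.
have bV : (b *m V <= V)%MS := submxMl _ _.
have xt (x : 'rV_#|{: {ffun 'I_n -> 'I_n}}|) : (x <= specht_mx F l)%MS -> (x *m col_antisym t <= polytabloid F t)%MS.
  by move=> xS; apply: content_col_antisym lt (specht_content xS).
have line m (W : 'M_(m, _)) (y : 'rV_#|{: {ffun 'I_n -> 'I_n}}|) : (y *m col_antisym t <= polytabloid F t)%MS -> (y *m col_antisym t <= W)%MS ->
    y *m col_antisym t != 0 -> (polytabloid F t <= W)%MS.
  move=> /sub_rVP[c ->] yW; rewrite scaler_eq0 negb_or => /andP[nzc _].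
  by move: yW; rewrite (eqmx_scale _ nzc).
have a0 : a *m U *m col_antisym t = 0.
  apply/eqP; apply: contraR ntU => nza; apply: line nza; first by apply: xt; rewrite (submx_trans aU).
  exact: col_antisym_module.
have tV : (polytabloid F t <= V)%MS.
  have bE : b *m V *m col_antisym t = #|col_stab t|%:R *: polytabloid F t.
    by rewrite -polytabloid_col_antisym tE mulmxDl a0 add0r.
  apply: (line _ V (b *m V)).
  - by rewrite bE scalemx_sub.
  - exact: col_antisym_module.
  by rewrite bE scaler_eq0 negb_or card_col_stab polytabloid_neq0.
have SV := specht_generated lt modV tV.
by case/negP: nzU; rewrite -submx0 -dxUV sub_capmx submx_refl (submx_trans sUS).
Qed.

(** An isomorphism carries the polytabloid to a vector not killed by the column antisymmetrizer of
    [t]. Some word of content [l'] is then injective on the columns of a tableau of shape [l], and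
    [dominance] applies. *)
Lemma specht_dominance l l' :
  mx_rsim (specht_repr F l) (specht_repr F l') ->
  forall r : nat, (\sum_(i < n | (i < r)%N) val l' i <= \sum_(i < n | (i < r)%N) val l i)%N.
Proof.
case=> B def_n freeB homB r; have [t lt] := tableau_ex l; have [inj_t _] := tableauP lt.
pose e := in_submod (specht_mx F l) (polytabloid F t).
have actE (l0 : intpart n) m (z : 'M_(m, \rank (specht_mx F l0))) :
    \sum_(u in col_stab t) (-1) ^+ u *: (z *m specht_repr F l0 u) =
    in_submod (specht_mx F l0) (val_submod z *m col_antisym t).
  rewrite in_submodE -mulmxA mulmx_suml mulmx_sumr; apply: eq_bigr => u _.
  have zu : z *m specht_repr F l0 u = in_submod (specht_mx F l0) (val_submod z *m rT u).
    by rewrite (in_submodJ (specht_module F l0)) ?inE ?val_submodP // val_submodK.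
  rewrite -scalemxAl -scalemxAr zu [in LHS]in_submodE; congr (_ *: _).
  exact/esym/mulmxA.
pose z := e *m B.
have nz : val_submod z *m col_antisym t != 0.
  apply/negP => /eqP z0; have := actE l' _ z; rewrite z0 [in_submod _ 0]linear0.
  rewrite (eq_bigr (fun u : 'S_n => ((-1) ^+ u *: (e *m specht_repr F l u)) *m B)); last first.
    move=> u _; have hu : e *m specht_repr F l u *m B = z *m specht_repr F l' u.
      by rewrite /z -(mulmxA e B) -homB ?inE //; apply/esym/mulmxA.
    by rewrite -scalemxAl hu.
  rewrite -mulmx_suml actE in_submodK ?polytabloid_sub // polytabloid_col_antisym.
  move/eqP; rewrite mulmx_free_eq0 // -val_submod_eq0.
  rewrite in_submodK ?scalemx_sub ?polytabloid_sub // scaler_eq0.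
  by rewrite (negPf (card_col_stab t)) (negPf (polytabloid_neq0 inj_t)).
have [s cs nzs] : exists2 s, has_content l' s & basis_vec F s *m col_antisym t != 0.
  apply/exists_inP; apply: contraR nz => /exists_inPn s0.
  rewrite [val_submod z]basis_sum mulmx_suml big1 // => s _.
  have [/s0|ns] := boolP (has_content l' s).
    by rewrite negbK -scalemxAl => /eqP ->; rewrite scaler0.
  by rewrite (specht_content (val_submodP z)) // scale0r mul0mx.
exact: dominance lt cs (col_antisym_neq0 nzs) r.
Qed.

Lemma specht_rsim_inj l l' : mx_rsim (specht_repr F l) (specht_repr F l') -> l = l'.
Proof.
move=> sim; have sum_eq r : (\sum_(i < n | (i < r)%N) val l i = \sum_(i < n | (i < r)%N) val l' i)%N.
  by apply/eqP; rewrite eqn_leq !specht_dominance //; apply: mx_rsim_sym.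
apply/val_inj/ffunP => i; apply/val_inj.
have split_sum (l0 : intpart n) : (\sum_(j < n | (j < i.+1)%N) val l0 j = val l0 i + \sum_(j < n | (j < i)%N) val l0 j)%N.
  rewrite (bigD1 i) //=; congr addn; apply: eq_bigl => j.
  by rewrite ltnS ltn_neqAle andbC.
by have := sum_eq i.+1; rewrite !split_sum sum_eq => /addIn.
Qed.

End SpechtModules.

(** * Embedding the Specht modules in the top cycles *)

Lemma odd_extend (T T' : finType) (i : T -> T') (s : {perm T}) (E : {perm T'}) :
    injective i -> (forall x, E (i x) = i (s x)) -> (forall y, y \notin codom i -> E y = y) ->
  odd_perm E = odd_perm s.
Proof.
move=> inj_i; have [ts -> _] := prod_tpermP s.
elim: ts E => [|[a b] ts IHts] E Ei Eout; rewrite ?big_nil ?big_cons.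
  suff -> : E = 1%g by rewrite !odd_perm1.
  apply/permP => y; rewrite perm1; have [/codomP[x ->]|/Eout//] := boolP (y \in codom i).
  by rewrite Ei big_nil perm1.
have E'i x : (tperm (i a) (i b) * E)%g (i x) = i ((\prod_(t <- ts) tperm t.1 t.2)%g x).
  by rewrite permM -inj_tperm // Ei big_cons permM /= tpermK.
have E'out y : y \notin codom i -> (tperm (i a) (i b) * E)%g y = y.
  move=> ny; rewrite permM tpermD ?Eout //; apply: contraNneq ny => <-; exact: codom_f.
have := IHts _ E'i E'out; rewrite odd_permM odd_permM !odd_tperm (inj_eq inj_i) => <-.
by rewrite addbA addbb addFb.
Qed.

(** The numbers [i] and [s i] have the same sum, so no inequality is strict. *)
Lemma perm_leq_id m (s : 'S_m) : (forall i : 'I_m, i <= s i)%N -> s = 1%g.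
Proof.
move=> le_s; have le_i (i : 'I_m) : xpredT i -> (i <= s i ?= iff (i == s i :> nat))%N.
  by move=> _; split=> //; apply: le_s.
have [_ /esym] := leqif_sum le_i.
rewrite [X in (_ == X)%N](reindex_inj (@perm_inj _ s^-1%g)) /=.
rewrite [X in (_ == X)%N](eq_bigr (fun i : 'I_m => i : nat)) => [|i _]; last by rewrite permKV.
rewrite eqxx => /forallP s1; apply/permP => i; rewrite perm1; apply/val_inj/esym/eqP.
exact: (s1 i).
Qed.

Section Embedding.
Variables (F : numClosedFieldType) (k : nat).
Local Notation n := (3 * k + 1)%N.
Local Notation word := {ffun 'I_n -> 'I_k.+1}.
Local Notation row_word := {ffun 'I_n -> 'I_n}.
Local Notation tr := (word_repr F n 'I_k.+1).
Local Notation rT := (tabloid_repr F n).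
Local Notation H := (top_cycles F n k).
Local Notation T := ('I_k.+1 + 'I_k * bool)%type.

Let char0 : [pchar F] =i pred0. Proof. exact: pchar_num. Qed.

Variable l : intpart n.
Hypothesis odd_l : odd_intpart l.

Let mu (i : nat) := oapp (fun j : 'I_n => (val l j)./2) 0%N (insub i).

Let off (i : nat) := (\sum_(j < i) mu j)%N.

Lemma odd_part_pos (i : 'I_n) : (0 < val l i)%N = (i <= k)%N.
Proof.
have /andP[/eqP sz _] := odd_l.
pose P := [set i : 'I_n | (0 < val l i)%N].
have cardP : #|P| = k.+1.
  rewrite -sz /parts size_filter count_map -sum1_count big_enum_cond /= -sum1_card.
  by apply: eq_bigl => j; rewrite inE.
have le (m : 'I_n) : #|[set j : 'I_n | (j <= m)%N]| = m.+1.
  by rewrite -[RHS](@card_ord_lt n) //; apply: eq_card => j; rewrite !inE.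
apply/idP/idP => [pi|le_ik].
  rewrite -ltnS -cardP -(le i); apply/subset_leq_card/subsetP => j; rewrite !inE => le_ji.
  exact: leq_trans pi (part_antitone _ le_ji).
rewrite lt0n; apply/eqP => li0; suff: (#|P| <= i)%N by rewrite cardP; lia.
apply: (@leq_trans #|[set j : 'I_n | (j < i)%N]|); last by rewrite card_ord_lt // ltnW.
apply/subset_leq_card/subsetP => j; rewrite !inE => pj.
by rewrite ltnNge; apply/negP => /(part_antitone l); rewrite li0; lia.
Qed.

Lemma odd_part_mu (i : 'I_n) : (i <= k)%N -> val l i = (mu i).*2.+1 :> nat.
Proof.
move=> le_ik; have /andP[_ /allP odd_parts] := odd_l.
have oi : odd (val l i).
  apply: odd_parts; rewrite mem_filter odd_part_pos le_ik /=.
  by apply/mapP; exists i; rewrite ?mem_enum.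
by rewrite /mu valK /= -{1}[X in X = _]odd_double_half oi.
Qed.

Lemma mu_anti i j : (i <= j)%N -> (mu j <= mu i)%N.
Proof.
move=> le_ij; rewrite /mu; case: insubP => [j' lt_j jE|//].
have lt_i : (i < n)%N by apply: leq_ltn_trans lt_j.
rewrite insubT /=; apply: half_leq; apply: part_antitone; rewrite /= jE.
by [].
Qed.

Lemma off_last : off k.+1 = k.
Proof.
have := part_sum l; rewrite (bigID (fun i : 'I_n => (i <= k)%N)) /= [X in (_ + X)%N]big1 ?addn0 => [|i]; last first.
  by rewrite -odd_part_pos -leqNgt leqn0 => /eqP.
rewrite (eq_bigr (fun i : 'I_n => (mu i).*2.+1)); last by move=> i; apply: odd_part_mu.
have <- := @big_ord_widen _ 0%N addn k.+1 n (fun i => (mu i).*2.+1) ltac:(lia).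
rewrite (eq_bigr (fun i : 'I_k.+1 => (2 * mu i) + 1)%N); last by move=> i _; lia.
by rewrite big_split /= -big_distrr /= sum_nat_const card_ord -/(off k.+1); lia.
Qed.

Lemma offS i : off i.+1 = (off i + mu i)%N.
Proof. by rewrite /off big_ord_recr. Qed.

(* The cells outside the first column are grouped in horizontal dominoes,
   numbered row by row: domino r is in row dom_row r. *)
Definition dom_row (r : nat) := find (fun i => r < off i.+1)%N (iota 0 k.+1).
Definition dom_col (r : nat) := (r - off (dom_row r))%N.

Lemma dom_rowP (r : 'I_k) :
  [/\ (dom_row r <= k)%N, (off (dom_row r) <= r)%N & (r < off (dom_row r).+1)%N].
Proof.
have has_r : has (fun i => r < off i.+1)%N (iota 0 k.+1).
  apply/hasP; exists k; first by rewrite mem_iota; lia.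
  by rewrite off_last.
have lt_r : (dom_row r < k.+1)%N by move: has_r; rewrite has_find size_iota.
have := nth_find 0%N has_r; rewrite -/(dom_row r) nth_iota // add0n => lt_off; split=> //.
have := @before_find _ 0%N (fun i => r < off i.+1)%N (iota 0 k.+1) (dom_row r).-1.
rewrite -/(dom_row r); case: (dom_row r) lt_r => [|i] lt_i; first by rewrite /off big_ord0.
by rewrite [_.-1]/= nth_iota ?(ltnW lt_i) // add0n => /(_ (leqnn _)) /negbT; rewrite -leqNgt.
Qed.

(** The row of domino [r] has positive [mu] and [mu] is nonincreasing, so every earlier row holds a
    domino numbered before [r]. *)
Lemma dom_row_leq (r : 'I_k) : (dom_row r <= r)%N.
Proof.
have [_ le_r lt_r] := dom_rowP r; apply: leq_trans le_r.
have mu_gt0 : (0 < mu (dom_row r))%N by move: lt_r; rewrite offS; have [_ + _] := dom_rowP r; lia.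
move: (dom_row r) mu_gt0 => i mu_i; have: (forall j, j <= i -> j <= off j)%N; last by apply.
elim=> // j IHj lt_j; rewrite offS; have := IHj (ltnW lt_j); have := mu_anti (ltnW lt_j); lia.
Qed.

Lemma dom_inj (r q : 'I_k) : dom_row r = dom_row q -> dom_col r = dom_col q -> r = q.
Proof.
rewrite /dom_col => e; have [_ lr _] := dom_rowP r; have [_ lq _] := dom_rowP q.
by move: lr lq; rewrite e => lr lq eq_rq; apply: val_inj; rewrite /=; lia.
Qed.

Lemma dom_col_lt (r : 'I_k) : (dom_col r < mu (dom_row r))%N.
Proof. by have [_ + +] := dom_rowP r; rewrite offS /dom_col; lia. Qed.

Definition nth_ord (m : nat) : 'I_n := insubd (cast_ord (esym (addn1 _)) ord_max) m.

Lemma nth_ordE m : (m < n)%N -> nth_ord m = m :> nat.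
Proof. by move=> lt_m; rewrite /nth_ord val_insubd lt_m. Qed.

(** The base points fill the first column, so the antisymmetry of a polytabloid within that column
    becomes antisymmetry over k+1 points; pair [r] fills domino [r]. *)
Definition cell (x : T) : 'I_n * 'I_n :=
  match x with
  | inl i => (nth_ord i, nth_ord 0)
  | inr (r, b) => (nth_ord (dom_row r), nth_ord ((dom_col r).*2.+1 + b))
  end.

Definition std_tableau : {ffun 'I_n -> 'I_n * 'I_n} := [ffun p => cell (unpt p)].

Lemma cell_row x : (cell x).1 = (match x with inl i => i : nat | inr (r, _) => dom_row r end) :> nat.
Proof.
case: x => [i|[r b]] /=; rewrite nth_ordE //; first by have := ltn_ord i; lia.
by have [+ _ _] := dom_rowP r; lia.
Qed.

Lemma cell_row_eq x j : ((cell x).1 == j) =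
  ((match x with inl i => i : nat | inr (r, _) => dom_row r end) == j :> nat).
Proof. by rewrite -cell_row. Qed.

Lemma cell_col x : (cell x).2 = (match x with inl i => 0%N | inr (r, b) => (dom_col r).*2.+1 + b end)%N :> nat.
Proof.
case: x => [i|[r b]] /=; rewrite nth_ordE //; first by lia.
have le_rk : (nth_ord (dom_row r) <= k)%N by have := cell_row (inr (r, b)); have [+ _ _] := dom_rowP r => /=; lia.
have := odd_part_mu le_rk; have := dom_col_lt r; have := ltn_ord (val l (nth_ord (dom_row r))).
by have := cell_row (inr (r, b)) => /= ->; case: b; lia.
Qed.

Lemma std_tableauE x : std_tableau (pt x) = cell x.
Proof. by rewrite ffunE ptK. Qed.

Lemma cell_inj : injective cell.
Proof.
move=> x y exy; have := congr1 (fun c : 'I_n * 'I_n => c.1 : nat) exy.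
have := congr1 (fun c : 'I_n * 'I_n => c.2 : nat) exy; rewrite /= !cell_row !cell_col {exy}.
case: x => [i|[r b]]; case: y => [j|[q c]] //.
  by move=> _ e; congr inl; apply: val_inj.
move=> e2 e1; have [eb ed] : b = c /\ dom_col r = dom_col q by case: b c e2 => [] []; lia.
by rewrite eb (dom_inj e1 ed).
Qed.

Lemma std_tableau_in : std_tableau \in tableaux l.
Proof.
rewrite inE; apply/andP; split.
  by apply/injectiveP => p q; rewrite !ffunE => /cell_inj/(can_inj (@unptK k)).
apply/forallP => p; rewrite ffunE; case: (unpt p) => [i|[r b]].
  rewrite cell_col odd_part_pos cell_row -ltnS; exact: ltn_ord.
rewrite cell_col odd_part_mu ?cell_row; last by have [] := dom_rowP r.
by have := dom_col_lt r; case: b; lia.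
Qed.

(* f is obtained from the row word s by cutting it into k triples of points, the
   r-th one taken from row r and twice from the row of domino r, and one point
   left over in row k. *)
Definition compat (s : row_word) (f : word) :=
  [forall r : 'I_k.+1, forall j : 'I_n, #|[set p | (f p == r) && (s p == j)]| ==
     if r == ord_max then nat_of_bool (j == k :> nat)
     else ((j == r :> nat) + 2 * (j == dom_row r :> nat))%N].

Lemma compat_act s f g : compat (fun_act s g) (fun_act f g) = compat s f.
Proof.
apply: eq_forallb => r; apply: eq_forallb => j; congr (_ == _).
rewrite -(card_imset _ (@perm_inj _ g^-1%g)); apply: eq_card => p.
rewrite inE; apply/imsetP/idP => [[q]|fp]; first by rewrite inE !ffunE => fq ->.
by exists (g p); rewrite ?inE ?ffunE permK.
Qed.

Lemma sum_row (i : nat) : (i < n)%N -> (\sum_(j < n) (j == i :> nat) = 1)%N.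
Proof.
move=> lt_i; rewrite (bigD1 (Ordinal lt_i)) //= eqxx big1 // => j.
by rewrite -(inj_eq val_inj) /= => /negPf ->.
Qed.

Lemma compat_top s f : compat s f -> top f.
Proof.
move=> /forallP cf; apply/forallP => r; apply/eqP.
rewrite -sum1_card (partition_big s xpredT) //=.
rewrite (eq_bigr (fun j : 'I_n => if r == ord_max then nat_of_bool (j == k :> nat)
     else ((j == r :> nat) + 2 * (j == dom_row r :> nat))%N)); last first.
  move=> j _; rewrite -(eqP (forallP (cf r) j)) -sum1_card; apply: eq_bigl => p.
  by rewrite !inE.
have kn : (k < n)%N by lia.
case: eqVneq => [_|rm]; first exact: sum_row.
have rn : (r < n)%N by have := ltn_ord r; lia.
rewrite big_split /= -big_distrr /= !sum_row //.
case: (unliftP ord_max r) rm => [r' ->|->]; last by rewrite eqxx.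
by rewrite lift_max => _; have [+ _ _] := dom_rowP r'; lia.
Qed.

Lemma card_points_pred (P : pred T) : #|[set p | P (unpt p)]| =
  (\sum_(i < k.+1) P (inl i) + \sum_(r < k) (P (inr (r, true)) + P (inr (r, false))))%N.
Proof.
rewrite card_pt -sum1_card big_mkcond /= big_sumType /=; congr addn.
  by apply: eq_bigr => i _; rewrite inE; case: (P _).
pose G (r : 'I_k) (b : bool) := if inr (r, b) \in [set t | P t] then 1%N else 0%N.
rewrite (eq_bigr (fun p => G p.1 p.2)) => [|[r b] _ //]; rewrite -(pair_bigA _ G).
by apply: eq_bigr => r _; rewrite big_bool /G !inE; case: (P _); case: (P _).
Qed.

Lemma sum_andb_eq (I : finType) (a : I) (B : pred I) : (\sum_i ((i == a) && B i) = B a)%N.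
Proof. by rewrite (bigD1 a) //= eqxx big1 ?addn0 // => i /negPf ->. Qed.

Lemma compat_std : compat (tabloid std_tableau) (std_word 1).
Proof.
apply/forallP => r; apply/forallP => j; apply/eqP.
pose P (t : T) := (match t with inl i => i | inr (q, _) => lift ord_max q end == r) && ((cell t).1 == j).
rewrite (_ : [set p | _] = [set p | P (unpt p)]); last first.
  apply/setP=> p; rewrite !inE !ffunE /P; case: (unpt p) => // -[q b].
  by rewrite perm1 if_same.
rewrite card_points_pred /P sum_andb_eq.
case: (unliftP ord_max r) => [r' ->|->].
  rewrite [lift _ _ == _]eq_sym (negPf (neq_lift _ _)) lift_max.
  congr addn.
    by rewrite cell_row_eq lift_max eq_sym.
  rewrite (eq_bigr (fun q : 'I_k => 2 * ((q == r') && ((cell (inr (q, true))).1 == j)))%N); last first.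
    by move=> q _; rewrite !(inj_eq lift_inj) /=; lia.
  rewrite -big_distrr sum_andb_eq; congr (_ * _)%N.
  by rewrite cell_row_eq eq_sym.
rewrite eqxx big1 ?addn0 => [|q _].
  by rewrite cell_row_eq eq_sym.
by rewrite ![lift _ _ == _]eq_sym (negPf (neq_lift _ _)).
Qed.

Definition inl_fun (a : 'S_k.+1) (x : T) : T := if x is inl i then inl (a i) else x.

Definition half_fun (b : bool) (g : 'S_k) (x : T) : T :=
  if x is inr (r, c) then inr (if c == b then g r else r, c) else x.

Lemma inl_fun_inj a : injective (inl_fun a).
Proof. by move=> [i|x] [j|y] //= [] // /perm_inj ->. Qed.

Lemma half_fun_inj b g : injective (half_fun b g).
Proof.
move=> [i|[r c]] [j|[q d]] //= [] // + cd; rewrite -cd.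
by case: (c == b) => [/perm_inj|] ->.
Qed.

Lemma odd_pt_perm (I : finType) (i : I -> T) (g : {perm I}) (e : T -> T) (inj_e : injective e) :
    injective i -> (forall x, e (i x) = i (g x)) -> (forall y, y \notin codom i -> e y = y) ->
  odd_perm (pt_perm (perm inj_e)) = odd_perm g.
Proof.
move=> inj_i ei eout; apply: (odd_extend (i := @pt k \o i)).
- exact: inj_comp (can_inj (@ptK k)) inj_i.
- by move=> x /=; rewrite pt_permE permE ei.
move=> y ny; rewrite -[y]unptK pt_permE permE eout //.
by apply: contra ny => /codomP[x yE]; rewrite -[y]unptK yE; apply: (codom_f (@pt k \o i)).
Qed.

(* u acts as the inverse of s on the first column and by one and the same
   permutation on the left and the right halves of the dominoes.  Hence
   sgn u = sgn s, and all terms of the coefficient of std_word 1 in the image of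
   the standard polytabloid are +1. *)
Section Sign.
Variables (u : 'S_n) (s : 'S_k.+1).
Hypotheses (Cu : u \in col_stab std_tableau) (smax : s ord_max = ord_max).
Hypothesis cpt : compat (tabloid std_tableau) (relabel s [ffun p => std_word 1 (u p)]).

Let col (x : T) : nat := (match x with inl i => 0%N | inr (r, b) => (dom_col r).*2.+1 + b end)%N.

Let colE x : col (unpt (u (pt x))) = col x.
Proof.
have := Cu; rewrite inE => /forallP/(_ (pt x))/eqP/(congr1 val)/=.
by rewrite -[u (pt x)]unptK !std_tableauE !cell_col unptK.
Qed.

Let al0 i := if unpt (u (pt (inl i))) is inl j then j else i.

Let ga0 b r := if unpt (u (pt (inr (r, b)))) is inr (q, _) then q else r.

Let al0E i : u (pt (inl i)) = pt (inl (al0 i)).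
Proof.
apply: (can_inj (@unptK k)); rewrite ptK /al0; have := colE (inl i).
by case: (unpt _) => // -[r b] /=.
Qed.

Let ga0E b r : u (pt (inr (r, b))) = pt (inr (ga0 b r, b)).
Proof.
apply: (can_inj (@unptK k)); rewrite ptK /ga0; have := colE (inr (r, b)).
case: (unpt _) => [i|[q c]] /=; first by case: b; lia.
by case: b c => [] [] //=; lia.
Qed.

Let ga0_col b r : dom_col (ga0 b r) = dom_col r.
Proof. by have := colE (inr (r, b)); rewrite ga0E ptK /=; case: b; lia. Qed.

Let al0_inj : injective al0.
Proof.
move=> i j e; have: pt (inl i) = pt (inl j) :> 'I_n.
  by apply: (@perm_inj _ u); rewrite !al0E e.
by move/(can_inj (@ptK k)) => -[].
Qed.

Let ga0_inj b : injective (ga0 b).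
Proof.
move=> i j e; have: pt (inr (i, b)) = pt (inr (j, b)) :> 'I_n.
  by apply: (@perm_inj _ u); rewrite !ga0E e.
by move/(can_inj (@ptK k)) => -[].
Qed.

Let al := perm al0_inj.
Let ga b := perm (@ga0_inj b).

(** The letter of base point [i] in the compatible word is [s (al i)]. A letter [q] other than
    [ord_max] occurs only in rows [q] and [dom_row q <= q], and the base point lies in row [i];
    hence [i <= s (al i)] for all [i]. *)
Let al_s : (al * s = 1)%g.
Proof.
apply: perm_leq_id => i; rewrite permM permE.
set q := s (al0 i).
have /forallP/(_ q)/forallP/(_ (nth_ord i))/eqP := cpt.
have in_n : (i < n)%N by have := ltn_ord i; lia.
rewrite (cardsD1 (pt (inl i))) inE !ffunE al0E !ptK eqxx -(inj_eq val_inj) /= !nth_ordE // eqxx.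
case: (unliftP ord_max q) => [q' ->|-> _]; last by rewrite -ltnS.
rewrite [lift _ _ == _]eq_sym (negPf (neq_lift _ _)) lift_max.
have := dom_row_leq q'; have [->|] := eqVneq (i : nat) q'; first by rewrite leqnn.
by have [-> //|] := eqVneq (i : nat) (dom_row q').
Qed.

Let s_al0 i : s (al0 i) = i.
Proof. by have /permP/(_ i) := al_s; rewrite permM permE perm1. Qed.

Let s0 i := odflt i (unlift ord_max (s (lift ord_max i))).

Let s0E i : s (lift ord_max i) = lift ord_max (s0 i).
Proof.
rewrite /s0; case: unliftP => [j -> //|]; rewrite -{2}smax => /perm_inj/esym/eqP.
by rewrite (negPf (neq_lift _ _)).
Qed.

Let s0_inj : injective s0.
Proof. by move=> i j e; apply/(@lift_inj _ ord_max)/(@perm_inj _ s); rewrite !s0E e. Qed.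

Let s1 := perm s0_inj.

(** By [al_s] the base point of triple [q] lies in row [q]. Compatibility asks for two further
    points in row [dom_row q], and the two domino points of the triple are the only candidates. *)
Let dom_row_ga b r : dom_row (s1 (ga b r)) = dom_row r.
Proof.
set q := s1 (ga b r); have := cpt => /forallP/(_ (lift ord_max q))/forallP/(_ (cell (inr (q, true))).1)/eqP.
pose f := relabel s [ffun p => std_word 1 (u p)].
pose P (t : T) := (f (pt t) == lift ord_max q) && ((cell t).1 == (cell (inr (q, true))).1).
rewrite (_ : [set p | _] = [set p | P (unpt p)]); last first.
  by apply/setP=> p; rewrite !inE /P unptK /tabloid !ffunE.
have f_inl i : f (pt (inl i)) = i by rewrite /f !ffunE al0E ptK s_al0.
have f_inr r' c : f (pt (inr (r', c))) = lift ord_max (s1 (ga c r')).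
  by rewrite /f !ffunE ga0E ptK perm1 if_same s0E !permE.
rewrite card_points_pred /P.
rewrite (eq_bigr (fun i => (i == lift ord_max q) && ((cell (inl i)).1 == (cell (inr (q, true))).1) : nat)) => [|i _]; last by rewrite f_inl.
rewrite sum_andb_eq.
have sumE c : (\sum_(r' < k) ((f (pt (inr (r', c))) == lift ord_max q) && ((cell (inr (r', c))).1 == (cell (inr (q, true))).1)) =
    ((dom_row ((ga c * s1)^-1%g q)) == dom_row q))%N.
  rewrite -(sum_andb_eq ((ga c * s1)^-1%g q) (fun r' => dom_row r' == dom_row q)).
  apply: eq_bigr => r' _; rewrite f_inr (inj_eq lift_inj) cell_row_eq cell_row; congr (_ && _ : nat).
  by rewrite -(inj_eq (@perm_inj _ (ga c * s1)%g)) permKV permM.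
rewrite [X in (_ + X)%N = _](_ : _ = ((dom_row ((ga true * s1)^-1%g q) == dom_row q) +
    (dom_row ((ga false * s1)^-1%g q) == dom_row q))%N); last first.
  by rewrite -!sumE; apply: big_split.
rewrite [lift _ _ == _]eq_sym (negPf (neq_lift _ _)).
rewrite !cell_row_eq !cell_row !lift_max eqxx [q == dom_row q :> nat]eq_sym.
have rE : (ga b * s1)^-1%g q = r by apply: (canLR (permK _)); rewrite permM.
move/(congr1 (subn^~ (dom_row q == q :> nat)))=> e.
by apply/esym/eqP; rewrite -[r]rE; move: e; case: (b); do 3!case: (dom_row _ == _) => //=; lia.
Qed.

(** A domino is determined by its row and column; [ga0_col] fixes the column and [dom_row_ga] the
    row, in the same way for both halves. *)
Let ga_eq : ga true = ga false.
Proof.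
apply/permP => r; pose r' := (ga false)^-1%g (ga true r).
have r'E : ga false r' = ga true r by rewrite permKV.
suff rr : r = r' by rewrite -r'E -rr.
apply: dom_inj.
  by rewrite -(dom_row_ga true) -(dom_row_ga false r') r'E.
by rewrite -(ga0_col true) -(ga0_col false r'); move: r'E; rewrite !permE => ->.
Qed.

Lemma odd_col_perm : odd_perm u = odd_perm s.
Proof.
have -> : u = (pt_perm (perm (@inl_fun_inj al)) * pt_perm (perm (@half_fun_inj true (ga true))) *
               pt_perm (perm (@half_fun_inj false (ga true))))%g.
  apply/permP => p; rewrite -[p]unptK !permM !pt_permE !permE.
  case: (unpt p) => [i|[r []]] /=; first by rewrite al0E permE.
    by rewrite ga0E permE.
  by rewrite ga0E ga_eq permE.
have odd_inl : odd_perm (pt_perm (perm (@inl_fun_inj al))) = odd_perm al.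
  apply: (odd_pt_perm (i := inl)) => //; first by move=> i j [].
  by case=> [i|//]; rewrite (codom_f (fun i : 'I_k.+1 => inl i : T)).
rewrite !odd_permM odd_inl.
have oddh b : odd_perm (pt_perm (perm (@half_fun_inj b (ga true)))) = odd_perm (ga true).
  apply: (odd_pt_perm (i := fun r => inr (r, b))) => [r q []//|r|]; first by rewrite /= eqxx.
  case=> [//|[r c]] /=; case: (eqVneq c b) => // -> /negP[].
  exact: (codom_f (fun r => inr (r, b))).
rewrite !oddh -addbA addbb addbF.
by have := congr1 (@odd_perm _) al_s; rewrite odd_permM odd_perm1; do 2!case: (odd_perm _).
Qed.

End Sign.

Definition embed_mx : 'M[F]_(#|{: row_word}|, #|{: word}|) :=
  lin_ext (fun s => \sum_(f | compat s f) basis_vec F f) *m alt_mx F n k.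

Lemma embed_mx_equiv g : rT g *m embed_mx = embed_mx *m tr g.
Proof.
rewrite /embed_mx mulmxA (lin_ext_equiv (rG := tr)) => [|s].
  by rewrite -mulmxA alt_mx_equiv mulmxA.
rewrite mulmx_suml (reindex_inj (act_inj (fun_action n 'I_k.+1) g)) /=.
by apply: eq_big => f; [rewrite compat_act | rewrite word_reprE].
Qed.

Lemma embed_std_neq0 : polytabloid F std_tableau *m embed_mx != 0.
Proof.
suff: coord (polytabloid F std_tableau *m embed_mx) (std_word 1) != 0.
  by apply: contraNneq => ->; rewrite coord0.
rewrite polytabloidE -mulmxA /col_antisym !mulmx_suml mulmx_sumr coord_sum.
pose c (u : 'S_n) (s : 'S_k.+1) : bool :=
  compat (tabloid std_tableau) (relabel s [ffun p => std_word 1 (u p)]).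
(* Each compatible pair [u], [s] contributes +1, so the coefficient is the number of such pairs; the
   pair of identities is one of them. *)
rewrite (eq_bigr (fun u => \sum_(s : 'S_k.+1 | s ord_max == ord_max) (c u s)%:R)); last first.
  move=> u Cu; rewrite -scalemxAl -scalemxAr coordZ embed_mx_equiv mulmxA coord_word.
  rewrite /embed_mx mulmxA coord_alt basis_lin_ext mulr_sumr; apply: eq_bigr => s /eqP smax.
  rewrite coord_sum -/(c u s).
  rewrite (eq_bigr (fun f => (relabel s [ffun p => std_word 1 (u p)] == f)%:R)) => [|f _]; last first.
    by rewrite coord_basis.
  have [cus|ncus] := boolP (c u s).
    rewrite (bigD1 (relabel s [ffun p => std_word 1 (u p)])) //= eqxx big1 ?addr0 => [|f /andP[_ ne]]; last first.
      by rewrite eq_sym (negPf ne).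
    by rewrite mulr1 (odd_col_perm Cu smax cus) -signr_addb addbb.
  rewrite big1 ?mulr0 // => f cf; case: eqP => // e.
  by rewrite -e /c in cf ncus; rewrite cf in ncus.
under eq_bigr do rewrite -natr_sum.
rewrite -natr_sum ((pcharf0P F).1 char0) -lt0n (bigD1 1%g) ?col_stab1 //= (bigD1 1%g) ?perm1 //=.
rewrite (_ : c _ _ = true) // /c relabel1.
have -> : [ffun p => std_word 1 ((1%g : 'S_n) p)] = std_word (1%g : 'S_k).
  by apply/ffunP => p; rewrite ffunE perm1.
exact: compat_std.
Qed.

(** The polytabloid is antisymmetric over the base points, which form the first column. Its image is
    therefore, up to a nonzero factor, an antisymmetrization over k+1 points, and [antisym_merge0]
    applies. *)
Lemma embed_std_sub : (0 < k)%N -> (polytabloid F std_tableau *m embed_mx <= H)%MS.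
Proof.
move=> k_gt0; apply/top_cyclesP; split.
- rewrite /embed_mx mulmxA => f nf; rewrite coord_alt big1 // => s /eqP smax.
  rewrite lin_ext_sum coord_sum big1 ?mulr0 // => s' _.
  rewrite coordZ coord_sum big1 ?mulr0 // => f' /compat_top tf'.
  rewrite coord_basis; case: eqP => // e.
  by move: tf'; rewrite -e top_relabel // (negPf nf).
- by rewrite /embed_mx mulmxA; apply: alternating_alt.
have cov : covariant rT true (Sym (base_pts k)) (polytabloid F std_tableau).
  move=> g Bg; have Cg : g \in col_stab std_tableau.
    rewrite inE; apply/forallP => p; have [Bp|nBp] := boolP (p \in base_pts k).
      have /imsetP[j _ ->] := Sym_closed Bg Bp; have /imsetP[i _ ->] := Bp.
      by rewrite !std_tableauE.
    by move: Bg; rewrite inE => /out_perm ->.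
  by rewrite polytabloidE -mulmxA col_antisym_actr // -scalemxAr.
have nzc : #|Sym (base_pts k)|%:R != 0 :> F.
  by rewrite ((pcharf0P F).1 char0) -lt0n (cardD1 1%g) inE perm_on1.
apply: (scalerI nzc); rewrite scaler0 !scalemxAl -(covariant_antisym cov).
have comm : antisym_mx rT (base_pts k) *m embed_mx = embed_mx *m antisym_mx tr (base_pts k).
  rewrite mulmx_suml mulmx_sumr; apply: eq_bigr => g _.
  by rewrite -scalemxAl -scalemxAr embed_mx_equiv.
rewrite -(mulmxA _ _ embed_mx) comm -!mulmxA antisym_merge0 ?mulmx0 ?card_base_pts //.
by apply/eqP => /(congr1 val)/=; lia.
Qed.

Lemma embed_sub : (0 < k)%N -> (specht_mx F l *m embed_mx <= H)%MS.
Proof.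
move=> k_gt0; rewrite /specht_mx sumsmxMr_gen; apply/sumsmx_subP => t lt.
rewrite genmxE (eqmxMr _ (genmxE _)); have [g ->] := tableau_trans std_tableau_in lt.
rewrite -polytabloid_act -mulmxA embed_mx_equiv mulmxA.
by apply: mxmodule_trans (embed_std_sub k_gt0); rewrite ?top_cycles_module ?inE.
Qed.

End Embedding.

(** * Homology as a module of top cycles *)

Lemma section_rsim (F : fieldType) (gT : finGroupType) (G : {group gT}) m d
    (rG : mx_representation F G m) (rG' : mx_representation F G d)
    (U V : 'M_m) (H : 'M_d) (Phi : 'M_(m, d))
    (modU : mxmodule rG U) (modV : mxmodule rG V) (modH : mxmodule rG' H) :
    (forall g, g \in G -> rG g *m Phi = Phi *m rG' g) ->
    (U <= V)%MS -> U *m Phi = 0 -> (V :&: kermx Phi <= U)%MS -> (V *m Phi :=: H)%MS ->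
  mx_rsim (section_repr modU modV) (submod_repr modH).
Proof.
move=> equiv sUV UPhi kerU defH.
have UV : (U + V :=: V)%MS by apply/addsmx_idPr.
pose n1 := \rank <<in_factmod U V>>%MS.
(* [w] lifts coordinates in the section V/U to vectors of V; the choice of lift does not affect
   [Phi], which kills U. *)
pose w m1 (u : 'M_(m1, n1)) := val_factmod (val_submod u) : 'M_(m1, m).
have sw m1 (u : 'M_(m1, n1)) : (w _ u <= V)%MS.
  rewrite -UV; apply: submx_trans (proj_factmodS _ _).
  by rewrite val_factmodS; apply: submx_trans (val_submodP _) _; rewrite genmxE.
have wE m1 (u : 'M_(m1, n1)) : w _ u = u *m w _ 1%:M.
  by rewrite /w val_factmodE val_submodE [in RHS]val_factmodE !mulmxA.
have swH m1 (u : 'M_(m1, n1)) : (w _ u *m Phi <= H)%MS by rewrite -defH submxMr.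
have factPhi m1 (x : 'M_(m1, m)) : val_factmod (in_factmod U x) *m Phi = x *m Phi.
  rewrite -[in RHS](add_sub_fact_mod U x) mulmxDl [X in _ = X + _](_ : _ = 0) ?add0r //.
  by have /submxP[D ->] := val_submodP (in_submod U x); rewrite -mulmxA UPhi mulmx0.
have linw m1 (u : 'M_(m1, n1)) :
    u *m in_submod H (w _ 1%:M *m Phi) = in_submod H (w _ u *m Phi).
  by rewrite in_submodE [RHS]in_submodE (wE _ u) !mulmxA.
exists (in_submod H (w _ 1%:M *m Phi)) => [||g Gg].
- have kerE : (V :&: kermx Phi :=: U)%MS.
    by apply/eqmxP; rewrite kerU sub_capmx sUV; apply/sub_kermxP.
  apply: (@addIn (\rank U)); rewrite -/n1 /n1 genmxE mxrank_in_factmod UV -(mxrank_mul_ker V Phi) kerE.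
  by rewrite defH.
- rewrite -kermx_eq0; apply/rowV0P => u /sub_kermxP.
  rewrite linw => /eqP.
  rewrite -val_submod_eq0 in_submodK // => /eqP wPhi.
  have : (w _ u <= U)%MS by apply: submx_trans kerU; rewrite sub_capmx sw; apply/sub_kermxP.
  by rewrite -in_factmod_eq0 val_factmodK val_submod_eq0 => /eqP.
pose S := section_repr modU modV g.
have wS : w _ S *m Phi = w _ 1%:M *m Phi *m rG' g.
  have SE : val_submod S = val_submod (1%:M : 'M_n1) *m factmod_repr modU g.
    by rewrite -(val_submodJ (section_module modU modV)) // mul1mx.
  rewrite /w SE (val_factmodJ modU) // factPhi.
  by rewrite -[LHS](mulmxA _ (rG g)) (equiv _ Gg) [LHS]mulmxA.
rewrite -/S linw.
by rewrite wS (in_submodJ modH).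
Qed.

Lemma big_lift_perm (R : Type) (idx : R) (op : Monoid.com_law idx) m (i j : 'I_m.+1)
    (E : 'S_m.+1 -> R) :
  \big[op/idx]_(s : 'S_m.+1 | s i == j) E s = \big[op/idx]_(w : 'S_m) E (lift_perm i j w).
Proof.
have inj_lp : injective (lift_perm i j).
  move=> w w' e; apply/permP => x; apply: (@lift_inj _ j).
  by rewrite -!(lift_perm_lift i j) e.
transitivity (\big[op/idx]_(s in lift_perm i j @: [set: 'S_m]) E s); last first.
  rewrite big_imset => [|? ? _ _ /inj_lp //].
  by apply: eq_bigl => w; rewrite inE.
apply: eq_bigl => s; apply/eqP/imsetP => [si|[w _ ->]]; last by rewrite lift_perm_id.
pose w0 x := odflt x (unlift j (s (lift i x))).
have w0E x : lift j (w0 x) = s (lift i x).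
  rewrite /w0; case: unliftP => [y -> //|]; rewrite -si => /perm_inj/esym/eqP.
  by rewrite (negPf (neq_lift _ _)).
have w0_inj : injective w0.
  by move=> x y e; apply/(@lift_inj _ i)/(@perm_inj _ s); rewrite -!w0E e.
exists (perm w0_inj); rewrite ?inE //; apply/permP => x.
by case: (unliftP i x) => [y|] ->; rewrite ?lift_perm_lift ?lift_perm_id // permE.
Qed.

(** * Comparison of oriented chains with words *)

Section ChainComparison.
Variables (F : numClosedFieldType) (n : nat).
Local Notation V := {set 'I_n}.
Local Notation K := (matching_complex 3 n).
Local Notation simplices p := (ordered_simplices K p).

Let char0 : [pchar F] =i pred0. Proof. exact: pchar_num. Qed.

(** For a point in none of the [p] triples [find] returns [p], so the point gets the letter
    [ord_max]. *)
Definition word_of p (s : p.-tuple V) : {ffun 'I_n -> 'I_p.+1} :=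
  [ffun x => inord (find (fun A : V => x \in A) s)].

Definition tuple_of p (f : {ffun 'I_n -> 'I_p.+1}) : p.-tuple V :=
  [tuple [set x | f x == lift ord_max i] | i < p].

Lemma simplex_card p (s : p.-tuple V) i : s \in simplices p -> #|tnth s i| = 3%N.
Proof.
rewrite inE => /andP[_]; rewrite inE => /andP[/forall_inP/(_ (tnth s i)) cs _].
by apply/eqP/cs; rewrite inE mem_tnth.
Qed.

Lemma simplex_disjoint p (s : p.-tuple V) i j x : s \in simplices p ->
  x \in tnth s i -> x \in tnth s j -> i = j.
Proof.
rewrite inE => /andP[/tuple_uniqP inj_s]; rewrite inE => /andP[_ /trivIsetP tI] xi xj.
apply: inj_s; apply/eqP/negPn/negP => nij.
have := tI (tnth s i) (tnth s j); rewrite !inE !mem_tnth => /(_ isT isT nij).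
by rewrite -setI_eq0 => /eqP/setP/(_ x); rewrite !inE xi xj.
Qed.

Lemma word_of_lift p (s : p.-tuple V) x i : s \in simplices p ->
  (word_of s x == lift ord_max i) = (x \in tnth s i).
Proof.
move=> Ks; have le_f : (find (fun A : V => x \in A) s < p.+1)%N.
  by rewrite ltnS -[X in (_ <= X)%N](size_tuple s) find_size.
have -> : (word_of s x == lift ord_max i) = (find (fun A : V => x \in A) s == i :> nat).
  by rewrite ffunE -[in RHS](lift_max i) -[in RHS](inordK le_f).
apply/eqP/idP => [fE|xi].
  have hs : has (fun A : V => x \in A) s by rewrite has_find size_tuple fE.
  by have := nth_find set0 hs; rewrite fE -tnth_nth.
have hs : has (fun A : V => x \in A) s by apply/hasP; exists (tnth s i); rewrite ?mem_tnth.
have lt_f := hs; rewrite has_find size_tuple in lt_f.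
have -> : i = Ordinal lt_f; last by [].
apply: (simplex_disjoint Ks xi).
by have := nth_find set0 hs; rewrite -(tnth_nth _ _ (Ordinal lt_f)).
Qed.

Lemma tuple_ofK p (s : p.-tuple V) : s \in simplices p -> tuple_of (word_of s) = s.
Proof.
move=> Ks; apply: eq_from_tnth => i; rewrite tnth_mktuple; apply/setP => x.
by rewrite inE word_of_lift.
Qed.

Lemma word_ofK p (f : {ffun 'I_n -> 'I_p.+1}) : tuple_of f \in simplices p -> word_of (tuple_of f) = f.
Proof.
move=> Kf; apply/ffunP => x; case: (unliftP ord_max (f x)) => [i fx|fx].
  by apply/eqP; rewrite fx word_of_lift // tnth_mktuple inE fx.
case: (unliftP ord_max (word_of (tuple_of f) x)) => [i /eqP|->]; last by rewrite fx.
by rewrite word_of_lift // tnth_mktuple inE fx (negPf (neq_lift _ _)).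
Qed.

Lemma word_of_eq p (s : p.-tuple V) (f : {ffun 'I_n -> 'I_p.+1}) : s \in simplices p ->
  (forall x i, (x \in tnth s i) = (f x == lift ord_max i)) -> word_of s = f.
Proof.
move=> Ks sf; rewrite -[RHS](@word_ofK p).
  congr word_of; apply: eq_from_tnth => i; rewrite tnth_mktuple; apply/setP => x.
  by rewrite inE sf.
suff -> : tuple_of f = s by [].
by apply: eq_from_tnth => i; rewrite tnth_mktuple; apply/setP => x; rewrite inE sf.
Qed.

Lemma word_of_act p (s : p.-tuple V) g :
  word_of (tuple_act ('P^*)%act s g) = fun_act (word_of s) g.
Proof.
apply/ffunP => x; rewrite !ffunE find_map; congr inord; apply: eq_find => A /=.
rewrite /setact; apply/imsetP/idP => [[y Ay ->]|Ax]; first by rewrite /= apermE permK.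
by exists (g^-1%g x); rewrite //= apermE permKV.
Qed.

Lemma tuple_perm_simplex p (s : p.-tuple V) (u : 'S_p) : s \in simplices p ->
  tuple_perm s u \in simplices p.
Proof.
rewrite !inE => /andP[/tuple_uniqP inj_s Ks]; apply/andP; split.
  by apply/tuple_uniqP => i j; rewrite !tnth_mktuple => /inj_s/perm_inj.
suff -> : [set:: tuple_perm s u] = [set:: s] by [].
apply/setP => A; rewrite !inE; apply/tnthP/tnthP => -[i ->].
  by exists (u i); rewrite tnth_mktuple.
by exists (u^-1%g i); rewrite tnth_mktuple permKV.
Qed.

Lemma tuple_del_simplex p (s : p.+1.-tuple V) j : s \in simplices p.+1 ->
  tuple_del s j \in simplices p.
Proof.
rewrite inE => /andP[/tuple_uniqP inj_s Ks]; rewrite inE; apply/andP; split.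
  by apply/tuple_uniqP => i i'; rewrite !tnth_mktuple => /inj_s/lift_inj.
apply: faces_subset Ks; apply/subsetP => A; rewrite !inE => /tnthP[i ->].
by rewrite tnth_mktuple mem_tnth.
Qed.

Lemma word_of_perm p (s : p.-tuple V) (u : 'S_p) : s \in simplices p ->
  word_of (tuple_perm s u) = relabel (embed_perm u)^-1%g (word_of s).
Proof.
move=> Ks; apply: word_of_eq; first exact: tuple_perm_simplex.
move=> x i; rewrite tnth_mktuple ffunE -(inj_eq (@perm_inj _ (embed_perm u))) permKV.
by rewrite embed_lift word_of_lift.
Qed.

Lemma tuple_permM p (s : p.-tuple V) (u w : 'S_p) :
  tuple_perm (tuple_perm s u) w = tuple_perm s (w * u)%g.
Proof. by apply: eq_from_tnth => i; rewrite !tnth_mktuple permM. Qed.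

(** On chains the kernel of this alternation is the space of orientation relations ([chain_alt0P]),
    so its image is a model of the quotient. *)
Definition tuple_alt p : 'M[F]_#|{: p.-tuple V}| :=
  lin_ext (fun s => \sum_(u : 'S_p) (-1) ^+ u *: basis_vec F (tuple_perm s u)).

Definition word_mx p : 'M[F]_(#|{: p.-tuple V}|, #|{: {ffun 'I_n -> 'I_p.+1}}|) :=
  lin_ext (fun s => basis_vec F (word_of s)).

Definition del0_mx p : 'M[F]_(#|{: p.+1.-tuple V}|, #|{: p.-tuple V}|) :=
  lin_ext (fun s => basis_vec F (tuple_del s ord0)).

Local Notation OC p := (ordered_chains F K p).
Local Notation OR p := (orientation_rels F K p).

Lemma chains_eq p m (A B : 'M_(_, m)) :
  (forall s, s \in simplices p -> basis_vec F s *m A = basis_vec F s *m B) ->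
  forall d (v : 'M_(d, _)), (v <= OC p)%MS -> v *m A = v *m B.
Proof.
move=> eqAB d v vOC; apply/eqP; rewrite -subr_eq0 -mulmxBr; apply/eqP/sub_kermxP.
apply: submx_trans vOC _; apply/sumsmx_subP => s Ks; rewrite genmxE; apply/sub_kermxP.
by rewrite mulmxBr eqAB // subrr.
Qed.

Lemma chains_sub p m k (A : 'M_(_, m)) (C : 'M_(k, m)) :
  (forall s, s \in simplices p -> (basis_vec F s *m A <= C)%MS) ->
  forall d (v : 'M_(d, _)), (v <= OC p)%MS -> (v *m A <= C)%MS.
Proof.
move=> sAC d v vOC; apply: submx_trans (submxMr A vOC) _; rewrite /ordered_chains sumsmxMr_gen.
apply/sumsmx_subP => s Ks; rewrite genmxE (eqmxMr _ (genmxE _)); exact: sAC.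
Qed.

Lemma basis_chain p s : s \in simplices p -> (basis_vec F s <= OC p)%MS.
Proof. by move=> Ks; rewrite /ordered_chains (sumsmx_sup s) ?genmxE. Qed.

Lemma tuple_alt_chain p d (v : 'M_(d, _)) : (v <= OC p)%MS -> (v *m tuple_alt p <= OC p)%MS.
Proof.
apply: chains_sub => s Ks; rewrite basis_lin_ext summx_sub // => u _.
by rewrite scalemx_sub // basis_chain // tuple_perm_simplex.
Qed.

Lemma word_mx_inj p d (v : 'M_(d, _)) : (v <= OC p)%MS -> v *m word_mx p = 0 -> v = 0.
Proof.
move=> vOC v0; pose Psi : 'M[F]__ := lin_ext (fun f => basis_vec F (@tuple_of p f)).
rewrite -[v]mulmx1 -(@chains_eq p _ (word_mx p *m Psi) 1%:M) //.
  by rewrite mulmxA v0 mul0mx.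
by move=> s Ks; rewrite mulmxA !basis_lin_ext mulmx1 tuple_ofK.
Qed.

Lemma orientation_rels_chain p : (OR p <= OC p)%MS.
Proof.
apply/sumsmx_subP => -[s u] /= Ks; rewrite genmxE addmx_sub ?basis_chain ?tuple_perm_simplex //.
by rewrite eqmx_opp scalemx_sub // basis_chain.
Qed.

Lemma orientation_rels_alt p : OR p *m tuple_alt p = 0.
Proof.
apply/eqP; rewrite -submx0 /orientation_rels sumsmxMr_gen; apply/sumsmx_subP => -[s u] /= Ks.
rewrite genmxE (eqmxMr _ (genmxE _)) submx0 mulmxBl -scalemxAl !basis_lin_ext subr_eq0.
rewrite scaler_sumr [X in _ == X](reindex_inj (mulIg u)) /=; apply/eqP/eq_bigr => w _.
by rewrite tuple_permM scalerA odd_permM signr_addb mulrCA -signr_addb addbb mulr1.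
Qed.

(** On a basis vector the difference is a sum over [u] of signed orientation relations. As p! is
    invertible, an alternation equal to 0 then leaves only orientation relations. *)
Lemma chain_alt_sub p (v : 'rV_#|{: p.-tuple V}|) : (v <= OC p)%MS ->
  (#|'S_p|%:R *: v - v *m tuple_alt p <= OR p)%MS.
Proof.
rewrite -mul_mx_scalar -mulmxBr; apply: chains_sub => s Ks.
rewrite mulmxBr mul_mx_scalar basis_lin_ext scaler_nat -sumr_const -sumrB summx_sub // => u _.
rewrite (_ : _ - _ = - (-1) ^+ u *: orientation_rel F s u); last first.
  rewrite /orientation_rel scaleNr scalerBr opprB scalerA -signr_addb addbb scale1r.
  by [].
rewrite scalemx_sub // /orientation_rels (sumsmx_sup (s, u)) //= genmxE.
exact: submx_refl.
Qed.

Lemma chain_alt0P p (v : 'rV_#|{: p.-tuple V}|) : (v <= OC p)%MS ->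
  (v <= OR p)%MS = (v *m tuple_alt p == 0).
Proof.
move=> vOC; apply/idP/eqP => [/submxP[D ->]|v0].
  by rewrite -mulmxA orientation_rels_alt mulmx0.
have := chain_alt_sub vOC; rewrite v0 subr0 => sv.
have nz : #|'S_p|%:R != 0 :> F by rewrite ((pcharf0P F).1 char0) -lt0n; apply/card_gt0P; exists 1%g.
by rewrite -(eqmx_scale _ nz).
Qed.

Lemma boundary_chain p d (v : 'M_(d, _)) : (v <= OC p.+1)%MS -> (v *m boundary_map F V p <= OC p)%MS.
Proof.
apply: chains_sub => s Ks; rewrite basis_lin_ext summx_sub // => j _.
by rewrite scalemx_sub // basis_chain // tuple_del_simplex.
Qed.

(** Grouping the permutations by the image [j] of 0 shows that deleting the first vertex after
    alternating already yields all faces; the sign [(-1)^j] is the one of [lift_perm ord0 j]. So the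
    boundary becomes a single face map, as in [top_cycles]. *)
Lemma boundary_alt p : boundary_map F V p *m tuple_alt p = tuple_alt p.+1 *m del0_mx p.
Proof.
apply: basis_vec_ext => s; rewrite !mulmxA !basis_lin_ext !mulmx_suml.
rewrite [RHS](partition_big (fun v : 'S_p.+1 => v ord0) xpredT) //=.
apply: eq_bigr => j _; rewrite big_lift_perm -scalemxAl basis_lin_ext scaler_sumr.
apply: eq_bigr => w _; rewrite -scalemxAl basis_lin_ext scalerA odd_lift_perm /= signr_addb signr_odd.
congr (_ *: basis_vec F _); apply: eq_from_tnth => i.
by rewrite !tnth_mktuple lift_perm_lift.
Qed.

Lemma del0_word p (s : p.+1.-tuple V) : s \in simplices p.+1 ->
  merge ord0 (word_of s) =
  [ffun x => if unlift ord_max (word_of (tuple_del s ord0) x) is Some i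
             then lift ord_max (lift ord0 i) else ord0].
Proof.
move=> Ks; have Kd := tuple_del_simplex ord0 Ks.
have del0E x i : (word_of (tuple_del s ord0) x == lift ord_max i) = (x \in tnth s (lift ord0 i)).
  by rewrite word_of_lift // tnth_mktuple.
apply/ffunP => x; rewrite ffunE [RHS]ffunE.
case: (unliftP ord_max (word_of s x)) => [i|] wx.
  rewrite wx [_ == ord_max]eq_sym (negPf (neq_lift _ _)).
  have xi : x \in tnth s i by rewrite -word_of_lift // wx.
  case: unliftP => [j /eqP|dx].
    by rewrite del0E => /(simplex_disjoint Ks xi) ->.
  case: (unliftP ord0 i) => [j ij|->]; last exact/val_inj.
  by have := del0E x j; rewrite dx -ij xi (negPf (neq_lift _ _)).
rewrite wx eqxx; case: unliftP => [j /eqP|//].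
by rewrite del0E -word_of_lift // wx (negPf (neq_lift _ _)).
Qed.

(** The word of the face and the merged word differ by the renaming of letters [th], which has the
    left inverse [th'] and thus loses nothing. *)
Lemma del0_merge p (v : 'rV_#|{: p.+1.-tuple V}|) : (v <= OC p.+1)%MS ->
  (v *m del0_mx p == 0) = (v *m word_mx p.+1 *m merge_mx F n ord0 == 0).
Proof.
move=> vOC; pose th (f : {ffun 'I_n -> 'I_p.+1}) : {ffun 'I_n -> 'I_p.+2} :=
  [ffun x => if unlift ord_max (f x) is Some i then lift ord_max (lift ord0 i) else ord0].
pose th' (f : {ffun 'I_n -> 'I_p.+2}) : {ffun 'I_n -> 'I_p.+1} :=
  [ffun x => if unlift ord_max (f x) is Some j then (if unlift ord0 j is Some i then lift ord_max i else ord_max) else ord_max].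
pose Th : 'M[F]__ := lin_ext (fun f => basis_vec F (th f)).
pose Th' : 'M[F]__ := lin_ext (fun f => basis_vec F (th' f)).
have thK : Th *m Th' = 1%:M.
  apply: basis_vec_ext => f; rewrite mulmxA !basis_lin_ext mulmx1; congr basis_vec.
  apply/ffunP => x; rewrite !ffunE; case: (unliftP ord_max (f x)) => [i|] ->.
    by rewrite liftK liftK.
  case: unliftP => [j e|//]; have -> : j = ord0 by apply: val_inj; have := congr1 val e; rewrite /= /bump; case: leqP => //; lia.
  by rewrite unlift_none.
have eqv : v *m word_mx p.+1 *m merge_mx F n ord0 = v *m del0_mx p *m word_mx p *m Th.
  rewrite -!mulmxA; apply: (chains_eq _ vOC) => s Ks.
  by rewrite !mulmxA !basis_lin_ext del0_word.
rewrite eqv; apply/eqP/eqP => [-> | e]; first by rewrite !mul0mx.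
apply: (@word_mx_inj p).
  by apply: chains_sub vOC => s Ks; rewrite basis_lin_ext basis_chain // tuple_del_simplex.
by rewrite -[LHS]mulmx1 -thK mulmxA e mul0mx.
Qed.

Lemma cyclesP p (v : 'rV_#|{: p.+1.-tuple V}|) :
  (v <= cycles F K p)%MS =
  (v <= OC p.+1)%MS && (v *m tuple_alt p.+1 *m word_mx p.+1 *m merge_mx F n ord0 == 0).
Proof.
rewrite sub_capmx; apply: andb_id2l => vOC; rewrite -del0_merge ?tuple_alt_chain //.
rewrite (sameP sub_kermxP eqP) mulmxA -submxE chain_alt0P ?boundary_chain //.
by rewrite -mulmxA boundary_alt mulmxA.
Qed.

End ChainComparison.

Section HomologyIso.
Variables (F : numClosedFieldType) (p : nat).
Local Notation k := p.+1.
Local Notation n := (3 * k + 1)%N.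
Local Notation V := {set 'I_n}.
Local Notation K := (matching_complex 3 n).
Local Notation simplices p := (ordered_simplices K p).
Local Notation tr := (word_repr F n 'I_k.+1).

Lemma sum_fibers q (f : {ffun 'I_n -> 'I_q}) : (\sum_(i < q) #|[set x | f x == i]| = n)%N.
Proof.
rewrite -[RHS](card_ord n) -sum1_card (partition_big f xpredT) //=.
apply: eq_bigr => i _; rewrite -sum1_card; apply: eq_bigl => x; by rewrite inE.
Qed.

Lemma card_word_of q (s : q.-tuple V) i : s \in simplices q ->
  #|[set x | word_of s x == lift ord_max i]| = 3%N.
Proof.
move=> Ks; apply: etrans (simplex_card i Ks); apply: eq_card => x.
by rewrite inE word_of_lift.
Qed.

(** One more triple would require 3k+3 points. *)
Lemma no_simplices : simplices k.+1 = set0.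
Proof.
apply/setP => s; rewrite [RHS]inE; apply/negP => Ks.
have := sum_fibers (word_of s); rewrite big_ord_recr /=.
rewrite (eq_bigr (fun=> 3%N)) => [|i _]; first by rewrite sum_nat_const card_ord; lia.
apply: etrans (card_word_of i Ks); apply: eq_card => x; rewrite !inE; congr (_ == _).
by apply/val_inj/esym; apply: lift_max.
Qed.

Lemma top_word_of (s : k.-tuple V) : s \in simplices k -> top (word_of s).
Proof.
move=> Ks; apply/forallP => i; case: (unliftP ord_max i) => [j|] ->.
  by rewrite card_word_of // [_ == ord_max]eq_sym (negPf (neq_lift _ _)).
rewrite eqxx; apply/eqP; have := sum_fibers (word_of s); rewrite big_ord_recr /=.
rewrite (eq_bigr (fun=> 3%N)) => [|j _]; first by rewrite sum_nat_const card_ord; lia.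
apply: etrans (card_word_of j Ks); apply: eq_card => x; rewrite !inE; congr (_ == _).
by apply/val_inj/esym; apply: lift_max.
Qed.

Lemma tuple_of_simplex (f : {ffun 'I_n -> 'I_k.+1}) : top f -> tuple_of f \in simplices k.
Proof.
move=> /forallP tf; have card3 i : #|tnth (tuple_of f) i| = 3%N.
  by rewrite tnth_mktuple; have /eqP := tf (lift ord_max i); rewrite [_ == ord_max]eq_sym (negPf (neq_lift _ _)).
rewrite inE; apply/andP; split.
  apply/tuple_uniqP => i j e; have /card_gt0P[x xi] : (0 < #|tnth (tuple_of f) i|)%N by rewrite card3.
  have := xi; rewrite e; move: xi; rewrite !tnth_mktuple !inE => /eqP -> /eqP.
  exact: lift_inj.
rewrite inE; apply/andP; split.
  by apply/forall_inP => A; rewrite inE => /tnthP[i ->]; rewrite card3.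
apply/trivIsetP => A B; rewrite !inE => /tnthP[i ->] /tnthP[j ->] nAB.
rewrite -setI_eq0; apply/eqP/setP => x; rewrite !tnth_mktuple !inE; apply/negP => /andP[/eqP -> /eqP/lift_inj ij].
by rewrite ij eqxx in nAB.
Qed.

Lemma basis_alt_embed (f : {ffun 'I_n -> 'I_k.+1}) : basis_vec F f *m alt_mx F n k =
  \sum_(u : 'S_k) (-1) ^+ u *: basis_vec F (relabel (embed_perm u)^-1%g f).
Proof.
rewrite basis_lin_ext big_lift_perm (reindex_inj invg_inj) /=; apply: eq_bigr => u _.
have <- : (embed_perm u)^-1%g = lift_perm ord_max ord_max u^-1%g :> 'S_k.+1 by rewrite lift_permV.
by rewrite odd_permV odd_embed.
Qed.

Lemma tuple_alt_word d (v : 'M_(d, _)) : (v <= ordered_chains F K k)%MS ->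
  v *m (tuple_alt F n k *m word_mx F n k) = v *m (word_mx F n k *m alt_mx F n k).
Proof.
apply: chains_eq => s Ks; rewrite !mulmxA [_ *m word_mx _ _ _ in RHS]basis_lin_ext basis_alt_embed.
rewrite basis_lin_ext mulmx_suml; apply: eq_bigr => u _.
by rewrite -scalemxAl basis_lin_ext word_of_perm.
Qed.

(** In the top degree the boundaries are just the orientation relations, that is, 0 in the quotient;
    [Phi] has them as kernel on cycles and maps onto the top cycles. *)
Lemma homology_rsim :
  mx_rsim (reduced_homology F (@matching_complex_acts 3 n) p)
          (submod_repr (top_cycles_module F n k)).
Proof.
pose Phi := tuple_alt F n k *m word_mx F n k.
have chains0 : ordered_chains F K k.+1 = 0.
  by rewrite /ordered_chains big_pred0 // => s; rewrite no_simplices inE.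
have bE : (boundaries F K p :=: orientation_rels F K k)%MS.
  by rewrite /boundaries chains0 mul0mx; apply: adds0mx.
apply: (section_rsim (Phi := Phi)).
- move=> g _; apply: basis_vec_ext => s.
  rewrite /Phi !mulmxA (perm_reprE F [set: 'S_n]%G) !basis_lin_ext !mulmx_suml; apply: eq_bigr => u _.
  rewrite -!scalemxAl !basis_lin_ext -[fun_action _ _ _ g]/(fun_act _ g) -word_of_act; congr (_ *: basis_vec F (word_of _)).
  by apply: eq_from_tnth => i; rewrite !(tnth_map, tnth_ord_tuple).
- rewrite bE; apply/rV_subP => v vOR; rewrite cyclesP (submx_trans vOR (orientation_rels_chain _ _ _)) /=.
  by have /submxP[D ->] := vOR; rewrite -(mulmxA D) orientation_rels_alt mulmx0 !mul0mx.
- have /submxP[D ->] : (boundaries F K p <= orientation_rels F K k)%MS by rewrite bE.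
  by rewrite /Phi -mulmxA (mulmxA _ (tuple_alt _ _ _)) orientation_rels_alt mul0mx mulmx0.
- rewrite bE; apply/rV_subP => v; rewrite sub_capmx cyclesP => /andP[/andP[vOC _] /sub_kermxP].
  rewrite /Phi mulmxA => /word_mx_inj v0; rewrite chain_alt0P // v0 //.
  exact: tuple_alt_chain.
apply/eqmxP/andP; split.
  apply/row_subP => i; rewrite row_mul; set v := row i _.
  have : (v <= cycles F K p)%MS by apply: row_sub.
  rewrite cyclesP => /andP[vOC /eqP v0]; apply/top_cyclesP; split.
  - apply/top_supportedP; rewrite /Phi mulmxA -(mulmxA (v *m _)); apply/eqP.
    apply: (chains_eq _ (tuple_alt_chain vOC)) => s Ks.
    by rewrite mulmxA !basis_lin_ext top_word_of // scale1r.
  - by rewrite /Phi tuple_alt_word // mulmxA; apply: alternating_alt.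
  by rewrite /Phi mulmxA.
apply/rV_subP => x /top_cyclesP[topx altx x0].
(* For surjectivity, [Psi] reads a top word as an ordered simplex; alternating it multiplies the
   already alternating [x] by [nb_relabel k]. *)
pose Psi : 'M[F]__ := lin_ext (fun f => basis_vec F (@tuple_of n k f)).
pose v := x *m Psi.
have vOC : (v <= ordered_chains F K k)%MS.
  rewrite /v [x]basis_sum mulmx_suml summx_sub // => f _; rewrite -scalemxAl basis_lin_ext.
  have [tf|/topx ->] := boolP (top f); last by rewrite scale0r sub0mx.
  by rewrite scalemx_sub // basis_chain // tuple_of_simplex.
have vw : v *m word_mx F n k = x.
  rewrite /v [in RHS](basis_sum x) [x in x *m Psi]basis_sum !mulmx_suml; apply: eq_bigr => f _.
  rewrite -!scalemxAl !basis_lin_ext; have [tf|/topx ->] := boolP (top f); last by rewrite !scale0r.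
  by rewrite word_ofK // tuple_of_simplex.
have vPhi : v *m Phi = (nb_relabel k)%:R *: x.
  by rewrite /Phi tuple_alt_word // mulmxA vw; apply/eqP/alternatingP.
have -> : x = (nb_relabel k)%:R^-1 *: (v *m Phi).
  by rewrite vPhi scalerA mulVf ?nb_relabel_neq0 ?scale1r.
rewrite scalemx_sub // submxMr // cyclesP vOC -(mulmxA v) -/Phi vPhi -scalemxAl x0 scaler0.
by rewrite eqxx.
Qed.

End HomologyIso.

(** * Decomposition *)

Lemma simple_image_rsim (F : fieldType) (gT : finGroupType) (G : {group gT}) m d
    (rG : mx_representation F G m) (rG' : mx_representation F G d)
    (S : 'M_m) (Phi : 'M_(m, d)) (modS : mxmodule rG S) (modT : mxmodule rG' <<S *m Phi>>%MS) :
    (forall g, g \in G -> rG g *m Phi = Phi *m rG' g) ->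
    mxsimple rG S -> S *m Phi != 0 ->
  mx_rsim (submod_repr modS) (submod_repr modT).
Proof.
move=> equiv [_ _ simS] nz; set H := <<_>>%MS in modT *.
have modK : mxmodule rG (S :&: kermx Phi)%MS.
  apply: capmx_module => //; apply/mxmoduleP => g Gg; apply/sub_kermxP.
  by rewrite -mulmxA equiv // mulmxA mulmx_ker mul0mx.
have K0 : (S :&: kermx Phi = 0)%MS.
  apply/eqP; apply: contraR nz => nzK.
  have := submx_trans (simS _ modK (capmxSl _ _) nzK) (capmxSr _ _).
  by move/sub_kermxP => ->.
have sH m1 (u : 'M_(m1, \rank S)) : (val_submod u *m Phi <= H)%MS.
  by rewrite genmxE submxMr // val_submodP.
have linH m1 (u : 'M_(m1, \rank S)) :
    u *m in_submod H (val_submod 1%:M *m Phi) = in_submod H (val_submod u *m Phi).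
  by rewrite in_submodE [RHS]in_submodE (val_submodE u) !mulmxA.
exists (in_submod H (val_submod 1%:M *m Phi)) => [||g Gg].
- by rewrite genmxE -(mxrank_mul_ker S Phi) K0 mxrank0 addn0.
- rewrite -kermx_eq0; apply/rowV0P => u /sub_kermxP; rewrite linH => /eqP.
  rewrite -val_submod_eq0 in_submodK // => /eqP uPhi; apply/eqP.
  by rewrite -val_submod_eq0 -submx0 -K0 sub_capmx val_submodP; apply/sub_kermxP.
rewrite linH -(in_submodJ modT) //; congr in_submod.
by rewrite -[submod_repr modS g]mul1mx (val_submodJ modS) // -mulmxA equiv // mulmxA.
Qed.

Section Decomposition.
Variables (F : numClosedFieldType) (k : nat).
Hypothesis k_gt0 : (0 < k)%N.
Local Notation n := (3 * k + 1)%N.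
Local Notation tr := (word_repr F n 'I_k.+1).
Local Notation H := (top_cycles F n k).
Implicit Types l : intpart n.

Let char0 : [pchar F] =i pred0. Proof. exact: pchar_num. Qed.

Let U l := <<specht_mx F l *m embed_mx F l>>%MS.

Let U_module l : mxmodule tr (U l).
Proof.
apply/mxmoduleP => g Gg; rewrite genmxE (eqmxMr _ (genmxE _)) -mulmxA -embed_mx_equiv mulmxA.
by rewrite submxMr // (mxmoduleP (specht_module F l)).
Qed.

Let U_neq0 l : odd_intpart l -> specht_mx F l *m embed_mx F l != 0.
Proof.
move=> odd_l; apply: contraNneq (embed_std_neq0 F odd_l) => S0.
have /submxP[D ->] := polytabloid_sub F (std_tableau_in odd_l).
by rewrite -mulmxA S0 mulmx0.
Qed.

Let U_rsim l : odd_intpart l -> mx_rsim (specht_repr F l) (submod_repr (U_module l)).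
Proof.
move=> odd_l; apply: simple_image_rsim (U_neq0 odd_l) => [g _|].
  exact: embed_mx_equiv.
exact: specht_simple.
Qed.

Let U_simple l : odd_intpart l -> mxsimple tr (U l).
Proof.
move=> odd_l; apply/(submod_mx_irr (U_module l)); apply: mx_rsim_irr (U_rsim odd_l) _.
by apply/submod_mx_irr; apply: specht_simple.
Qed.

Let U_inj l l' : odd_intpart l -> odd_intpart l' -> mx_iso tr (U l) (U l') -> l = l'.
Proof.
move=> odd_l odd_l' /(mx_rsim_iso (U_module l) (U_module l')) iso.
apply: (specht_rsim_inj char0); apply: mx_rsim_trans (U_rsim odd_l) _.
exact: mx_rsim_trans iso (mx_rsim_sym (U_rsim odd_l')).
Qed.

Let U_sub l : odd_intpart l -> (U l <= H)%MS.
Proof. by move=> odd_l; rewrite genmxE embed_sub. Qed.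

Let A := [set l : intpart n | odd_intpart l].
Let UI (i : 'I_#|A|) := U (enum_val i).

Let odd_enum (i : 'I_#|A|) : odd_intpart (enum_val i).
Proof. by have := enum_valP i; rewrite inE. Qed.

Let dxU : mxdirect (\sum_i UI i).
Proof.
have [J [defJ dxJ]] := sum_mxsimple_direct_sub (fun i => U_simple (odd_enum i)) (eqmx_refl (\sum_i UI i)%MS).
suff J1 : J = setT.
  have sumJ (R : Type) (idx : R) (op : Monoid.com_law idx) (E : 'I_#|A| -> R) :
      \big[op/idx]_i E i = \big[op/idx]_(i in J) E i.
    by apply: eq_bigl => i; rewrite J1 inE.
  by rewrite mxdirectE /= (sumJ _ _ _ UI) (sumJ _ _ _ (fun i => \rank (UI i))) -mxdirectE.
apply/setP => i; rewrite inE; apply/idP.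
have sUJ : (UI i <= (\sum_(j in J) UI j)%MS *m 1%:M)%MS.
  rewrite mulmx1; apply: submx_trans (_ : UI i <= \sum_j UI j)%MS _.
    exact: (sumsmx_sup i).
  by case/eqmxP/andP: defJ.
(* A simple submodule of a sum of simple modules is isomorphic to one of them, and distinct odd
   partitions give nonisomorphic modules. *)
have [] := hom_mxsemisimple_iso (U_simple (odd_enum i)) _ _ sUJ.
- by move=> j _ _; apply: U_simple.
- exact: scalar_mx_hom.
move=> j Jj /(U_inj (odd_enum j) (odd_enum i))/enum_val_inj <-.
exact: Jj.
Qed.

(** A nonzero complement [W] would be one summand more than the number of conjugacy classes allows,
    by [card_classes_Sym]. *)
Let defH : (\sum_i UI i :=: H)%MS.
Proof.
set S := (\sum_i UI i)%MS.
have modS : mxmodule tr S by apply: sumsmx_module => i _; apply: U_module.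
have sSH : (S <= H)%MS by apply/sumsmx_subP => i _; apply: U_sub.
have pG : [pchar F]^'.-group [set: 'S_n].
  by rewrite /pgroup pcharf'_nat ((pcharf0P F).1 char0) -lt0n cardG_gt0.
have redH : mx_completely_reducible tr H.
  by apply: mx_reducibleS (mx_Maschke_pchar tr pG); rewrite ?top_cycles_module ?submx1.
have [W modW defSW dxSW] := redH S modS sSH.
have [W0|nzW] := eqVneq W 0.
  by apply: eqmx_trans defSW; rewrite W0; apply/eqmx_sym; apply: addsmx0.
pose M (i : 'I_#|A|.+1) := if unlift ord_max i is Some j then UI j else W.
have Mw j : M (widen_ord (leqnSn _) j) = UI j.
  rewrite /M (_ : widen_ord _ j = lift ord_max j) ?liftK //.
  by apply/val_inj/esym; apply: lift_max.
have Mm : M ord_max = W by rewrite /M unlift_none.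
have sumM : (\sum_i M i :=: H)%MS.
  apply: eqmx_trans defSW; rewrite big_ord_recr /= Mm.
  by under eq_bigr do rewrite Mw.
have dxM : mxdirect (\sum_i M i).
  rewrite mxdirectE /= sumM -defSW (mxdirectP dxSW) /= big_ord_recr /= Mm eqn_add2r.
  by under [X in _ == X]eq_bigr do rewrite Mw; have := dxU; rewrite mxdirectE.
have := card_top_cycles_summands k_gt0 _ _ sumM dxM.
rewrite card_ord => /(_ _ _)/leq_trans/(_ (card_classes_Sym k)).
rewrite ltnn => H0; suff: false by []; apply: H0 => i.
  by rewrite /M; case: unlift => [j|//]; apply: U_module.
rewrite /M; case: unlift => [j|//]; by have [] := U_simple (odd_enum j).
Qed.

Lemma top_cycles_rsim :
  mx_rsim (submod_repr (top_cycles_module F n k))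
    (\big[dadd_grepr/grepr0]_(l : intpart n | odd_intpart l) specht_repr F l).
Proof.
(* [mx_rsim_dsum] asks for an isomorphism at every index, so [rU] takes the module [U l] itself as a
   default where [l] is not odd. *)
pose rU l := if odd_intpart l then specht_repr F l else Representation (submod_repr (U_module l)).
rewrite (eq_bigr rU) => [|l odd_l]; last by rewrite /rU odd_l.
have sumA (R : Type) (idx : R) (op : Monoid.com_law idx) (E : intpart n -> R) :
    \big[op/idx]_(l | odd_intpart l) E l = \big[op/idx]_(i < #|A|) E (enum_val i).
  by rewrite -(big_enum_val E); apply: eq_bigl => l; rewrite inE.
apply: (mx_rsim_dsum (U := U) (modU := U_module)).
- by apply: eqmx_trans defH; rewrite (sumA _ _ _ U).
- by have := dxU; rewrite !mxdirectE /= (sumA _ _ _ U) (sumA _ _ _ (fun l => \rank (U l))).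
move=> l; rewrite /rU; case: ifP => odd_l; last exact: mx_rsim_refl.
exact/mx_rsim_sym/U_rsim.
Qed.

End Decomposition.

Local Close Scope ring_scope.
Local Close Scope group_scope.

Theorem theorem5p11 (R : realType) (k : nat) (hk : (0 < k)%N) :
  mx_rsim
    (reduced_homology R[i] (@matching_complex_acts 3 (3 * k + 1)) k.-1)
    (\big[dadd_grepr/grepr0]_(
        l : intpart (3 * k + 1) | (size (parts l) == k.+1) && all odd (parts l))
       specht_repr R[i] l).
Proof.
case: k hk => // p hp.
exact: mx_rsim_trans (homology_rsim R[i] p) (top_cycles_rsim R[i] hp).
Qed.
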